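(* Suppose that a group $G$ has a finite-index subgroup $F$ which is a free product $F=\ast_{i\in I}G_i$ of left-orderable groups $G_i$. Then, for any nontrivial free subgroups $A$ and $B$ of $G$ that intersect trivially every subgroup of $G$ conjugate to one of the $G_i$, the following inequality holds: $$\operatorname{rank}(A\cap B)-1\le |G:F|\cdot(\operatorname{rank}(A)-1)\cdot(\operatorname{rank}(B)-1).$$
   Context: A left-orderable group is a group admitting a linear (total) order such that $x\le y$ implies $zx\le zy$ for all elements $x,y,z$. For a free group $H$, $\operatorname{rank}(H)$ is the cardinality of a free basis of $H$ (the trivial group is free of rank $0$). $|G:F|$ is the index of $F$ in $G$. The ranks of $A$ and $B$ may be infinite; the inequality is understood in the sense of cardinal arithmetic (so $\kappa-1=\kappa$ for infinite $\kappa$, and $0\cdot\kappa=0$); if $A\cap B$ is trivial the left-hand side is $-1$. *)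

(* Defs.v *)
From mathcomp Require Export all_boot.
From mathcomp Require Export boolp classical_sets functions cardinality.

Set Implicit Arguments.
Unset Strict Implicit.
Unset Printing Implicit Defensive.


Local Open Scope classical_set_scope.
Local Open Scope group_scope.

(* [groupType] is the type of arbitrary, possibly infinite, groups. Subgroups
   are classical sets of elements of the ambient group. *)
Definition is_subgroup (G : groupType) (H : set G) : Prop :=
  group_closed (mem H).

Definition left_coset (G : groupType) (F : set G) (x : G) : set G :=
  [set x * h | h in F].

(* The index |G : F| is the cardinality of this set. *)
Definition left_cosets (G : groupType) (F : set G) : set (set G) :=
  range (left_coset F).

Definition conjugate (G : groupType) (H : set G) (g : G) : set G :=
  [set h ^ g | h in H].

Definition left_orderable (G : groupType) (H : set G) : Prop :=
  exists le : rel G,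
    [/\ {in H, reflexive le}, {in H &, antisymmetric le},
        {in H & &, transitive le}, {in H &, total le}
      & {in H & &, forall z x y, le x y -> le (z * x) (z * y)}].

(* Normal forms of a free product: words (i_1, g_1) ... (i_n, g_n) with each
   g_k a nontrivial element of G_(i_k) and i_k <> i_(k+1). *)
Definition reduced_product_word (G : groupType) (I : Type) (Gi : I -> set G)
    (s : seq (I * G)) : bool :=
  all (fun a => (a.2 \in Gi a.1) && (a.2 != 1)) s
  && sorted (fun a b => `[< a.1 <> b.1 >]) s.

(* F is the (internal) free product of its subgroups G_i: every element of F
   is the product of exactly one reduced word. *)
Definition is_free_product (G : groupType) (I : Type) (Gi : I -> set G)
    (F : set G) : Prop :=
  (forall i, is_subgroup (Gi i)) /\
  set_bij [set s | reduced_product_word Gi s] F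
          (fun s => \prod_(a <- s) a.2).

(* The letter (x, false) stands for x and (x, true) for x^-1; a word is reduced
   when no letter is followed by its inverse. *)
Definition letter_val (G : groupType) (a : G * bool) : G :=
  if a.2 then a.1^-1 else a.1.

Definition reduced_word (G : groupType) (X : set G) (s : seq (G * bool)) : bool :=
  all (fun a => a.1 \in X) s
  && sorted (fun a b => (a.1 == b.1) ==> (a.2 == b.2)) s.

Definition is_free_basis (G : groupType) (H X : set G) : Prop :=
  set_bij [set s | reduced_word X s] H
          (fun s => \prod_(a <- s) letter_val a).

Definition is_free_subgroup (G : groupType) (H : set G) : Prop :=
  is_subgroup H /\ exists X, is_free_basis H X.

(* X with one element removed: a set of cardinality |X| - 1, which is |X| when
   X is infinite. For X empty this is empty instead of having "cardinality -1";
   this is harmless on the left of an inequality whose right-hand side is a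
   cardinal, as both -1 and 0 are below every cardinal. *)
Definition minus_one (G : groupType) (X : set G) : set G :=
  X `\ xget 1 X.

(* Main.v *)
Require Import Defs.
From mathcomp Require Import ssralg ssrnum ssrint finmap zify.

(* G acts on a forest made of |G : F| copies of the Bass-Serre tree of F. Edge
   stabilizers are trivial and, free products of left-orderable groups being
   left-orderable, the edges of each tree have a G-invariant total order. Inside
   a subforest, call an edge a bridge if it is the largest edge of some
   bi-infinite line; equivalently, it is not the least edge of the coboundary of
   a finite set of vertices. A bridge of a subforest of S is a bridge of S.

   Let A have finite rank and let S_A be the convex hull of the A-orbits of one
   base point per tree; it has finitely many edges modulo A. Add the edges of S_A
   in increasing order: an edge that is not a bridge merges a finite component
   into another one, and thereby kills the least vertex of the younger component.
   No vertex survives, since the union of its components would be a set with a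
   nontrivial stabilizer but a unique survivor. Hence non-bridges and vertices
   are in equivariant bijection, and the Euler characteristic shows that there
   are |G : F| (rank A - 1) orbits of bridges. The intersection of A and B acts
   on the intersection of S_A and S_B, where the injectivity of the pairing
   alone gives at least |G : F| (rank (A cap B) - 1) orbits of bridges; sending
   an edge to its A-orbit and its B-orbit is injective on these, so that
   |G : F| (rank (A cap B) - 1) <= |G : F|^2 (rank A - 1) (rank B - 1).

   This is the argument of Mineyev and Dicks for the Hanna Neumann conjecture,
   as extended by Klyachko and Ponfilenko. *)

(** The geometry of the trees enters through two facts: vertices of one sheet are joined by walks
    ([walk]), and every [bool]-valued function of the edges is a coboundary ([integral]), which is
    acyclicity mod 2. Half-trees, separation and convex hulls are expressed through functions whose
    coboundary is a single edge ([cut]). The Euler characteristic needs no homology either: sets of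
    [bool]-valued functions, each described by finitely many free bits, are injected into one
    another, and comparing powers of 2 compares numbers of orbits.

    The two inequalities are kept apart because they ask for different things. The lower bound for
    orbits of bridges accepts any finite part of a basis. So it applies to the intersection before
    its rank is known to be finite, and it excludes an infinite basis by itself. The upper bound
    asks for a finite basis and an infinite group.

    If A or B has infinite rank, hulls are of no help and the inequality is cardinal arithmetic: a
    free group of infinite rank has no more elements than its rank. *)

Set Implicit Arguments.
Unset Strict Implicit.
Unset Printing Implicit Defensive.

Local Open Scope classical_set_scope.
Local Open Scope card_scope.
Local Open Scope group_scope.

(** * Counting equivalence classes *)

Section ClassCount.
Local Open Scope nat_scope.

(** A surjective numbering whose fibres are the classes. It makes [R] an equivalence relation on [S]
    by itself, so no quotient has to be formed. *)
Definition class_count (T : Type) (S : set T) (R : T -> T -> Prop) (k : nat) :=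
  exists idx : T -> nat,
    [/\ forall x, S x -> idx x < k,
        forall x y, S x -> S y -> (idx x = idx y <-> R x y)
      & forall j, j < k -> exists2 x, S x & idx x = j].

(** [Q] is a relation because the pairing [kills] is one. Values are chosen at one representative
    per class only, and injectivity is asked only up to the equivalences. *)
Lemma class_count_le (T U : Type) (S : set T) (R : T -> T -> Prop) k
    (S' : set U) (R' : U -> U -> Prop) k' (Q : T -> U -> Prop) :
  (forall x, S x -> exists2 y, S' y & Q x y) ->
  (forall x x' y y', S x -> S x' -> S' y -> S' y' ->
     Q x y -> Q x' y' -> R' y y' -> R x x') ->
  class_count S R k -> class_count S' R' k' -> k <= k'.
Proof.
move=> Qtot Qinj [idx [idxlt idxR idxs]] [idx' [idx'lt idx'R _]].
have ch (j : 'I_k) : exists y : 'I_k', exists x x',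
    [/\ S x, S' x', Q x x', idx x = j & idx' x' = y].
  have [x Sx xj] := idxs _ (ltn_ord j).
  have [x' Sx' Qx] := Qtot _ Sx.
  by exists (Ordinal (idx'lt _ Sx')), x, x'.
have [f fP] := choice ch.
have inj : injective f.
  move=> i j fij; have [x [x' [Sx Sx' Qx xi x'i]]] := fP i.
  have [y [y' [Sy Sy' Qy yj y'j]]] := fP j.
  apply/val_inj => /=; rewrite -xi -yj; apply/idxR => //.
  by apply: (Qinj _ _ x' y') => //; apply/idx'R => //; rewrite x'i y'j fij.
by rewrite -(card_ord k) -(card_ord k'); apply: leq_card inj.
Qed.

Lemma class_count_prod (T U : Type) (S : set T) (R : T -> T -> Prop) k
    (S' : set U) (R' : U -> U -> Prop) k' :
  class_count S R k -> class_count S' R' k' ->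
  class_count (S `*` S') (fun p q => R p.1 q.1 /\ R' p.2 q.2) (k * k').
Proof.
move=> [idx [idxlt idxR idxs]] [idx' [idx'lt idx'R idx's]].
exists (fun p => idx p.1 * k' + idx' p.2); split.
- move=> [x y] [/= /idxlt hx /idx'lt hy]; nia.
- move=> [x y] [x' y'] [/= Sx Sy] [/= Sx' Sy'].
  split=> [eq|[/(idxR _ _ Sx Sx')-> /(idx'R _ _ Sy Sy')->] //].
  have hy := idx'lt _ Sy; have hy' := idx'lt _ Sy'.
  have k'0 : 0 < k' by apply: leq_ltn_trans hy.
  have e1 : idx x = idx x'.
    by have := congr1 (divn^~ k') eq; rewrite /= !divnMDl // !divn_small // !addn0.
  have e2 : idx' y = idx' y'.
    by have := congr1 (modn^~ k') eq; rewrite /= !modnMDl !modn_small.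
  by split; [apply/idxR|apply/idx'R].
- move=> j jlt; have k'0 : 0 < k' by nia.
  have [x Sx xj] : exists2 x, S x & idx x = j %/ k'.
    by apply: idxs; rewrite ltn_divLR.
  have [y Sy yj] : exists2 y, S' y & idx' y = j %% k'.
    by apply: idx's; rewrite ltn_mod.
  by exists (x, y) => //=; rewrite xj yj -divn_eq.
Qed.

Lemma class_count_sub (T : Type) (S N : set T) (R : T -> T -> Prop) k :
  class_count S R k -> N `<=` S ->
  (forall x y, S x -> S y -> R x y -> N x -> N y) ->
  exists k1 k2, [/\ class_count N R k1, class_count (S `\` N) R k2
    & k = k1 + k2].
Proof.
move=> [idx [idxlt idxR idxs]] NS Ninv.
have Rsym x y : S x -> S y -> R x y -> R y x.
  by move=> Sx Sy /(idxR _ _ Sx Sy) e; apply/idxR.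
have gen (M : set T) : M `<=` S ->
    (forall x y, S x -> S y -> R x y -> M x -> M y) ->
    class_count M R #|[pred j : 'I_k | `[< exists2 x, M x & idx x = j >]]|.
  move=> MS Minv; set P := [pred j | _].
  have PM x (Mx : M x) : Ordinal (idxlt _ (MS _ Mx)) \in P.
    by apply/asboolP; exists x.
  pose ix x := if pselect (M x) is left Mx
    then nat_of_ord (enum_rank_in (PM x Mx) (Ordinal (idxlt _ (MS _ Mx)))) else 0.
  have ixE x (Mx : M x) :
      ix x = index (Ordinal (idxlt _ (MS _ Mx))) (enum P).
    rewrite /ix; case: pselect => // Mx'.
    rewrite (Prop_irrelevance Mx' Mx) enum_rank_in.unlock /insubd insubT //=.
    by rewrite cardE index_mem mem_enum.
  exists ix; split.
  - by move=> x Mx; rewrite (ixE _ Mx) cardE index_mem mem_enum.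
  - move=> x y Mx My; rewrite -(idxR _ _ (MS _ Mx) (MS _ My)).
    rewrite (ixE _ Mx) (ixE _ My); split.
      move/(congr1 (nth (Ordinal (idxlt _ (MS _ Mx))) (enum P))).
      by rewrite !nth_index ?mem_enum // => -[].
    by move=> e; congr index; apply/val_inj.
  - move=> j jlt; pose i := enum_val (Ordinal jlt).
    have /asboolP[x Mx xi] : i \in P by exact: enum_valP.
    exists x => //; rewrite (ixE _ Mx).
    have -> : Ordinal (idxlt _ (MS _ Mx)) = i by apply/val_inj.
    have jlt' : j < size (enum P) by rewrite -cardE.
    by rewrite /i (enum_val_nth i) /= index_uniq ?enum_uniq.
exists #|[pred j : 'I_k | `[< exists2 x, N x & idx x = j >]]|.
exists #|[pred j : 'I_k | `[< exists2 x, (S `\` N) x & idx x = j >]]|.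
split; [exact: gen|apply: gen|].
- by move=> x [].
- move=> x y Sx Sy xy [_ Nx]; split => // Ny; apply: Nx.
  by apply: Ninv Ny => //; apply: Rsym.
(* Since [N] is a union of classes, each index is met by exactly one of the two parts. *)
rewrite -[LHS](card_ord k) -[LHS](cardC [pred j : 'I_k | `[< exists2 x, N x & idx x = j >]]).
congr (_ + _); apply: eq_card => j; rewrite !inE /=.
apply/idP/asboolP => [/asboolPn nN|[x [Sx nNx] xj]].
  have [x Sx xj] := idxs _ (ltn_ord j).
  by exists x => //; split => // Nx; apply: nN; exists x.
apply/asboolPn => -[y Ny yj]; apply: nNx; apply: (Ninv y) => //; first exact: NS.
by apply/idxR => //; [exact: NS|rewrite xj yj].
Qed.

(** The list must meet every class but may leave [S]; the induction therefore looks for some [z] in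
    [S] equivalent to the head [y]. *)
Lemma class_count_fin (T : Type) (S : set T) (R : T -> T -> Prop) (s : seq T) :
  (forall x, R x x) -> (forall x y, R x y -> R y x) ->
  (forall x y z, R x y -> R y z -> R x z) ->
  (forall x, S x -> exists2 y, List.In y s & R x y) ->
  exists k, class_count S R k.
Proof.
move=> Rr Rs Rt; elim: s S => [|y s IH] S Ss.
  exists 0; exists (fun=> 0); split => // [x|x y] Sx.
    by have [? []] := Ss _ Sx.
  by have [? []] := Ss _ Sx.
have [|k [idx [idxlt idxR idxs]]] := IH (S `&` [set x | ~ R x y]).
  move=> x [Sx nR]; have [z [<- //|zs] xz] := Ss _ Sx; first by exists z.
have [[z Sz zy]|nz] := pselect (exists2 z, S z & R z y); last first.
  exists k; exists idx; split.
  - by move=> x Sx; apply: idxlt; split => // xy; apply: nz; exists x.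
  - move=> x x' Sx Sx'; apply: idxR; split => // xy; apply: nz; by [exists x|exists x'].
  - by move=> j /idxs[x [Sx _] xj]; exists x.
exists k.+1; exists (fun x => if `[< R x y >] then k else idx x); split.
- move=> x Sx; case: asboolP => // nR; exact/ltnW/idxlt.
- move=> x x' Sx Sx'; case: asboolP => xy; case: asboolP => x'y.
  + by split => // _; apply: Rt xy _; exact: Rs.
  + split=> [e|xx']; first by have := idxlt x' (conj Sx' x'y); rewrite -e ltnn.
    by case: x'y; apply: Rt xy; exact: Rs.
  + split=> [e|xx']; first by have := idxlt x (conj Sx xy); rewrite e ltnn.
    by case: xy; apply: Rt xx' x'y.
  + exact: idxR.
- move=> j; rewrite ltnS leq_eqVlt => /orP[/eqP->|jk].
    by exists z => //; case: asboolP.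
  by have [x [Sx nR] xj] := idxs _ jk; exists x => //; case: asboolP.
Qed.

End ClassCount.

(** * Free groups *)

Section Subgroups.
Variables (G : groupType) (H : set G).
Hypothesis Hs : is_subgroup H.

Lemma subgroup1 : H 1.
Proof. by case: Hs => + _; rewrite in_setE. Qed.

Lemma subgroup_div x y : H x -> H y -> H (x / y).
Proof. by case: Hs => _ Hd Hx Hy; have := Hd x y; rewrite !in_setE; exact. Qed.

Lemma subgroupV x : H x -> H x^-1.
Proof. by move=> Hx; rewrite -[x^-1]mul1g; exact: subgroup_div subgroup1 Hx. Qed.

Lemma subgroupM x y : H x -> H y -> H (x * y).
Proof. by move=> Hx Hy; rewrite -[y]invgK; exact: subgroup_div (subgroupV Hy). Qed.

End Subgroups.

Lemma subgroupI (G : groupType) (H K : set G) :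
  is_subgroup H -> is_subgroup K -> is_subgroup (H `&` K).
Proof.
move=> Hs Ks; split=> [|x y]; rewrite !in_setE /=.
  by split; exact: subgroup1.
by move=> [Hx Kx] [Hy Ky]; split; exact: subgroup_div.
Qed.

Notation word_val s := (\prod_(a <- s) letter_val a).
Notation no_backtrack :=
  (fun a b : _ * bool => (a.1 == b.1) ==> (a.2 == b.2)).

Lemma sorted_rcons2 (T : Type) (e : rel T) s a b :
  sorted e (rcons (rcons s a) b) = sorted e (rcons s a) && e a b.
Proof. by case: s => [|c s] /=; rewrite ?andbT // rcons_path last_rcons. Qed.

Lemma sorted_rconsW (T : Type) (e : rel T) s a :
  sorted e (rcons s a) -> sorted e s.
Proof. by elim/last_ind: s => // s b _; rewrite sorted_rcons2 => /andP[]. Qed.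

Lemma word_val_cat (G : groupType) (s t : seq (G * bool)) :
  word_val (s ++ t) = word_val s * word_val t.
Proof. by rewrite big_cat. Qed.

Section Words.
Variables (G : groupType) (X : set G).

Let letters (s : seq (G * bool)) := all (fun a => a.1 \in X) s.

Lemma word_val_rcons (s : seq (G * bool)) a :
  word_val (rcons s a) = word_val s * letter_val a.
Proof. by rewrite -cats1 big_cat big_seq1. Qed.

Lemma reduced_word_rconsW s a : reduced_word X (rcons s a) -> reduced_word X s.
Proof.
by rewrite /reduced_word all_rcons => /andP[/andP[_ sX] sr]; rewrite sX (sorted_rconsW sr).
Qed.

Lemma reduced_word_step s a : reduced_word X s -> X a.1 ->
  exists s', reduced_word X s' /\ word_val s' = word_val s * letter_val a.
Proof.
elim/last_ind: s => [|s b _] sr Xa.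
  exists [:: a]; rewrite /reduced_word /= big_nil mul1g big_seq1.
  by rewrite andbT mem_set.
have [bt|nbt] := boolP (no_backtrack b a).
  exists (rcons (rcons s b) a); rewrite word_val_rcons; split => //.
  move: sr; rewrite /reduced_word !all_rcons sorted_rcons2 bt andbT.
  by rewrite (mem_set Xa).
exists s; split; first exact: reduced_word_rconsW sr.
rewrite word_val_rcons -mulgA [letter_val b * _](_ : _ = 1) ?mulg1 //.
move: nbt; rewrite /letter_val; case: a b {Xa sr} => [x [|]] [y [|]] //=;
  rewrite negb_imply => /andP[/eqP-> //]; by rewrite ?mulgV ?mulVg.
Qed.

Lemma reduced_word_exists s : letters s ->
  exists s', reduced_word X s' /\ word_val s' = word_val s.
Proof.
elim/last_ind: s => [|s a IH]; first by exists [::].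
rewrite /letters all_rcons => /andP[]; rewrite in_setE => Xa /IH[s' [s'r s'v]].
have [t [tr tv]] := reduced_word_step s'r Xa.
by exists t; split => //; rewrite tv s'v word_val_rcons.
Qed.

Lemma word_val_subgroup (H : set G) s :
  is_subgroup H -> X `<=` H -> letters s -> H (word_val s).
Proof.
move=> Hs XH; elim: s => [_|a s IH /andP[]].
  by rewrite big_nil; exact: subgroup1.
rewrite in_setE big_cons => /XH Ha /IH; apply: subgroupM => //.
by rewrite /letter_val; case: ifP => _ //; exact: subgroupV.
Qed.

End Words.

Section FreeBasis.
Variables (G : groupType) (H X : set G).
Hypotheses (Hs : is_subgroup H) (HX : is_free_basis H X).

Lemma free_basis_sub : X `<=` H.
Proof.
move=> x Xx; have [Hf _ _] := HX.
have := Hf [:: (x, false)]; rewrite /= big_seq1 /letter_val /=; apply.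
by rewrite /reduced_word /= andbT mem_set.
Qed.

Lemma free_basis_word h : H h ->
  exists s, reduced_word X s /\ word_val s = h.
Proof. by move=> Hh; have [_ _ /(_ h Hh)[s /= sr sv]] := HX; exists s. Qed.

Lemma free_basis_uniq s t : reduced_word X s -> reduced_word X t ->
  word_val s = word_val t -> s = t.
Proof. by move=> sr tr; have [_ Hi _] := HX; apply: Hi; rewrite in_setE. Qed.

(** Connectedness of the Cayley graph of [H]. For an inverse letter the hypothesis is applied at the
    end point of the step. *)
Lemma free_basis_const (T : Type) (f : G -> T) :
  (forall h x, H h -> X x -> f (h * x) = f h) -> forall h, H h -> f h = f 1.
Proof.
move=> fX h /free_basis_word[s [/andP[sX _] <-]]; elim/last_ind: s sX => [|s a IH].
  by rewrite big_nil.
rewrite all_rcons word_val_rcons => /andP[]; rewrite in_setE => Xa sX.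
rewrite -(IH sX); have Hs' := word_val_subgroup Hs free_basis_sub sX.
rewrite /letter_val; case: ifP => _; last exact: fX.
rewrite -(fX _ a.1) ?mulgVK //; apply: subgroup_div => //; exact: free_basis_sub.
Qed.

(** Acyclicity of the Cayley graph mod 2: [phi h] sums [eps] along the normal form of [h]. Appending
    a generator either lengthens the normal form or deletes a final inverse letter, which stands for
    the same edge. *)
Lemma free_basis_integral (eps : G -> G -> bool) :
  exists phi : G -> bool, phi 1 = false /\
    forall h x, H h -> X x -> phi (h * x) = phi h (+) eps h x.
Proof.
(* An inverse letter read at [g] crosses the edge that starts at [g * a.1^-1]. *)
pose cross g (a : G * bool) := eps (if a.2 then g * a.1^-1 else g) a.1.
pose Phi := fix Phi g s :=
  if s is a :: s' then cross g a (+) Phi (g * letter_val a) s' else false.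
have PhiR g s a : Phi g (rcons s a) = Phi g s (+) cross (g * word_val s) a.
  elim: s g => [|b s IH] g /=; first by rewrite big_nil mulg1 addbF.
  by rewrite IH big_cons mulgA addbA.
have /choice[nf nfP] : forall h, exists s : seq (G * bool), H h ->
    reduced_word X s /\ word_val s = h.
  move=> h.
  by have [/free_basis_word[s ?]|nH] := pselect (H h); [exists s|exists [::]].
have nfE s : reduced_word X s -> nf (word_val s) = s.
  move=> sr; have Hw : H (word_val s).
    by case/andP: sr => sX _; exact: word_val_subgroup free_basis_sub sX.
  by have [nr nv] := nfP _ Hw; apply: free_basis_uniq.
exists (fun h => Phi 1 (nf h)); split.
  by have := nfE [::]; rewrite big_nil => ->.
move=> h x Hh Xx; have [nr nv] := nfP _ Hh.
have [s sE] : exists s, s = nf h by exists (nf h).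
move: sE nr nv => <-; case/lastP: s => [|s a] sr nv.
  have <- : word_val [:: (x, false)] = h * x.
    by rewrite big_seq1 -nv big_nil mul1g.
  rewrite nfE /= ?mulg1 ?addbF; last by rewrite /reduced_word /= andbT mem_set.
  by rewrite /cross /= -nv big_nil.
rewrite -nv.
have [e|ne] := eqVneq a (x, true).
  rewrite e word_val_rcons /letter_val /= mulgVK nfE; last exact: reduced_word_rconsW sr.
  by rewrite PhiR mul1g /cross /= -addbA addbb addbF.
have <- : word_val (rcons (rcons s a) (x, false)) = word_val (rcons s a) * x.
  by rewrite word_val_rcons.
rewrite nfE; first by rewrite PhiR mul1g.
move: sr; rewrite /reduced_word !all_rcons sorted_rcons2 /= (mem_set Xx) /=.
move=> /andP[-> ->] /=; apply/implyP => /eqP ax; move: ne.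
by case: a ax {nv} => y [] //= ->; rewrite eqxx.
Qed.

End FreeBasis.

(** * Free bases recognized by cuts of the Cayley graph *)

Section FreeBasisCriterion.
Variables (G : groupType) (H Z : set G).
Hypotheses (Hs : is_subgroup H) (ZH : Z `<=` H).
Hypothesis Zgen : forall h, H h ->
  exists2 s, all (fun a => a.1 \in Z) s & word_val s = h.
(* The edge from h to h * z disconnects the Cayley graph of H. *)
Hypothesis Zcut : forall h z, H h -> Z z -> exists phi : G -> bool,
  forall h' z', H h' -> Z z' ->
    phi (h' * z') = phi h' (+) `[< h' = h /\ z' = z >].

(** A reduced word of value 1 is a closed walk, so it must cross its first edge again, as [phi]
    changes there. If the crossing letter [b] has the direction of [a], then [a :: u] is a shorter
    closed walk. If it has the opposite direction, then [u] is closed, hence empty by induction, and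
    [b] cancels [a]. *)
Lemma reduced_word_neq1 s : reduced_word Z s -> s <> [::] -> word_val s <> 1.
Proof.
elim: {s}(size s).+1 {-2}s (ltnSn (size s)) => // n IH [|a t] // sz sr _ s1.
have [szt /andP[/= /andP[aZ tZ] tp]] : (size t < n)%N /\ reduced_word Z (a :: t) by [].
have Ha : H (letter_val a).
  by rewrite /letter_val; case: ifP => _; [apply: subgroupV => //|]; apply: ZH; rewrite in_setE in aZ.
have Hbase g b : H g -> b.1 \in Z -> H (if b.2 then g * b.1^-1 else g).
  by rewrite in_setE; case: ifP => // _ Hg Zb; apply: subgroup_div => //; exact: ZH.
pose base g (b : G * bool) := if b.2 then g * b.1^-1 else g.
have aZ' := aZ; rewrite in_setE in aZ'.
have [phi phiE] := Zcut (Hbase _ _ (subgroup1 Hs) aZ) aZ'.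
have step g b : H g -> b.1 \in Z -> phi (g * letter_val b) =
    phi g (+) `[< base g b = base 1 a /\ b.1 = a.1 >].
  move=> Hg bZ; have := Hbase g b Hg bZ; rewrite in_setE in bZ.
  rewrite /base /letter_val; case: b.2 => Hg'; last exact: phiE.
  by have := phiE _ _ Hg' bZ; rewrite mulgVK => ->; rewrite -addbA addbb addbF.
have := step 1 a (subgroup1 Hs) aZ; rewrite mul1g asboolT // addbT => phia.
suff const u v : t = u ++ v -> phi (letter_val a * word_val u) = phi (letter_val a).
  have := const t [::]; rewrite cats0 => /(_ erefl).
  by move: s1; rewrite big_cons => ->; rewrite phia; case: (phi 1).
elim/last_ind: u v => [|u b IHu] v tE; first by rewrite big_nil mulg1.
have tE' : t = u ++ b :: v by rewrite tE cat_rcons.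
rewrite -(IHu _ tE') word_val_rcons mulgA.
have auZ : all (fun a => a.1 \in Z) (a :: u).
  by rewrite /= aZ; move: tZ; rewrite tE' all_cat => /andP[].
have bZ : b.1 \in Z.
  by move: tZ; rewrite tE' all_cat /= => /andP[_ /andP[]].
have Hau : H (letter_val a * word_val u).
  by have := word_val_subgroup Hs ZH auZ; rewrite big_cons.
rewrite step // asboolF ?addbF // => -[be b1].
have aur : reduced_word Z (a :: u).
  rewrite /reduced_word auZ /=; move: tp; rewrite tE' cat_path.
  by case/andP.
have ur : reduced_word Z u.
  by case/andP: aur => /andP[_ uZ] /path_sorted us; apply/andP.
have szu : (size u < size t)%N by rewrite tE' size_cat /= addnS ltnS leq_addr.
have [b2|b2] := eqVneq b.2 a.2.
  apply: (IH (a :: u)) => //=; first by apply: leq_ltn_trans szt.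
  rewrite big_cons; move: be; rewrite /base b2 b1.
  by case: a.2 => // /mulIg.
have u1 : word_val u = 1.
  apply: (mulgI (letter_val a)); rewrite mulg1.
  move: be b2; rewrite /base /letter_val b1; case: (a.2); case: (b.2) => // + _.
    by rewrite mul1g.
  by move=> /(canRL (mulgK _)); rewrite mul1g invgK => ->.
have u0 : u = [::].
  apply: contrapT => un0; apply: IH u1 => //; exact: ltn_trans szt.
move: tp; rewrite tE' u0 /= => /andP[+ _]; rewrite b1 eqxx /= eq_sym.
by move/eqP/esym => e; rewrite e eqxx in b2.
Qed.

(** Equal first letters are cancelled; once they differ, the formal inverse of [s] followed by [t]
    is a nonempty reduced word of value 1. *)
Lemma reduced_word_inv s t :
  reduced_word Z s -> reduced_word Z t -> word_val s = word_val t -> s = t.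
Proof.
elim: s t => [|a s IH] [|b t] //.
- by rewrite big_nil => _ tr /esym/(reduced_word_neq1 tr); case.
- by rewrite big_nil => sr _ /(reduced_word_neq1 sr); case.
move=> sr tr; have [<-|ab] := eqVneq a b.
  rewrite !big_cons => /mulgI e; congr cons; apply: IH => //.
    by case/andP: sr => /andP[_ sZ] /path_sorted ss; apply/andP.
  by case/andP: tr => /andP[_ tZ] /path_sorted ts; apply/andP.
move=> e; exfalso.
pose flip (a : G * bool) := (a.1, ~~ a.2).
have flipV c : letter_val (flip c) = (letter_val c)^-1.
  by rewrite /letter_val /=; case: c => x [] /=; rewrite ?invgK.
have invV u : word_val (rev (map flip u)) = (word_val u)^-1.
  elim: u => [|c u IHu]; first by rewrite big_nil invg1.
  by rewrite map_cons rev_cons word_val_rcons IHu big_cons invgM flipV.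
apply: (@reduced_word_neq1 (rev (map flip (a :: s)) ++ b :: t)).
- move: sr tr => /andP[sZ ss] /andP[tZ ts]; apply/andP; split.
    by rewrite all_cat tZ andbT all_rev all_map.
  rewrite sorted_cat_cons; move: ts => /= ->; rewrite andbT.
  rewrite /= rev_cons sorted_rcons2 -rev_cons -map_cons rev_sorted.
  apply/andP; split.
    rewrite sorted_map; apply: sub_sorted ss => x y /=.
    by rewrite eq_sym; case: x.2; case: y.2.
  apply/implyP => /eqP /= ab1; move: ab; case: (a) (b) ab1 => [x p] [y q] /= <-.
  by rewrite xpair_eqE eqxx; case: p; case: q.
- by case: (rev _).
- by rewrite word_val_cat invV e mulVg.
Qed.

Lemma free_basis_criterion : is_free_basis H Z.
Proof.
split.
- by move=> s /= /andP[sZ _]; exact: word_val_subgroup ZH sZ.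
- by move=> s t; rewrite !in_setE; exact: reduced_word_inv.
- move=> h /Zgen[s sZ <-]; have [s' [s'r s'v]] := reduced_word_exists sZ.
  by exists s'.
Qed.

End FreeBasisCriterion.

(** * The Nielsen-Schreier theorem *)

Section NielsenSchreier.
Variables (G : groupType) (A X H : set G).
Hypotheses (As : is_subgroup A) (AX : is_free_basis A X).
Hypotheses (Hs : is_subgroup H) (HA : H `<=` A).

(* Partial Schreier transversals of the right cosets H a. *)
Let schreier (T : set G) :=
  [/\ T `<=` A, forall t t', T t -> T t' -> H (t / t') -> t = t'
    & forall t, T t -> exists s, [/\ all (fun a => a.1 \in X) s, word_val s = t
        & forall u v, s = u ++ v -> T (word_val u)]].

(** By Zorn's lemma. If a maximal [T] missed a coset, follow a word up to the first missed coset: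
    the product of the last representative [t] with the next letter could be added, its word being
    that of [t] with one letter appended. *)
Lemma schreier_transversal : exists T : set G,
  [/\ schreier T, T 1 & forall a, A a -> exists2 t, T t & H (a / t)].
Proof.
have [C Cschr Ctot|T [Tschr Tmax]] := @Zorn_bigcup G schreier.
  split=> [t [Y CY Yt]|t t' [Y CY Yt] [Y' CY' Yt']|t [Y CY Yt]].
  - by have [+ _ _] := Cschr _ CY; apply.
  - have [/(_ _ Yt) Yt2|/(_ _ Yt') Yt2] := Ctot _ _ CY CY'.
      by have [_ + _] := Cschr _ CY'; apply.
    by have [_ + _] := Cschr _ CY; apply.
  - have [_ _ /(_ _ Yt)[s [sX sv sp]]] := Cschr _ CY; exists s; split => // u v suv.
    by exists Y => //; exact: sp suv.
have [TA Tinj Tconn] := Tschr.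
have add t : A t -> (forall t', T t' -> ~ H (t / t')) ->
    (exists s, [/\ all (fun a => a.1 \in X) s, word_val s = t
      & forall u v, s = u ++ v -> v <> [::] -> T (word_val u)]) -> False.
  move=> At tT [s [sX sv sp]].
  have nTt : ~ T t by move=> /tT; apply; rewrite mulgV; exact: subgroup1.
  apply: (Tmax (T `|` [set t])).
    rewrite properEneq; split; last exact: subsetUl.
    by apply/eqP => e; apply: nTt; rewrite e; right.
  split=> [x [/TA|->]//|x y [Tx|->] [Ty|->] //|x [Tx|->]].
  - exact: Tinj.
  - by move=> /(subgroupV Hs); rewrite invgM invgK => /tT; case.
  - by move=> /tT; case.
  - have [s' [s'X s'v s'p]] := Tconn _ Tx; exists s'; split => // u v /s'p; by left.
  - exists s; split => // u v suv; have [v0|v0] := pselect (v = [::]).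
      by right; rewrite -sv suv v0 cats0.
    by left; exact: sp suv v0.
have T1 : T 1.
  apply: contrapT => nT1; have T0 t : ~ T t.
    move=> /Tconn[s [_ _ /(_ [::] s erefl)]]; by rewrite big_nil.
  apply: (add 1) => // [|t /T0 //|]; first exact: subgroup1.
  exists [::]; split => //; first by rewrite big_nil.
  by case=> // -[].
exists T; split => // a /(free_basis_word AX)[s [/andP[sX _] <-]].
elim/last_ind: s sX => [|s b IH].
  by move=> _; exists 1 => //; rewrite big_nil mulgV; exact: subgroup1.
rewrite all_rcons => /andP[bX sX]; have [t Tt Hst] := IH sX.
have bX' := bX; rewrite in_setE in bX'.
have Ab : A (letter_val b).
  by rewrite /letter_val; case: ifP => _; [apply: subgroupV => //|]; exact: free_basis_sub AX _ bX'.
apply: contrapT => nT; have tb t' : T t' -> ~ H (t * letter_val b / t').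
  move=> Tt' Htb; apply: nT; exists t' => //.
  rewrite word_val_rcons.
  have -> : word_val s * letter_val b / t' = (word_val s / t) * (t * letter_val b / t').
    by rewrite !mulgA mulgVK.
  exact: subgroupM.
apply: (add (t * letter_val b)) => //; first exact: subgroupM (TA _ Tt) Ab.
have [s' [s'X s'v s'p]] := Tconn _ Tt.
exists (rcons s' b); split.
- by rewrite all_rcons bX.
- by rewrite word_val_rcons s'v.
- move=> u v; case/lastP: v => // v c; rewrite -rcons_cat => /rcons_inj[/s'p Tu _] _.
  exact: Tu.
Qed.

(** The basis consists of the nontrivial Schreier generators [z t x]. Collapsing the translates of
    the spanning tree [T] turns the Cayley graph of [A] into that of [H], so cuts of the former
    provide the cuts that [free_basis_criterion] asks for. *)
Lemma free_subgroup_of_free : is_free_subgroup H.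
Proof.
have [T [[TA Tinj Tconn] T1 Ttot]] := schreier_transversal.
have /choice[r rP] : forall a, exists t, A a -> T t /\ H (a / t).
  by move=> a; have [/Ttot[t ? ?]|na] := pselect (A a); [exists t|exists 1].
have rE a t : A a -> T t -> H (a / t) -> r a = t.
  move=> Aa Tt Hat; have [Tr Hr] := rP _ Aa; apply: Tinj => //.
  have -> : r a / t = (a / r a)^-1 * (a / t) by rewrite invgM invgK !mulgA mulgVK.
  by apply: subgroupM => //; exact: subgroupV.
have rH h a : H h -> A a -> r (h * a) = r a.
  move=> Hh Aa; have [Tr Hr] := rP _ Aa; apply: rE => //.
    by apply: subgroupM => //; exact: HA.
  by rewrite -mulgA; exact: subgroupM.
have XA := free_basis_sub AX.
have rT t : T t -> r t = t.
  by move=> Tt; apply: rE => //; [exact: TA|rewrite mulgV; exact: subgroup1].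
pose z t x := t * x / r (t * x).
have Hz t x : T t -> X x -> H (z t x).
  move=> Tt Xx; have Atx : A (t * x) by apply: subgroupM => //; [exact: TA|exact: XA].
  by have [] := rP _ Atx.
pose Z := [set g | g <> 1 /\ exists t x, [/\ T t, X x & g = z t x]].
have ZH : Z `<=` H by move=> g [_ [t [x [Tt Xx ->]]]]; exact: Hz.
split => //; exists Z.
(* phi changes only across the translate of the edge from t0 to t0 * x0 by h0,
   so it is constant on the translates of the spanning tree T. *)
have cut h0 t0 x0 : H h0 -> T t0 -> X x0 -> z t0 x0 <> 1 ->
    exists phi : G -> bool, forall h t x, H h -> T t -> X x ->
      phi (h * z t x) = phi h (+) `[< [/\ h = h0, t = t0 & x = x0] >].
  move=> Hh0 Tt0 Xx0 nz.
  have [phi [_ phiE]] := free_basis_integral As AX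
    (fun g x => `[< g = h0 * t0 /\ x = x0 >]).
  have hT h t h' t' : H h -> T t -> H h' -> T t' -> h * t = h' * t' -> h = h' /\ t = t'.
    move=> Hh Tt Hh' Tt' e.
    have tt' : t = t'.
      apply: Tinj => //; have -> : t / t' = h^-1 * h'.
        by rewrite -[t](mulKg h) e !mulgA mulgK.
      by apply: subgroupM => //; exact: subgroupV.
    by split => //; move: e; rewrite tt' => /mulIg.
  have phiT h t : H h -> T t -> phi (h * t) = phi h.
    move=> Hh /Tconn[s [sX <- sp]].
    suff: forall u v, s = u ++ v -> phi (h * word_val u) = phi h.
      by move=> /(_ s [::]); rewrite cats0 => /(_ erefl).
    elim/last_ind => [|u b IH] v sE; first by rewrite big_nil mulg1.
    have sE' : s = u ++ b :: v by rewrite sE cat_rcons.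
    have Tu := sp _ _ sE'; have Tub := sp _ _ sE.
    have bX : X b.1.
      by move: sX; rewrite sE' all_cat /= => /andP[_ /andP[]]; rewrite in_setE.
    rewrite -(IH _ sE') word_val_rcons; rewrite word_val_rcons in Tub.
    have zx t' : T t' -> T (t' * b.1) -> ~ (h * t' = h0 * t0 /\ b.1 = x0).
      move=> Tt' Tt'b [/hT[] // _ e1 e2]; apply: nz.
      by rewrite /z -e1 -e2 rT // mulgV.
    move: Tub; rewrite [letter_val b]/letter_val; case: ifP => _ Tub.
      have := phiE (h * (word_val u / b.1)) b.1; rewrite -mulgA mulgVK => -> //.
        by rewrite asboolF ?addbF //; apply: zx => //; rewrite mulgVK.
      by apply: subgroupM => //; [exact: HA|exact: TA].
    rewrite mulgA (phiE (h * word_val u)) //; first by rewrite asboolF ?addbF //; exact: zx.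
    by apply: subgroupM => //; [exact: HA|exact: TA].
  exists phi => h t x Hh Tt Xx.
  have Atx : A (t * x) by apply: subgroupM => //; [exact: TA|exact: XA].
  have [Tr _] := rP _ Atx.
  rewrite -(phiT (h * z t x) _ _ Tr); last by apply: subgroupM => //; exact: Hz.
  rewrite /z -!mulgA mulVg mulg1 mulgA phiE //; last first.
    by apply: subgroupM => //; [exact: HA|exact: TA].
  rewrite phiT //; congr (_ (+) _); apply/asboolP/asboolP.
    by move=> [/hT[] // -> -> ->].
  by move=> [-> -> ->].
(* A cut at [(t0, x0)] changes along [z t0 x0], hence along the equal element [z t x], and this
   happens only at the pair that was cut. *)
have zinj t x t0 x0 : T t -> X x -> T t0 -> X x0 -> z t x = z t0 x0 ->
    z t x <> 1 -> t = t0 /\ x = x0.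
  move=> Tt Xx Tt0 Xx0 e nz; rewrite e in nz.
  have [phi phiE] := cut 1 _ _ (subgroup1 Hs) Tt0 Xx0 nz.
  have := phiE 1 t x (subgroup1 Hs) Tt Xx.
  rewrite e phiE //; last exact: subgroup1.
  rewrite asboolT // => /addbI/esym; rewrite -/(is_true _) => /asboolP[_ -> ->] //.
apply: free_basis_criterion => // [h Hh|h0 z0 Hh0 [nz [t0 [x0 [Tt0 Xx0 z0E]]]]].
  have [s [/andP[sX _] sv]] := free_basis_word AX (HA Hh).
  (* Reidemeister rewriting: each letter multiplies the quotient of a prefix by its representative
     by 1, a Schreier generator or the inverse of one. For an element of [H] the representative is
     1. *)
  have : exists2 s', all (fun a => a.1 \in Z) s'
      & word_val s' = word_val s / r (word_val s).
    elim/last_ind: s sX {sv} => [|s b IH].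
      by exists [::] => //; rewrite !big_nil rT // mulgV.
    rewrite all_rcons => /andP[]; rewrite in_setE => bX sX.
    have Ap : A (word_val s) := word_val_subgroup As XA sX.
    have [s' s'Z s'v] := IH sX; have [Tr Hr] := rP _ Ap.
    have Ab : A (letter_val b).
      by rewrite /letter_val; case: ifP => _; [apply: subgroupV => //|]; exact: XA.
    set t := r (word_val s) in s'v Tr Hr.
    have At := TA _ Tr.
    have rtb : r (word_val s * letter_val b) = r (t * letter_val b).
      rewrite -[in RHS](rH (word_val s / t)) //; last exact: subgroupM.
      by rewrite mulgA mulgVK.
    have Zw g : g = 1 \/ Z g \/ Z g^-1 -> exists2 w, all (fun a => a.1 \in Z) w
        & word_val w = g.
      move=> [->|[Zg|Zg]]; first by exists [::] => //; rewrite big_nil.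
        by exists [:: (g, false)]; rewrite /= ?mem_set // big_seq1.
      exists [:: (g^-1, true)]; rewrite /= ?mem_set // big_seq1.
      by rewrite /letter_val /= invgK.
    have [w wZ wv] : exists2 w, all (fun a => a.1 \in Z) w
        & word_val w = t * letter_val b / r (t * letter_val b).
      apply: Zw; have [->|n1] := pselect (t * letter_val b / r (t * letter_val b) = 1).
        by left.
      right; move: n1 Ab; rewrite /letter_val; case: ifP => _ n1 Ab.
        (* For an inverse letter the factor is the inverse of the generator at [t'], since
           [t' * b.1] is represented by [t]. *)
        right; rewrite !invgM !invgK.
        have Atb : A (t * b.1^-1) by apply: subgroupM.
        have [Tr' Hr'] := rP _ Atb; set t' := r _ in n1 Tr' Hr' *.
        have rt' : r (t' * b.1) = t.
          rewrite -(rH (t / b.1 / t')) //.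
            by rewrite mulgA mulgVK mulgVK rT.
          by apply: subgroupM; [|exact: TA|exact: XA].
        split; last by exists t', b.1; split => //; rewrite /z rt' mulgA.
        by move=> e; apply: n1; apply: invg_inj; rewrite invg1 -e !invgM !invgK.
      by left; split => //; exists t, b.1.
    exists (s' ++ w); first by rewrite all_cat s'Z.
    by rewrite word_val_cat s'v wv word_val_rcons rtb !mulgA mulgVK.
  move=> [s' s'Z s'v]; exists s' => //; rewrite s'v sv.
  by rewrite (rE _ 1) ?invg1 ?mulg1 //; exact: HA.
have nz' : z t0 x0 <> 1 by rewrite -z0E.
have [phi phiE] := cut _ _ _ Hh0 Tt0 Xx0 nz'.
exists phi => h' z' Hh' [nz1 [t [x [Tt Xx z'E]]]].
rewrite z'E phiE //; congr (_ (+) _); apply/asboolP/asboolP.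
  by move=> [-> -> ->]; rewrite z0E.
move=> [-> e]; rewrite z0E in e; have [|-> ->] := zinj _ _ _ _ Tt Xx Tt0 Xx0 e.
  by rewrite -z'E.
by [].
Qed.

End NielsenSchreier.

(** * Free products *)

Notation syllables_val s := (\prod_(a <- s) a.2).

Section FreeProduct.
Variables (G : groupType) (I : Type) (Gi : I -> set G) (F : set G).
Hypotheses (Fs : is_subgroup F) (FG : is_free_product Gi F).

Let reduced := (reduced_product_word Gi).

Lemma factor_subgroup i : is_subgroup (Gi i).
Proof. by case: FG. Qed.

Lemma syllables_val_rcons (s : seq (I * G)) a :
  syllables_val (rcons s a) = syllables_val s * a.2.
Proof. by rewrite -cats1 big_cat big_seq1. Qed.

Lemma syllables_val_cat (s t : seq (I * G)) :
  syllables_val (s ++ t) = syllables_val s * syllables_val t.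
Proof. by rewrite big_cat. Qed.

Lemma factor_sub i : Gi i `<=` F.
Proof.
move=> x Gx; have [->|x1] := eqVneq x 1; first exact: subgroup1.
have [_ [Hf _ _]] := FG; have := Hf [:: (i, x)]; rewrite /= big_seq1 /=; apply.
by rewrite /reduced_product_word /= mem_set // x1.
Qed.

Lemma free_product_word f : F f ->
  exists s, reduced s /\ syllables_val s = f.
Proof. by move=> Ff; have [_ [_ _ /(_ f Ff)[s /= sr sv]]] := FG; exists s. Qed.

Lemma free_product_uniq s t : reduced s -> reduced t ->
  syllables_val s = syllables_val t -> s = t.
Proof. by move=> sr tr; have [_ [_ Hi _]] := FG; apply: Hi; rewrite in_setE. Qed.

Lemma syllables_val_sub s : reduced s -> F (syllables_val s).
Proof. by move=> sr; have [_ [Hf _ _]] := FG; exact: Hf. Qed.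

Lemma reduced_rconsW s a : reduced (rcons s a) -> reduced s.
Proof.
rewrite /reduced /reduced_product_word all_rcons => /andP[/andP[_ sG] sr].
by rewrite sG (sorted_rconsW sr).
Qed.

Lemma reduced_rcons s i x : reduced s -> Gi i x -> x <> 1 ->
  (forall s' j y, s = rcons s' (j, y) -> j <> i) -> reduced (rcons s (i, x)).
Proof.
move=> /andP[sG sr] Gx x1 sl; rewrite /reduced /reduced_product_word all_rcons sG /=.
rewrite (mem_set Gx) (introN eqP x1) /=; case/lastP: s sl sr {sG} => // s [j y] sl sr.
by rewrite sorted_rcons2 sr; apply/asboolP; exact: sl.
Qed.

Lemma reduced_rcons_last s i x : reduced (rcons s (i, x)) ->
  [/\ Gi i x, x <> 1 & forall s' j y, s = rcons s' (j, y) -> j <> i].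
Proof.
rewrite /reduced /reduced_product_word all_rcons => /andP[/andP[/andP[Gx /eqP x1] _] sr].
rewrite /= in_setE in Gx; split => // s' j y sE.
by move: sr; rewrite sE sorted_rcons2 => /andP[_ /asboolP].
Qed.

Lemma free_product_const (T : Type) (f : G -> T) :
  (forall g i x, Gi i x -> f (g * x) = f g) ->
  forall g h, F (g^-1 * h) -> f h = f g.
Proof.
move=> fG g h /free_product_word[s [/andP[sG _] sv]].
rewrite -[h](mulVKg g) -sv; elim/last_ind: s sG {sv} => [|s a IH].
  by rewrite big_nil mulg1.
rewrite all_rcons => /andP[/andP[Ga _] sG]; rewrite in_setE in Ga.
by rewrite syllables_val_rcons mulgA (fG _ a.1) // IH.
Qed.

(** Chosen from the coset as a set, so that it depends on the coset only. *)
Definition coset_rep (g : G) : G := xget 1 (left_coset F g).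

Lemma coset_rep_mem g : F ((coset_rep g)^-1 * g).
Proof.
have : left_coset F g (coset_rep g).
  by apply: (@xgetPex _ 1); exists g; exists 1; [exact: subgroup1|rewrite mulg1].
by case=> f Ff <-; rewrite invgM mulgVK; exact: subgroupV.
Qed.

Lemma left_coset_eq (H : set G) g h : is_subgroup H ->
  left_coset H g = left_coset H h <-> H (g^-1 * h).
Proof.
move=> Hs; split=> [e|Hgh].
  have : left_coset H h h by exists 1; [exact: subgroup1|rewrite mulg1].
  by rewrite -e => -[f Hf <-]; rewrite mulKg.
apply/seteqP; split=> _ [f Hf <-].
  exists (h^-1 * g * f); last by rewrite !mulgA mulgV mul1g.
  by apply: subgroupM => //; rewrite -[g]invgK -invgM; exact: subgroupV.
by exists (g^-1 * h * f); [exact: subgroupM|rewrite !mulgA mulgV mul1g].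
Qed.

Lemma coset_rep_eq g h : F (g^-1 * h) -> coset_rep g = coset_rep h.
Proof. by move=> Fgh; rewrite /coset_rep (left_coset_eq g h Fs).2. Qed.

(** Acyclicity of the Bass-Serre forest: the potential at the vertex [g G_i] has to be
    [phi g (+) eps g i], and the equation says that [g] and [g * x] prescribe the same value there.
    [phi] sums along the normal form of [g] relative to its coset representative. *)
Lemma free_product_integral (eps : G -> I -> bool) :
  exists phi : G -> bool, forall g i x, Gi i x ->
    phi (g * x) = phi g (+) (eps g i (+) eps (g * x) i).
Proof.
pose Phi := fix Phi g s := if s is a :: s' then
  (eps g a.1 (+) eps (g * a.2) a.1) (+) Phi (g * a.2) s' else false.
have PhiR g s a : Phi g (rcons s a) =
    Phi g s (+) (eps (g * syllables_val s) a.1 (+) eps (g * syllables_val s * a.2) a.1).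
  elim: s g => [|b s IH] g /=; first by rewrite big_nil mulg1 addbF.
  by rewrite IH big_cons !mulgA addbA.
have /choice[nf nfP] : forall f, exists s : seq (I * G), F f ->
    reduced s /\ syllables_val s = f.
  move=> f; have [/free_product_word[s ?]|nH] := pselect (F f); first by exists s.
  by exists [::].
have nfE s : reduced s -> nf (syllables_val s) = s.
  move=> sr; have [nr nv] := nfP _ (syllables_val_sub sr).
  exact: free_product_uniq.
exists (fun g => Phi (coset_rep g) (nf ((coset_rep g)^-1 * g))) => g i x Gx.
have <- : coset_rep g = coset_rep (g * x).
  by apply: coset_rep_eq; rewrite mulKg; exact: factor_sub Gx.
have [nr nv] := nfP _ (coset_rep_mem g).
have [->|/eqP x1] := eqVneq x 1; first by rewrite mulg1 addbb addbF.
have [s sE] : exists s, s = nf ((coset_rep g)^-1 * g) by eexists.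
rewrite -sE in nr nv *; rewrite mulgA -nv {sE}.
have {nv}gE : g = coset_rep g * syllables_val s by rewrite nv mulVKg.
set r := coset_rep g in gE *; clearbody r; rewrite {1 2}gE {gE}.
have [[s' [y ?]]|sl] := pselect (exists s' y, s = rcons s' (i, y)); last first.
  rewrite (_ : syllables_val s * x = syllables_val (rcons s (i, x))); last first.
    by rewrite syllables_val_rcons.
  rewrite nfE; first by rewrite PhiR.
  by apply: reduced_rcons => // s' j y sE' ji; apply: sl; exists s', y; rewrite -ji.
(* The last syllable lies in the same factor and merges with [x]; the terms of the intermediate edge
   cancel. *)
subst s; have s'r := reduced_rconsW nr.
have [Gy y1 s'l] := reduced_rcons_last nr.
rewrite syllables_val_rcons /= PhiR /= -mulgA.
have e (a b c d : bool) : a (+) (c (+) d) = a (+) (c (+) b) (+) (b (+) d).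
  by case: a; case: b; case: c; case: d.
have [yx|/eqP yx] := eqVneq (y * x) 1.
  by rewrite yx mulg1 nfE // !mulgA -[r * _ * y * x]mulgA yx mulg1 -e addbb addbF.
rewrite (_ : syllables_val s' * (y * x) = syllables_val (rcons s' (i, y * x))); last first.
  by rewrite syllables_val_rcons.
rewrite nfE; first by rewrite PhiR /= !mulgA -e.
by apply: reduced_rcons => //; apply: subgroupM => //; exact: factor_subgroup.
Qed.

End FreeProduct.

(** * Left orders on free products *)

Definition strict_total (T : Type) (lt : T -> T -> Prop) :=
  [/\ forall x, ~ lt x x, forall x y z, lt x y -> lt y z -> lt x z
    & forall x y, [\/ x = y, lt x y | lt y x]].

Lemma strict_total_exists (T : Type) : exists lt : T -> T -> Prop, strict_total lt.
Proof.
have [R Rwo] := wochoice.well_ordering_principle {classic T}.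
have Rmin (A : {classic T} -> Prop) x : A x -> exists z, A z /\ forall y, A y -> R z y.
  move=> Ax; have [|z [[Az zR] _]] := Rwo [pred y | `[< A y >]].
    by exists x; apply/asboolP.
  exists z; split; first exact/asboolP.
  by move=> y Ay; apply: zR; apply/asboolP.
have Rtot x y : R x y \/ R y x.
  have [z [[->|->] zR]] := Rmin (fun z => z = x \/ z = y) x (or_introl erefl).
    by left; apply: zR; right.
  by right; apply: zR; left.
have Ranti x y : R x y -> R y x -> x = y.
  move=> xy yx; have xx : R x x by case: (Rtot x x).
  have yy : R y y by case: (Rtot y y).
  have [|z [_ zu]] := Rwo [pred z | `[< z = x \/ z = y >]].
    by exists x; apply/asboolP; left.
  have <- : z = x.
    by apply: zu; split; [apply/asboolP; left|move=> u /asboolP[->|->]].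
  by apply: zu; split; [apply/asboolP; right|move=> u /asboolP[->|->]].
exists (fun x y : {classic T} => R x y /\ x <> y); split=> [x []//|x y z [xy nxy] [yz nyz]|x y].
  have xz : R x z.
    have [u [[->|[->|->]] uR]] := Rmin (fun u => u = x \/ u = y \/ u = z) x (or_introl erefl).
    - by apply: uR; auto.
    - by case: nxy; apply: Ranti => //; apply: uR; auto.
    - by case: nyz; apply: Ranti => //; apply: uR; auto.
  by split => // e; apply: nxy; apply: Ranti => //; rewrite e.
have [->|nxy] := pselect (x = y); first by constructor 1.
have nyx : y <> x by move=> e; apply: nxy.
by case: (Rtot x y) => xy; [constructor 2|constructor 3].
Qed.

Section FreeProductCone.
Variables (G : groupType) (I : Type) (Gi : I -> set G) (F : set G).
Hypotheses (Fs : is_subgroup F) (FG : is_free_product Gi F).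
Variables (sg : I -> G -> int) (cm : I -> I -> int).
Local Open Scope ring_scope.
Hypotheses (sg1 : forall i x, sg i x = 1 \/ sg i x = -1)
  (sgV : forall i x, Gi i x -> x <> 1%g -> sg i x^-1%g = - sg i x)
  (sgM : forall i x y, Gi i x -> Gi i y -> (x * y)%g <> 1%g -> sg i x = sg i y ->
     sg i (x * y)%g = sg i x).
Hypotheses (cm1 : forall i j, i <> j -> cm i j = 1 \/ cm i j = -1)
  (cmN : forall i j, cm j i = - cm i j)
  (cmT : forall i j k, cm i j = cm j k -> cm i j <> 0 -> cm i k = cm i j).

Let reduced := (reduced_product_word Gi).

Let cmo (x y : option I) : int :=
  if x is Some i then if y is Some j then cm i j else 0 else 0.
Let ohd (s : seq (I * G)) := omap fst (ohead s).
Let olast (s : seq (I * G)) := ohd (rev s).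

(* The Dicks-Sunic count of up-turns minus down-turns along the path of the
   Bass-Serre tree described by a word. *)
Let tau := fix tau (s : seq (I * G)) : int :=
  if s is a :: s' then sg a.1 a.2 + cmo (Some a.1) (ohd s') + tau s' else 0.

Let tau_cat s t : tau (s ++ t) = tau s + cmo (olast s) (ohd t) + tau t.
Proof.
elim: s => [|a s IH] //=; first by lia.
case: s IH => [|b s] /= -> /=; first by rewrite /olast /=; lia.
by rewrite /olast !rev_cons; case: (rev s) => [|c u] /=; lia.
Qed.

(** A word of [l] syllables contributes [l] signs and [l - 1] comparisons, each equal to 1 or -1. *)
Let tau_odd s : reduced s -> s <> [::] -> exists k : int, tau s = 2%:Z * k + 1.
Proof.
move=> /andP[_]; elim: s => // a s IH sr _; case: s IH sr => [|b s] IH sr /=.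
  by case: (sg1 a.1 a.2) => ->; [exists 0|exists (-1)]; lia.
have [|//|k /= ->] := IH; first exact: path_sorted sr.
have nab : a.1 <> b.1 by move: sr => /= /andP[/asboolP].
by case: (sg1 a.1 a.2) => ->; case: (cm1 nab) => ->;
  [exists (k + 1)|exists k|exists k|exists (k - 1)]; lia.
Qed.

Let olast_rcons s a : olast (rcons s a) = Some a.1.
Proof. by rewrite /olast rev_rcons. Qed.

Let reduced_cat s t : reduced s -> reduced t ->
  (forall i, olast s = Some i -> ohd t <> Some i) -> reduced (s ++ t).
Proof.
move=> /andP[sG sr] /andP[tG tr] st; rewrite /reduced /reduced_product_word.
rewrite all_cat sG tG /=; case: t tr st {tG} => [|b t] tr st; first by rewrite cats0.
rewrite sorted_cat_cons; move: tr => /= ->; rewrite andbT.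
case/lastP: s st sr {sG} => // s a st sr; rewrite sorted_rcons2 sr.
by apply/asboolP => ab; apply: (st a.1); rewrite ?olast_rcons //= ab.
Qed.

Let cmo_olast s a : reduced (rcons s a) ->
  olast s = None \/ exists2 j, olast s = Some j & j <> a.1.
Proof.
case/lastP: s => [|s b]; first by left.
move=> /andP[_]; rewrite sorted_rcons2 => /andP[_ /asboolP ba].
by right; exists b.1; rewrite ?olast_rcons.
Qed.

Let cmo_ohd a s : reduced (a :: s) ->
  ohd s = None \/ exists2 j, ohd s = Some j & j <> a.1.
Proof.
case: s => [|b s]; first by left.
move=> /andP[_] /= /andP[/asboolP ab _].
by right; exists b.1 => // e; apply: ab.
Qed.

Let reduced_behead a s : reduced (a :: s) -> reduced s.
Proof. by move=> /andP[/= /andP[_ sG] /path_sorted ss]; apply/andP. Qed.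

Let syllable a s : reduced (a :: s) -> Gi a.1 a.2 /\ a.2 <> 1%g.
Proof.
by move=> /andP[/= /andP[/andP[aG /eqP a1] _] _]; rewrite in_setE in aG.
Qed.

(** [tau] is a quasi-morphism of defect at most 1. The last clause, exact additivity when no
    syllables meet in one factor, serves the induction: after a cancellation it gives the value for
    the shorter words. *)
Let tau_mul s t : reduced s -> reduced t -> exists u,
  [/\ reduced u, syllables_val u = (syllables_val s * syllables_val t)%g,
    -1 <= tau u - tau s - tau t <= 1
  & (olast s = None \/ olast s <> ohd t) ->
    tau u = tau s + tau t + cmo (olast s) (ohd t)].
Proof.
elim/last_ind: s t => [|s [i x] IH] t sr tr.
  by exists t; split => //=; rewrite ?big_nil ?mul1g //; lia.
case: t tr => [|[j y] t] tr.
  exists (rcons s (i, x)); split => //=; rewrite ?big_nil ?mulg1 //; first by lia.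
  by rewrite olast_rcons /=; lia.
have [Gx x1 _] := reduced_rcons_last sr; have [/= Gy y1] := syllable tr.
have [ij|nij] := pselect (i = j); last first.
  exists (rcons s (i, x) ++ (j, y) :: t); rewrite tau_cat olast_rcons.
  split; [| |by case: (cm1 nij) => /= ->; lia|by move=> _ /=; lia].
    by apply: reduced_cat => // k; rewrite olast_rcons => -[<-] [/esym].
  by rewrite syllables_val_cat.
subst j; have sE u : tau (rcons s u) = tau s + cmo (olast s) (Some u.1) + sg u.1 u.2.
  by rewrite -cats1 tau_cat -[ohd [:: u]]/(Some u.1) /=; lia.
have hs := cmo_olast sr; have ht := cmo_ohd tr.
rewrite olast_rcons sE syllables_val_rcons big_cons /=.
have [xy|nxy] := pselect (x * y = 1)%g.
  have [u [ur uv ud ue]] := IH t (reduced_rconsW sr) (reduced_behead tr).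
  have yE : y = x^-1%g by rewrite -[y](mulKg x) xy mulg1.
  exists u; split => //; first by rewrite uv mulgA -[(_ * x * y)%g]mulgA xy mulg1.
    rewrite yE sgV //; move: ud ue; case: hs => /= [->|[a -> ai]]; case: ht => /= [->|[b -> bi]] /=.
    - by move=> _ /(_ (or_introl erefl))->; lia.
    - by move=> _ /(_ (or_introl erefl))->; case: (cm1 bi); rewrite (cmN i b); lia.
    - by move=> _ /(_ (or_intror _))-> //; case: (cm1 ai) => ->; lia.
    (* The defect is [cm a b - cm a i - cm i b], where transitivity excludes 3 and -3. If [a = b],
       the two comparisons cancel and the bound for the shorter words applies. *)
    - have [<-|ab] := pselect (a = b); first by rewrite (cmN a i); lia.
      move=> _ /(_ (or_intror _))->; last by case.
      have := cmT (i := a) (j := i) (k := b); rewrite (cmN b i).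
      by case: (cm1 ab) => ->; case: (cm1 ai) => ->; case: (cm1 bi) => ->; lia.
  by case.
exists (rcons s (i, (x * y)%g) ++ t); split.
- apply: reduced_cat.
  + apply: reduced_rcons => //; first exact: reduced_rconsW sr.
      by apply: subgroupM => //; exact: factor_subgroup FG _.
    by have [_ _ +] := reduced_rcons_last sr.
  + exact: reduced_behead tr.
  + by move=> k; rewrite olast_rcons => -[<-]; case: ht => [->|[b -> bi] []].
- by rewrite syllables_val_cat syllables_val_rcons /= !mulgA.
- rewrite tau_cat sE olast_rcons /=.
  have := sgM Gx Gy nxy.
  by case: (sg1 i x) => ->; case: (sg1 i y) => ->; case: (sg1 i (x * y)%g) => ->; lia.
- by case.
Qed.

(** The cone is given by [tau > 0]. Positive integers with defect at most 1 have a positive [tau] of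
    the product. The values at [f] and [f^-1] are odd with sum of absolute value at most 1, so they
    are opposite and nonzero. *)
Lemma free_product_cone_of_signs : exists P : set G,
  [/\ P `<=` F, forall f g, P f -> P g -> P (f * g)%g, ~ P 1%g
    & forall f, F f -> f <> 1%g -> P f \/ P f^-1%g].
Proof.
exists [set f | exists s, [/\ reduced s, syllables_val s = f & 0 < tau s]].
have tau1 s : reduced s -> syllables_val s = 1%g -> tau s = 0.
  move=> sr s1; suff -> : s = [::] by [].
  by apply: (free_product_uniq FG) => //; rewrite s1 big_nil.
split=> [f [s [sr <- _]]|f g [s [sr <- s0]] [t [tr <- t0]]|[s [sr /(tau1 _ sr)->]]|f Ff f1].
- exact: (syllables_val_sub FG).
- by have [u [ur uv ud _]] := tau_mul sr tr; exists u; split => //; lia.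
- by lia.
have [s [sr sv]] := free_product_word FG Ff.
have [t [tr tv]] := free_product_word FG (subgroupV Fs Ff).
have [u [ur uv ud _]] := tau_mul sr tr.
have u0 : tau u = 0 by apply: tau1 => //; rewrite uv sv tv mulgV.
have [k sk] : exists k : int, tau s = 2%:Z * k + 1.
  by apply: tau_odd => // s0; apply: f1; rewrite -sv s0 big_nil.
have [l tl] : exists k : int, tau t = 2%:Z * k + 1.
  by apply: tau_odd => // t0; apply: f1; rewrite -[f]invgK -tv t0 big_nil invg1.
have [s0|s0] : 0 < tau s \/ tau s < 0 by lia.
  by left; exists s.
by right; exists t; split => //; lia.
Qed.

End FreeProductCone.

Section FreeProductOrder.
Variables (G : groupType) (I : Type) (Gi : I -> set G) (F : set G).
Hypotheses (Fs : is_subgroup F) (FG : is_free_product Gi F).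
Hypothesis Gio : forall i, left_orderable (Gi i).

(** Vinogradov's theorem that free products of left-orderable groups are left-orderable, in the form
    of a positive cone. The signs [sg] come from the orders of the factors, and [cm] from an
    arbitrary order of the index set. *)
Lemma free_product_cone : exists P : set G,
  [/\ P `<=` F, forall f g, P f -> P g -> P (f * g), ~ P 1
    & forall f, F f -> f <> 1 -> P f \/ P f^-1].
Proof.
have [lt [ltxx ltT ltot]] := strict_total_exists I.
have /choice[le leP] := Gio.
pose sg i x : int := if le i 1 x then 1%R else (-1)%R.
pose cm i j : int := if `[< i = j >] then 0%R else if `[< lt i j >] then 1%R else (-1)%R.
have G1 i : 1 \in Gi i by apply: mem_set; apply: subgroup1; exact: factor_subgroup FG i.
have leM i z x y : Gi i z -> Gi i x -> Gi i y -> le i x y -> le i (z * x) (z * y).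
  by move=> Gz Gx Gy; have [_ _ _ _ h] := leP i; apply: h; rewrite in_setE.
have leA i x : Gi i x -> le i 1 x -> le i x 1 -> x = 1.
  move=> Gx lx xl; have [_ h _ _ _] := leP i.
  by apply/esym/h; rewrite ?in_setE ?lx //; have := G1 i; rewrite in_setE.
have lT i x : Gi i x -> le i 1 x \/ le i x 1.
  move=> Gx; have [_ _ _ h _] := leP i; apply/orP/h => //; exact: mem_set.
have leT i x y z : Gi i x -> Gi i y -> Gi i z -> le i x y -> le i y z -> le i x z.
  by move=> Gx Gy Gz; have [_ _ h _ _] := leP i; apply: h; rewrite in_setE.
have Gs i := factor_subgroup FG i.
have Gi1 i : Gi i 1 := subgroup1 (Gs i).
apply: (free_product_cone_of_signs Fs FG (sg := sg) (cm := cm)).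
- by move=> i x; rewrite /sg; case: ifP; auto.
- move=> i x Gx x1; have GVx := subgroupV (Gs i) Gx.
  rewrite /sg; case: ifPn => lV; case: ifPn => l //.
    case: x1; apply: (leA i) => //.
    by have := leM i x 1 x^-1 Gx (Gi1 i) GVx lV; rewrite mulg1 mulgV.
  case: (lT i x Gx) => [l'|l']; first by rewrite l' in l.
  have := leM i x^-1 x 1 GVx Gx (Gi1 i) l'; rewrite mulg1 mulVg => e.
  by rewrite e in lV.
- move=> i x y Gx Gy xy; rewrite /sg.
  have Gxy := subgroupM (Gs i) Gx Gy.
  case: ifPn => lx; case: ifPn => ly //; case: ifPn => lxy // _.
    have := leM i x 1 y Gx (Gi1 i) Gy ly; rewrite mulg1 => h.
    by rewrite (leT i 1 x) in lxy.
  case: xy; apply: (leA i) => //.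
  have [l'|l'] := lT i x Gx; first by rewrite l' in lx.
  have [l2|l2] := lT i y Gy; first by rewrite l2 in ly.
  have := leM i x y 1 Gx Gy (Gi1 i) l2; rewrite mulg1 => h.
  exact: leT h l'.
- by move=> i j ij; rewrite /cm asboolF //; case: ifP; auto.
- move=> i j; rewrite /cm; case: (asboolP (j = i)) => [->|ji].
    by case: (asboolP (i = i)).
  rewrite (asboolF (fun e : i = j => ji (esym e))).
  case: (asboolP (lt j i)) => lji; case: (asboolP (lt i j)) => lij //; first by case: (ltxx i); apply: ltT lij lji.
  by case: (ltot i j) => // e; case: ji.
- move=> i j k; rewrite /cm; case: (asboolP (i = j)) => // ij.
  case: (asboolP (j = k)) => [|jk]; first by case: ifP.
  case: (asboolP (lt i j)) => lij; case: (asboolP (lt j k)) => ljk // _ _.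
    have lik := ltT _ _ _ lij ljk; rewrite asboolF; last first.
      by move=> e; apply: (ltxx i); rewrite {2}e.
    by rewrite asboolT.
  have lji : lt j i by case: (ltot i j).
  have lkj : lt k j by case: (ltot j k).
  have lki := ltT _ _ _ lkj lji; rewrite asboolF; last first.
    by move=> e; apply: (ltxx i); rewrite {1}e.
  by rewrite asboolF // => lik; apply: (ltxx i); apply: ltT lik lki.
Qed.

End FreeProductOrder.

(** * Cardinal arithmetic *)

Section Cardinals.

Lemma card_le_of_inj (T U : Type) (A : set T) (B : set U) (f : T -> U) :
  (forall x, A x -> B (f x)) ->
  (forall x y, A x -> A y -> f x = f y -> x = y) -> A #<= B.
Proof.
move=> fB finj; apply: (@card_le_trans _ _ _ (f @` A)); last first.
  by apply: subset_card_le => _ [x Ax <-]; exact: fB.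
have /card_eqPle[_ //] : f @` A #= A.
by apply: inj_card_eq => x y; rewrite !in_setE; exact: finj.
Qed.

Lemma card_le_inj (T U : Type) (A : set T) (B : set U) b : B b -> A #<= B ->
  exists f : T -> U, (forall x, A x -> B (f x)) /\
    (forall x y, A x -> A y -> f x = f y -> x = y).
Proof.
move=> Bb /card_leP[f].
pose g x := if pselect (A x) is left Ax then val (f (SigSub (mem_set Ax))) else b.
exists g; split=> [x Ax|x y Ax Ay].
  by rewrite /g; case: pselect => // Ax'; exact: set_valP.
rewrite /g; case: pselect => // Ax'; case: pselect => // Ay' /val_inj.
by move=> /(inj (mem_set I) (mem_set I))/(congr1 val).
Qed.

(** Zorn's lemma for partial injections: a maximal one exhausts [A] or [B], since two unmatched
    elements could be matched. *)
Lemma card_le_total (T U : Type) (A : set T) (B : set U) : A #<= B \/ B #<= A.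
Proof.
pose P (R : set (T * U)) := [/\ forall p, R p -> A p.1 /\ B p.2,
  forall p q, R p -> R q -> p.1 = q.1 -> p = q
  & forall p q, R p -> R q -> p.2 = q.2 -> p = q].
have [C CP Ctot|R [[RAB R1 R2] Rmax]] := @Zorn_bigcup (T * U) P.
  have both p q : (\bigcup_(X in C) X) p -> (\bigcup_(X in C) X) q ->
      exists2 X, C X & X p /\ X q.
    move=> [X CX Xp] [Y CY Yq]; have [XY|YX] := Ctot _ _ CX CY.
      by exists Y => //; split => //; exact: XY.
    by exists X => //; split => //; exact: YX.
  split=> [p [X CX Xp]|p q Cp Cq|p q Cp Cq].
  - by have [+ _ _] := CP _ CX; apply.
  - by have [X CX [Xp Xq]] := both _ _ Cp Cq; have [_ + _] := CP _ CX; apply.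
  - by have [X CX [Xp Xq]] := both _ _ Cp Cq; have [_ _] := CP _ CX; apply.
have [[x Ax nx]|allA] := pselect (exists2 x, A x & forall y, ~ R (x, y)).
  have [[y By ny]|allB] := pselect (exists2 y, B y & forall x, ~ R (x, y)).
    exfalso; apply: (Rmax (R `|` [set (x, y)])).
      rewrite properEneq; split; last exact: subsetUl.
      by apply/eqP => e; apply: (nx y); rewrite e; right.
    split=> [p [/RAB//|-> //]|p q|p q].
    - move=> [Rp|->] [Rq|->] //; first exact: R1.
        by case: p Rp => a b Rp /= e; subst a; case: (nx b).
      by case: q Rq => a b Rq /= e; subst a; case: (nx b).
    - move=> [Rp|->] [Rq|->] //; first exact: R2.
        by case: p Rp => a b Rp /= e; subst b; case: (ny a).
      by case: q Rq => a b Rq /= e; subst b; case: (ny a).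
  right; have /choice[f fP] : forall y, exists x, B y -> R (x, y).
    move=> y; have [By|nBy] := pselect (B y); last by exists x.
    apply: contrapT => ne; apply: allB; exists y => // x' Rx'; apply: ne.
    by exists x'.
  apply: (card_le_of_inj (f := f)) => [y By|y y' By By' e].
    by have [] := RAB _ (fP _ By).
  by have := R1 _ _ (fP _ By) (fP _ By') e; case.
left; have [[b Bb]|B0] := pselect (B !=set0); last first.
  rewrite (_ : A = set0); first exact: card_ge0.
  apply/seteqP; split => // x Ax; apply: allA; exists x => // y /RAB[_ /= By].
  by apply: B0; exists y.
have /choice[f fP] : forall x, exists y, A x -> R (x, y).
  move=> x; have [Ax|nAx] := pselect (A x); last by exists b.
  apply: contrapT => ne; apply: allA; exists x => // y Ry; apply: ne.
  by exists y.
apply: (card_le_of_inj (f := f)) => [x Ax|x x' Ax Ax' e].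
  by have [] := RAB _ (fP _ Ax).
by have := R2 _ _ (fP _ Ax) (fP _ Ax') e; case.
Qed.

Definition words_on (T : Type) (X : set T) : set (seq T) :=
  [set s | forall x, List.In x s -> X x].

Lemma words_on_map (T U : Type) (X : set T) (Y : set U) (f : T -> U) s :
  (forall x, X x -> Y (f x)) -> words_on X s -> words_on Y (map f s).
Proof.
move=> fY; elim: s => [_ ? []|a s IH Xs y /= [<-|]].
  by apply: fY; apply: Xs; left.
by apply: IH => x xs; apply: Xs; right.
Qed.

Lemma map_inj_on (T U : Type) (X : set T) (f : T -> U) s s' :
  (forall x y, X x -> X y -> f x = f y -> x = y) ->
  words_on X s -> words_on X s' -> map f s = map f s' -> s = s'.
Proof.
move=> finj; elim: s s' => [|a s IH] [|b s'] // Xs Xs' [fab e].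
congr cons; first by apply: finj => //; [apply: Xs|apply: Xs']; left.
by apply: IH => // x xs; [apply: Xs|apply: Xs']; right.
Qed.

Lemma card_le_words_on (T U : Type) (X : set T) (Y : set U) :
  X #<= Y -> words_on X #<= words_on Y.
Proof.
have [[y Yy]|Y0] := pselect (Y !=set0).
  move=> /(card_le_inj Yy)[f [fY finj]].
  apply: (card_le_of_inj (f := map f)); first by move=> s; exact: words_on_map.
  by move=> s s'; exact: map_inj_on.
have {Y0} -> : Y = set0 by apply/eqP/negP => /negP/set0P.
rewrite card_le0 => /eqP->.
apply: (card_le_of_inj (f := fun _ : seq T => [::] : seq U)) => [s _ x []|].
by move=> [|a s] [|b s'] // h h'; [case: (h' b)|case: (h a)|case: (h a)]; left.
Qed.

(* R is the graph of an injection of words_on D into D for an infinite D. *)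
Let wgraph (T : Type) (X : set T) (R : set (seq T * T)) :=
  let D := [set x | exists y, R ([:: x], y)] in
  [/\ D `<=` X, infinite_set D, forall s, (exists y, R (s, y)) <-> words_on D s,
    forall p, R p -> D p.2
    & forall p q, R p -> R q -> (p.1 = q.1 \/ p.2 = q.2) -> p = q].

Lemma card_words_on (T : Type) (X : set T) : infinite_set X -> words_on X #<= X.
Proof.
move=> Xinf; pose P R := R = set0 \/ wgraph X R.
pose D (R : set (seq T * T)) := [set x | exists y, R ([:: x], y)].
have [C CP Ctot|R [RP Rmax]] := @Zorn_bigcup (seq T * T) P.
  have [[R0 CR0 nR0]|allC] := pselect (exists2 R, C R & R <> set0); last first.
    left; apply/seteqP; split => // p [R CR Rp].
    have R0 : R = set0 by apply: contrapT => nR; apply: allC; exists R.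
    by rewrite R0 in Rp.
  right; set U := \bigcup_(X in C) X.
  have g R : C R -> R <> set0 -> wgraph X R by move=> /CP[].
  have DU x : D U x <-> exists2 R, C R & D R x.
    by split=> [[y [R CR Ry]]|[R CR [y Ry]]]; [exists R => //; exists y|exists y; exists R].
  have gp R p : C R -> R p -> wgraph X R.
    by move=> CR Rp; apply: g => // R00; rewrite R00 in Rp.
  have [D0X D0inf _ _ _] := g _ CR0 nR0.
  split=> [x /DU[R CR [y Ry]]||s|[s y] [R CR Ry]|p q [R CR Rp] [R' CR' R'q]].
  - by have [+ _ _ _ _] := gp _ _ CR Ry; apply; exists y.
  - by apply: sub_infinite_set D0inf => x D0x; apply/DU; exists R0.
  - split=> [[y [R CR Ry]] x xs|Us].
      have [_ _ dom _ _] := gp _ _ CR Ry.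
      by apply/DU; exists R => //; apply: ((dom s).1 _ x xs); exists y.
    have [R [CR nR Rs]] : exists R, [/\ C R, R <> set0 & words_on (D R) s].
      elim: s Us => [_|a s IH Us]; first by exists R0; split => // ? [].
      have [|R [CR nR Rs]] := IH; first by move=> x xs; apply: Us; right.
      have /DU[R' CR' [y R'a]] := Us a (or_introl erefl).
      have [RR'|R'R] := Ctot _ _ CR CR'.
        exists R'; split => // [R'0|x [<-|/Rs[z Rz]]]; first by rewrite R'0 in R'a.
          by exists y.
        by exists z; exact: RR'.
      by exists R; split => // x [<-|/Rs//]; exists y; exact: R'R.
    have [_ _ dom _ _] := g _ CR nR.
    by have [y Ry] := (dom s).2 Rs; exists y; exists R.
  - by have [_ _ _ val _] := gp _ _ CR Ry; apply/DU; exists R => //; exact: val Ry.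
  - have [RR'|R'R] := Ctot _ _ CR CR'.
      by have [_ _ _ _] := gp _ _ CR' R'q; apply => //; exact: RR'.
    by have [_ _ _ _] := gp _ _ CR Rp; apply => //; exact: R'R.
have {RP} [DX Dinf dom val Rinj] : wgraph X R.
  case: RP => // R0; exfalso; rewrite {R}R0 in Rmax.
  have [x0 Xx0] := infinite_setN0 Xinf.
  have [f [fX finj]] := card_le_inj Xx0 (iffLR (infiniteP X) Xinf).
  have {}finj m n : f m = f n -> m = n by exact: finj.
  have [g gK] : exists g : T -> nat, cancel f g.
    have /choice[g gP] : forall x, exists n, forall m, f m = x -> m = n.
      move=> x; have [[n <-]|nx] := pselect (exists n, f n = x).
        by exists n => m; exact: finj.
      by exists 0%N => m mx; case: nx; exists m.
    by exists g => n; apply/esym; exact: gP.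
  (* A countable subset of [X] gives a first nonempty graph, since finite sequences of naturals are
     coded by naturals. *)
  pose code (l : seq nat) : nat := choice.pickle l.
  have codeK : injective code by exact: (pcan_inj choice.pickleK).
  pose R0 : set (seq T * T) := [set p | words_on (range f) p.1 /\ p.2 = f (code (map g p.1))].
  have D0 : D R0 = range f.
    apply/seteqP; split=> [x [y [/(_ x (or_introl erefl))]]//|x fx].
    by exists (f (code [:: g x])); split => // y [<-|].
  apply: (Rmax R0).
    rewrite properEneq; split; last exact: sub0set.
    apply/eqP => e; have : R0 ([::], f (code [::])) by split => // ? [].
    by rewrite -e.
  right; rewrite /wgraph -/(D R0) D0; split.
  - by move=> _ [n _ <-]; exact: fX.
  - apply/infiniteP; apply: (card_le_of_inj (f := f)) => [n _|m n _ _]; last exact: finj.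
    by exists n.
  - move=> s; split=> [[y [+ _]]//|fs].
    by exists (f (code (map g s))).
  - by move=> [s y] [_ /= ->]; eexists.
  - move=> [s y] [s' y'] [/= fs ->] [/= fs' ->] [->//|/finj/codeK e].
    have -> // : s = s'.
    apply: (map_inj_on _ fs fs' e) => _ _ [m _ <-] [n _ <-].
    by rewrite !gK => ->.
rewrite -/(D R) in DX Dinf dom val.
have [d0 Dd0] := infinite_setN0 Dinf.
have /choice[h hP] : forall s, exists y, words_on (D R) s -> R (s, y).
  move=> s; have [/dom[y Ry]|ns] := pselect (words_on (D R) s); first by exists y.
  by exists d0.
have hD s : words_on (D R) s -> D R (h s) by move=> /hP/val.
have hinj s s' : words_on (D R) s -> words_on (D R) s' -> h s = h s' -> s = s'.
  by move=> /hP Rs /hP Rs' e; have [] := Rinj _ _ Rs Rs' (or_intror e).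
have wD : words_on (D R) #<= D R by exact: card_le_of_inj hD hinj.
have w1 d : D R d -> words_on (D R) [:: d] by move=> Dd x [<-|].
have w2 d : D R d -> words_on (D R) [:: d; d] by move=> Dd x [<-|[<-|]].
have [XD|DX'] := card_le_total (X `\` D R) (D R).
  have [j [jD jinj]] := card_le_inj Dd0 XD.
  have XD' : X #<= D R.
    apply: card_le_trans wD.
    apply: (card_le_of_inj (f := fun x => if `[< D R x >] then [:: x] else [:: j x; j x])).
      move=> x Xx; case: asboolP => [Dx|nDx]; first exact: w1.
      by apply: w2; exact: jD.
    move=> x y Xx Xy; case: asboolP => Dx; case: asboolP => Dy // [] //.
    by move=> e _; exact: jinj.
  apply: card_le_trans (card_le_words_on XD') _.
  by apply: card_le_trans wD _; exact: subset_card_le.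
have [j0 Xj0] : (X `\` D R) !=set0.
  by apply: infinite_setN0 => fin; apply: Dinf; exact: card_le_finite DX' fin.
have [j [jX jinj]] := card_le_inj Xj0 DX'.
have /choice[k kP] : forall x, exists d, forall d', D R d' -> j d' = x -> d' = d.
  move=> x; have [[d Dd <-]|nd] := pselect (exists2 d, D R d & j d = x).
    by exists d => d' Dd'; exact: jinj.
  by exists d0 => d' Dd' jd'; case: nd; exists d'.
pose D1 := D R `|` j @` D R.
(* [c] injects the doubled alphabet into [D]: words of length 1 encode [D], words of length 2 its
   copy. *)
pose c x := if `[< D R x >] then h [:: x] else h [:: k x; k x].
have cj d : D R d -> c (j d) = h [:: d; d].
  move=> Dd; rewrite /c asboolF; last by have [] := jX _ Dd.
  by rewrite -(kP _ _ Dd erefl).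
have cD x : D R x -> c x = h [:: x] by move=> Dx; rewrite /c asboolT.
have c1 x : D1 x -> D R (c x).
  move=> [Dx|[d Dd <-]]; [rewrite cD //; apply: hD; exact: w1|].
  by rewrite cj //; apply: hD; exact: w2.
have cinj x y : D1 x -> D1 y -> c x = c y -> x = y.
  move=> [Dx|[d Dd <-]] [Dy|[d' Dd' <-]]; rewrite ?cj ?cD // => /hinj h'.
  - by have [] := h' (w1 _ Dx) (w1 _ Dy).
  - by have := h' (w1 _ Dx) (w2 _ Dd').
  - by have := h' (w2 _ Dd) (w1 _ Dy).
  - by have [->] := h' (w2 _ Dd) (w2 _ Dd').
pose R1 : set (seq T * T) := R `|` [set p | [/\ words_on D1 p.1, ~ words_on (D R) p.1
  & p.2 = j (h (map c p.1))]].
have ws s : words_on D1 s -> words_on (D R) (map c s) by exact: words_on_map.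
have D1E : D R1 = D1.
  apply/seteqP; split=> [x [y [Ry|[/= /(_ x (or_introl erefl))//]]]|x [[y Ry]|[d Dd <-]]].
  - by left; exists y.
  - by exists y; left.
  - exists (j (h (map c [:: j d]))); right; split => //= [y [<-|//]|].
      by right; exists d.
    by move=> /(_ _ (or_introl erefl)); have [] := jX _ Dd.
exfalso; apply: (Rmax R1).
  rewrite properEneq; split; last exact: subsetUl.
  apply/eqP => e; have : D R (j d0) by rewrite e D1E; right; exists d0.
  by have [] := jX _ Dd0.
right; rewrite /wgraph -/(D R1) D1E; split.
- by move=> x [/DX//|[d Dd <-]]; have [] := jX _ Dd.
- by apply: sub_infinite_set Dinf => x; left.
- move=> s; split=> [[y [Ry|[/= //]]] x xs|D1s].
    by left; apply: ((dom s).1 _ x xs); exists y.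
  have [Ds|nDs] := pselect (words_on (D R) s).
    by exists (h s); left; exact: hP.
  by exists (j (h (map c s))); right.
- move=> [s y] [Ry|[/= D1s _ ->]]; first by left; exact: val Ry.
  by right; exists (h (map c s)) => //; apply: hD; exact: ws.
have cross s y s' y' : R (s, y) -> words_on D1 s' -> ~ words_on (D R) s' ->
    y' = j (h (map c s')) -> s = s' \/ y = y' -> False.
  move=> Ry D1s' nDs' y'E [ss'|yy'].
    by apply: nDs'; rewrite -ss'; apply/dom; exists y.
  have := val _ Ry; rewrite /= yy' y'E.
  by have [] := jX _ (hD _ (ws _ D1s')).
move=> [s y] [s' y'] [Ry|[/= D1s nDs yE]] [Ry'|[/= D1s' nDs' y'E]] /=.
- exact: (Rinj _ _ Ry Ry').
- by move=> e; case: (cross _ _ _ _ Ry D1s' nDs' y'E e).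
- move=> e; case: (cross _ _ _ _ Ry' D1s nDs yE); case: e => ->; by [left|right].
- suff ss' : s = s' \/ y = y' -> s = s' by move=> /ss' e; rewrite yE y'E e.
  case=> //; rewrite yE y'E => /jinj e.
  have {}e := e (hD _ (ws _ D1s)) (hD _ (ws _ D1s')).
  have {}e := hinj _ _ (ws _ D1s) (ws _ D1s') e.
  exact: map_inj_on cinj D1s D1s' e.
Qed.

End Cardinals.

(** * Pairing vertices with edges that are not bridges *)

Lemma seq_has_min (T : eqType) (lt : T -> T -> Prop) (s : seq T) :
  (forall x y z, lt x y -> lt y z -> lt x z) ->
  (forall x y, x \in s -> y \in s -> [\/ x = y, lt x y | lt y x]) ->
  s <> [::] -> exists2 m, m \in s & forall x, x \in s -> x = m \/ lt m x.
Proof.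
move=> ltT; elim: s => // a [|b s] IH ltot _.
  by exists a => [|x]; rewrite inE // => /eqP; left.
have [|//|m ms mmin] := IH; first by move=> x y xs ys; apply: ltot; rewrite inE ?xs ?ys orbT.
have am : m \in a :: b :: s by rewrite inE ms orbT.
have [e|am'|ma] := ltot a m (mem_head _ _) am.
- exists a; rewrite ?mem_head // => x; rewrite inE => /orP[/eqP|/mmin]; rewrite e; by [left|].
- exists a; rewrite ?mem_head // => x; rewrite inE => /orP[/eqP|/mmin[->|mx]].
  + by left.
  + by right.
  + by right; apply: ltT am' mx.
- exists m => // x; rewrite inE => /orP[/eqP->|/mmin//]; by right.
Qed.

Section Pairing.
Variables (V E : choiceType) (o t : E -> V) (Q : Type) (sh : V -> Q).
Variables (ltV : V -> V -> Prop) (ltE : E -> E -> Prop).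
Variables (VS : set V) (ES : set E).

Definition bd (Y : {fset V}) (e : E) : bool := (o e \in Y) (+) (t e \in Y).

(** [Y] stays inside one sheet because the orders compare only edges, and only vertices, of a common
    sheet. *)
Definition cutmin (Y : {fset V}) (e : E) := [/\ ES e,
  forall v, v \in Y -> VS v /\ sh v = sh (o e), bd Y e
  & forall e', ES e' -> bd Y e' -> e' = e \/ ltE e e'].

(* e is not the largest edge of a line of the forest. *)
Definition nonbridge : set E := [set e | exists Y, cutmin Y e].

Definition minv (Y : {fset V}) (v : V) :=
  v \in Y /\ forall w, w \in Y -> w = v \/ ltV v w.

(* When edges are added in increasing order, e merges the component whose
   least vertex is v into an older or an infinite one. *)
Definition kills (e : E) (v : V) := exists Y, [/\ cutmin Y e, minv Y v
  & forall Y' v', cutmin Y' e -> minv Y' v' -> v' = v \/ ltV v' v].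

(* The component of x in the forest of the edges smaller than e. *)
Definition comp (e : E) (x : V) : set V := [set v | forall f : V -> Prop,
  (forall e', ES e' -> ltE e' e -> (f (o e') <-> f (t e'))) -> f x -> f v].

Hypothesis ES_VS : forall e, ES e -> VS (o e) /\ VS (t e).
Hypothesis sh_edge : forall e, sh (o e) = sh (t e).
Hypothesis ltVxx : forall v, ~ ltV v v.
Hypothesis ltVT : forall u v w, ltV u v -> ltV v w -> ltV u w.
Hypothesis ltV_total : forall u v, VS u -> VS v -> sh u = sh v ->
  [\/ u = v, ltV u v | ltV v u].
Hypothesis ltExx : forall v, ~ ltE v v.
Hypothesis ltET : forall u v w, ltE u v -> ltE v w -> ltE u w.
Hypothesis ltE_total : forall d e, ES d -> ES e -> sh (o d) = sh (o e) ->
  [\/ d = e, ltE d e | ltE e d].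

Lemma minv_exists (Y : {fset V}) q : Y != fset0 ->
  (forall v, v \in Y -> VS v /\ sh v = q) -> exists v, minv Y v.
Proof.
move=> /fset0Pn[v vY] Yq.
have [//|x y xY yY|e|m mY mmin] := @seq_has_min V ltV Y.
- have [Vx xq] := Yq _ xY; have [Vy yq] := Yq _ yY.
  by apply: ltV_total => //; rewrite xq.
- by move: vY; rewrite -[v \in Y]/(v \in enum_fset Y) e.
by exists m.
Qed.

Lemma minv_uniq Y v w : minv Y v -> minv Y w -> v = w.
Proof.
by move=> [vY vmin] [wY wmin]; case: (vmin _ wY) => // vw; case: (wmin _ vY) => // wv;
  case: (ltVxx (ltVT vw wv)).
Qed.

Lemma comp_refl e x : comp e x x.
Proof. by move=> f _. Qed.

Lemma comp_edge e e' : ES e' -> ltE e' e ->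
  forall x, comp e x (o e') <-> comp e x (t e').
Proof. by move=> Ee' e'e x; split=> h f fe fx; apply/fe => //; exact: h. Qed.

Lemma comp_trans e x y z : comp e x y -> comp e y z -> comp e x z.
Proof. by move=> xy yz f fe fx; apply: yz => //; exact: xy. Qed.

Lemma comp_sym e x y : comp e x y -> comp e y x.
Proof.
move=> /(_ (fun z => comp e z x)); apply; last exact: comp_refl.
move=> e' Ee' lte'; have ee f : (forall d, ES d -> ltE d e -> (f (o d) <-> f (t d))) ->
  f (o e') <-> f (t e') by apply.
by split=> h f fe fx; apply: h => //; apply/(ee f fe).
Qed.

Lemma comp_mono e e' x y : e = e' \/ ltE e e' -> comp e x y -> comp e' x y.
Proof.
move=> ee' xy f fe fx; apply: xy => // d Ed de; apply: fe => //.
by case: ee' => [<-//|]; exact: ltET.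
Qed.

Lemma comp_closed (Y : {fset V}) e x :
  (forall d, ES d -> ltE d e -> ~~ bd Y d) -> x \in Y ->
  forall y, comp e x y -> y \in Y.
Proof.
move=> Yc xY y /(_ (fun z => z \in Y)); apply => // d Ed de.
by have := Yc d Ed de; rewrite /bd; case: (o d \in Y); case: (t d \in Y).
Qed.

Lemma cutmin_closed Y e : cutmin Y e -> forall d, ES d -> ltE d e -> ~~ bd Y d.
Proof.
move=> [_ _ _ Ymin] d Ed de; apply/negP => /Ymin[//|e1|ed].
  by move: de; rewrite e1; exact: ltExx.
exact: ltExx (ltET de ed).
Qed.

Lemma bd_comp (C : {fset V}) e x : (forall v, v \in C <-> comp e x v) ->
  forall d, ES d -> ltE d e -> ~~ bd C d.
Proof.
move=> CE d Ed de; have := comp_edge Ed de x; rewrite -!CE /bd.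
by case: (o d \in C); case: (t d \in C) => // -[]; [move=> /(_ isT)|move=> _ /(_ isT)].
Qed.

Lemma compf (Y : {fset V}) e x :
  (forall d, ES d -> ltE d e -> ~~ bd Y d) -> x \in Y ->
  exists C : {fset V}, (forall v, v \in C <-> comp e x v)
    /\ (forall v, v \in C -> v \in Y).
Proof.
move=> Yc xY; exists [fset v in Y | `[< comp e x v >]]%fset; split=> v; rewrite !inE.
  split=> [/andP[_ /asboolP]//|xv].
  by apply/andP; split; [exact: comp_closed xv|exact/asboolP].
by case/andP.
Qed.

(** No edge below [e] leaves [Y], so [Y] contains the component of [x]. This component is therefore
    finite, misses the other end of [e], and has no smaller edge in its coboundary. *)
Lemma cutmin_comp Y e x : cutmin Y e -> x \in Y -> x = o e \/ x = t e ->
  exists C, [/\ forall v, v \in C <-> comp e x v, cutmin C e,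
    forall v, v \in C -> v \in Y & exists w, minv C w].
Proof.
move=> Ye xY xe; have [Ee Ysh Ybd Ymin] := Ye.
have [C [CE CY]] := compf (cutmin_closed Ye) xY.
have Csh v : v \in C -> VS v /\ sh v = sh (o e) by move/CY; exact: Ysh.
have xC : x \in C by apply/CE; exact: comp_refl.
exists C; split => //; last first.
  by apply: minv_exists Csh; apply/fset0Pn; exists x.
split => //.
  move: Ybd; rewrite /bd; case: xe => xe; move: xY xC; rewrite xe => -> -> /=.
    by apply: contra; exact: CY.
  by rewrite !addbT; apply: contra; exact: CY.
move=> d Ed Cd; have dsh : sh (o d) = sh (o e).
  move: Cd; rewrite /bd; have [oC _|_] := boolP (o d \in C); first by have [] := Csh _ oC.
  by rewrite sh_edge /= => tC; have [] := Csh _ tC.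
have [de|de|ed] := ltE_total Ed Ee dsh; [by left| |by right].
by have := bd_comp CE Ed de; rewrite Cd.
Qed.

(** Every [Y] with least coboundary edge [e] contains the finite component of an end of [e], so its
    least vertex is at most that of the component. There are at most two such components, and the
    larger of their least vertices is the one killed. *)
Lemma nonbridge_kills e : nonbridge e -> exists v, kills e v.
Proof.
(* [M x w]: the end [x] of [e] has a finite component below [e], with least vertex [w]. *)
pose M x w := (x = o e \/ x = t e) /\ exists C, [/\ forall v, v \in C <-> comp e x v,
  cutmin C e & minv C w].
have Mbound Y v : cutmin Y e -> minv Y v -> exists x w, M x w /\ (v = w \/ ltV v w).
  move=> Ye [vY vmin]; have [x [xe xY]] : exists x, (x = o e \/ x = t e) /\ x \in Y.
    have [_ _ + _] := Ye; rewrite /bd; have [oY _|_ /= tY] := boolP (o e \in Y).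
      by exists (o e); split => //; left.
    by exists (t e); split => //; right.
  have [C [CE Ce CY [w wC]]] := cutmin_comp Ye xY xe.
  exists x, w; split; first by split => //; exists C.
  by have [wCC _] := wC; case: (vmin _ (CY _ wCC)) => [->|]; [left|right].
have Muniq x w w' : M x w -> M x w' -> w = w'.
  move=> [_ [C [CE _ wC]]] [_ [C' [CE' _ wC']]].
  have CC' : C = C'.
    apply/fsetP => v; apply/idP/idP => [/CE|/CE'] h; [exact/CE'|exact/CE].
  by rewrite -CC' in wC'; exact: minv_uniq wC wC'.
have Mtot x w x' w' : M x w -> M x' w' -> [\/ w = w', ltV w w' | ltV w' w].
  move=> [_ [C [_ [_ Csh _ _] [wC _]]]] [_ [C' [_ [_ Csh' _ _] [wC' _]]]].
  have [Vw shw] := Csh _ wC; have [Vw' shw'] := Csh' _ wC'.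
  by apply: ltV_total => //; rewrite shw.
have Mkill x w : M x w -> (forall x' w', M x' w' -> w' = w \/ ltV w' w) -> kills e w.
  move=> [_ [C [_ Ce wC]]] wmax; exists C; split => // Y' v' Y'e v'Y'.
  have [x' [w' [Mx' v'w']]] := Mbound _ _ Y'e v'Y'.
  have := wmax _ _ Mx'; case: v'w' => [->//|v'w'] [<-|w'w]; first by right.
  by right; exact: ltVT w'w.
move=> [Y Ye]; have [v vY] : exists v, minv Y v.
  have [_ Ysh Ybd _] := Ye; apply: minv_exists Ysh.
  by apply/negP => /eqP Y0; move: Ybd; rewrite /bd Y0 !inE.
have [x [w [Mx _]]] := Mbound _ _ Ye vY.
have [[x' [w' [Mx' ww']]]|nw] := pselect (exists x' w', M x' w' /\ ltV w w'); last first.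
  exists w; apply: (Mkill _ _ Mx) => x' w' Mx'.
  by case: (Mtot _ _ _ _ Mx Mx') => [->|ww'|]; [left|case: nw; exists x', w'|right].
exists w'; apply: (Mkill _ _ Mx') => x'' w'' Mx''.
(* An edge has only two ends, so two of the three coincide. *)
have : x'' = x \/ x'' = x' \/ x = x'.
  by case: Mx Mx' Mx'' => [[->|->] _] [[->|->] _] [[->|->] _]; auto.
case=> [e1|[e1|e1]].
- by right; rewrite e1 in Mx''; rewrite (Muniq _ _ _ Mx'' Mx).
- by left; rewrite e1 in Mx''; rewrite (Muniq _ _ _ Mx'' Mx').
- by rewrite -e1 in Mx'; move: ww'; rewrite (Muniq _ _ _ Mx Mx') => /ltVxx.
Qed.

Definition symdiff (Y Z : {fset V}) : {fset V} := ((Y `\` Z) `|` (Z `\` Y))%fset.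

Lemma in_symdiff Y Z v : (v \in symdiff Y Z) = (v \in Y) (+) (v \in Z).
Proof. by rewrite !inE; case: (v \in Y); case: (v \in Z). Qed.

Lemma bd_symdiff Y Z e : bd (symdiff Y Z) e = bd Y e (+) bd Z e.
Proof.
rewrite /bd !in_symdiff.
by case: (o e \in Y); case: (t e \in Y); case: (o e \in Z); case: (t e \in Z).
Qed.

Lemma bd_neq0 Y e : bd Y e -> Y != fset0.
Proof. by apply: contraTneq => ->; rewrite /bd !inE. Qed.

Lemma kills_uniq e v w : kills e v -> kills e w -> v = w.
Proof.
move=> [Y [Ye vY vmax]] [Z [Ze wZ wmax]].
case: (vmax _ _ Ze wZ) => [->//|wv]; case: (wmax _ _ Ye vY) => [->//|vw].
by case: (ltVxx (ltVT wv vw)).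
Qed.

(* The symmetric difference of two finite sets with least vertex v has a larger
   least vertex, and the least edge of its boundary is the smaller of the two. *)
Lemma kills_inj e e' v : kills e v -> kills e' v -> e = e'.
Proof.
have lt_false d d' w : kills d w -> kills d' w -> ltE d d' -> False.
  move=> [Y [Yd [wY wmin] wmax]] [Y' [Y'd' [wY' wmin'] _]] dd'.
  have [Ed Ysh Ybd Ymin] := Yd; have [Ed' Ysh' Ybd' Ymin'] := Y'd'.
  have dsh : sh (o d) = sh (o d').
    by have [_ <-] := Ysh _ wY; have [_ <-] := Ysh' _ wY'.
  have Dd : cutmin (symdiff Y Y') d.
    split => // [u||d'' Ed''].
    - rewrite in_symdiff; have [/Ysh//|_ /=] := boolP (u \in Y).
      by move=> /Ysh'; rewrite dsh.
    - by rewrite bd_symdiff Ybd (negbTE (cutmin_closed Y'd' Ed dd')).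
    - rewrite bd_symdiff; have [/Ymin h _|_ /=] := boolP (bd Y d''); first exact: h.
      by move=> /Ymin'[//|->|d'd'']; right => //; exact: ltET d'd''.
  have [_ Dsh Dbd _] := Dd.
  have [u uD] := minv_exists (bd_neq0 Dbd) Dsh.
  have wu : ltV w u.
    have [] := uD; rewrite in_symdiff => uYY' _.
    have uw : u <> w by move=> uw; move: uYY'; rewrite uw wY wY'.
    have [/wmin|uY] := boolP (u \in Y); first by case.
    by move: uYY'; rewrite (negbTE uY) /= => /wmin'; case.
  case: (wmax _ _ Dd uD) => [uw|uw]; last by case: (ltVxx (ltVT wu uw)).
  by rewrite uw in wu; case: (ltVxx wu).
move=> kev ke'v; have [Y [[Ee Ysh _ _] [vY _] _]] := kev.
have [Y' [[Ee' Ysh' _ _] [vY' _] _]] := ke'v.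
have sh' : sh (o e) = sh (o e') by have [_ <-] := Ysh _ vY; have [_ <-] := Ysh' _ vY'.
case: (ltE_total Ee Ee' sh') => // h; first by case: (lt_false _ _ _ kev ke'v h).
by case: (lt_false _ _ _ ke'v kev h).
Qed.

Lemma kills_VS e v : kills e v -> VS v.
Proof. by move=> [Y [[_ Ysh _ _] [vY _] _]]; have [] := Ysh _ vY. Qed.

Lemma kills_nonbridge e v : kills e v -> nonbridge e.
Proof. by move=> [Y [Ye _ _]]; exists Y. Qed.

Section Action.
Variables (G : groupType) (A : set G) (av : G -> V -> V) (ae : G -> E -> E).
Hypothesis As : is_subgroup A.
Hypothesis av1 : forall v, av 1 v = v.
Hypothesis avM : forall g h v, av (g * h) v = av g (av h v).
Hypothesis ae1 : forall e, ae 1 e = e.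
Hypothesis aeM : forall g h e, ae (g * h) e = ae g (ae h e).
Hypothesis o_av : forall g e, o (ae g e) = av g (o e).
Hypothesis t_av : forall g e, t (ae g e) = av g (t e).
Hypothesis VSA : forall a v, A a -> VS v -> VS (av a v).
Hypothesis ESA : forall a e, A a -> ES e -> ES (ae a e).
Hypothesis shA : forall a u v, A a -> VS u -> VS v -> sh u = sh v ->
  sh (av a u) = sh (av a v).
Hypothesis ltVA : forall a u v, A a -> VS u -> VS v -> sh u = sh v ->
  ltV u v -> ltV (av a u) (av a v).
Hypothesis ltEA : forall a d e, A a -> ltE d e -> ltE (ae a d) (ae a e).

Let aVK a : cancel (av a) (av a^-1).
Proof. by move=> v; rewrite -avM mulVg av1. Qed.

Let aVKV a : cancel (av a^-1) (av a).
Proof. by move=> v; rewrite -avM mulgV av1. Qed.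

Let aEK a : cancel (ae a) (ae a^-1).
Proof. by move=> v; rewrite -aeM mulVg ae1. Qed.

Let aEKV a : cancel (ae a^-1) (ae a).
Proof. by move=> v; rewrite -aeM mulgV ae1. Qed.

Definition transl (a : G) (Y : {fset V}) : {fset V} := [fset av a v | v in Y]%fset.

Lemma in_transl a Y v : (v \in transl a Y) = (av a^-1 v \in Y).
Proof.
apply/imfsetP/idP => [[w wY ->]|vY]; first by rewrite aVK.
by exists (av a^-1 v); rewrite ?aVKV.
Qed.

Lemma bd_transl a Y e : bd (transl a Y) e = bd Y (ae a^-1 e).
Proof. by rewrite /bd !in_transl o_av t_av. Qed.

Lemma cutmin_transl a Y e : A a -> cutmin Y e -> cutmin (transl a Y) (ae a e).
Proof.
move=> Aa [Ee Ysh Ybd Ymin]; have [Vo _] := ES_VS Ee; split.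
- exact: ESA.
- move=> v; rewrite in_transl => /Ysh[Vv shv].
  rewrite -[v](aVKV a); split; first exact: VSA.
  by rewrite o_av; apply: shA.
- by rewrite bd_transl aEK.
- move=> d Ed; rewrite bd_transl => /Ymin[|e1|ed].
  + by apply: ESA => //; exact: subgroupV.
  + by left; rewrite -e1 aEKV.
  + by right; rewrite -[d](aEKV a); exact: ltEA.
Qed.

Lemma minv_transl a Y v q : A a -> (forall u, u \in Y -> VS u /\ sh u = q) ->
  minv Y v -> minv (transl a Y) (av a v).
Proof.
move=> Aa Ysh [vY vmin]; split; first by rewrite in_transl aVK.
move=> u; rewrite in_transl => uY; have [Vu shu] := Ysh _ uY; have [Vv shv] := Ysh _ vY.
rewrite -[u](aVKV a); case: (vmin _ uY) => [->|vu]; [by left|right].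
by apply: ltVA => //; rewrite shv.
Qed.

Lemma kills_act a e v : A a -> kills e v -> kills (ae a e) (av a v).
Proof.
move=> Aa [Y [Ye vY vmax]]; have [Ee Ysh _ _] := Ye.
exists (transl a Y); split.
- exact: cutmin_transl.
- exact: minv_transl Ysh vY.
move=> Z w Zae wZ; have AVa := subgroupV As Aa.
have := cutmin_transl AVa Zae; rewrite aEK => Z'e.
have [_ Zsh _ _] := Zae; have wZ' := minv_transl AVa Zsh wZ.
case: (vmax _ _ Z'e wZ') => [<-|wv]; rewrite ?aVKV; [by left|right].
rewrite -[w](aVKV a).
have [vYY _] := vY; have [Vv shv] := Ysh _ vYY.
have [_ Z'sh _ _] := Z'e; have [wZZ' _] := wZ'; have [Vw shw] := Z'sh _ wZZ'.
by apply: ltVA => //; rewrite shw.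
Qed.

Let orbV u v := exists2 a, A a & v = av a u.
Let orbE d e := exists2 a, A a & e = ae a d.

Lemma nonbridge_count_le j k : class_count nonbridge orbE j ->
  class_count VS orbV k -> (j <= k)%N.
Proof.
apply: (class_count_le (Q := kills)).
  by move=> e /nonbridge_kills[v kev]; exists v => //; exact: kills_VS kev.
move=> d e v w _ _ _ _ kdv kew [a Aa wE]; exists a => //.
by apply: kills_inj kew _; rewrite wE; exact: kills_act.
Qed.

Lemma nonbridge_act a e : A a -> nonbridge e -> nonbridge (ae a e).
Proof. by move=> Aa [Y Ye]; exists (transl a Y); exact: cutmin_transl. Qed.

Lemma comp_act a e x w : A a -> comp e x w -> comp (ae a e) (av a x) (av a w).
Proof.
move=> Aa xw f fe fx.
apply: (xw (fun u => f (av a u))) => // d Ed de; rewrite -o_av -t_av.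
by apply: fe; [exact: ESA|exact: ltEA].
Qed.

Section Surjectivity.
Hypothesis free : forall a v, A a -> VS v -> av a v = v -> a = 1.
Hypothesis locally_finite : forall v, VS v ->
  exists s : seq E, forall e, ES e -> o e = v \/ t e = v -> e \in s.
Hypothesis no_finite_comp : forall Y : {fset V}, Y != fset0 ->
  (exists q, forall v, v \in Y -> VS v /\ sh v = q) -> exists2 e, ES e & bd Y e.
Variable k : nat.
Hypothesis VScount : class_count VS orbV k.

(** The coboundary of [Y] is finite by local finiteness and nonempty by [no_finite_comp]. *)
Lemma cutmin_exists (Y : {fset V}) q : Y != fset0 ->
  (forall v, v \in Y -> VS v /\ sh v = q) -> exists e, cutmin Y e.
Proof.
move=> Y0 Ysh.
have [s sP] : exists s : seq E, forall e, ES e -> bd Y e -> e \in s.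
  have [s sP] : exists s : seq E, forall e v, ES e -> v \in enum_fset Y ->
      o e = v \/ t e = v -> e \in s.
    have : forall v, v \in enum_fset Y -> VS v by move=> v /Ysh[].
    elim: (enum_fset Y) => [|v l IH] lV; first by exists [::].
    have [|s sP] := IH; first by move=> u ul; apply: lV; rewrite inE ul orbT.
    have [s' s'P] := locally_finite (lV v (mem_head _ _)).
    exists (s' ++ s) => e u Ee; rewrite inE mem_cat => /orP[/eqP->|ul] eu.
      by rewrite s'P.
    by rewrite (sP _ u) ?orbT.
  exists s => e Ee; rewrite /bd; have [oY _|_ /= tY] := boolP (o e \in Y).
    by apply: sP oY _ => //; left.
  by apply: sP tY _ => //; right.
have bdsh d : ES d -> bd Y d -> sh (o d) = q.
  move=> Ed; rewrite /bd; have [oC _|_] := boolP (o d \in Y); first by have [] := Ysh _ oC.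
  by rewrite sh_edge /= => tC; have [] := Ysh _ tC.
pose s' := [seq e <- s | `[< ES e >] && bd Y e].
have s'E e : e \in s' <-> ES e /\ bd Y e.
  rewrite mem_filter; split=> [/andP[/andP[/asboolP]]//|[Ee Ye]].
  by rewrite Ye sP // !andbT; apply/asboolP.
have [e0 Ee0 Ye0] := no_finite_comp Y0 (ex_intro _ q Ysh).
have [||m /s'E[Em Ym] mmin] := @seq_has_min E ltE s' ltET.
- move=> d e /s'E[Ed Yd] /s'E[Ee Ye]; apply: ltE_total => //.
  by rewrite !bdsh.
- move=> s0; have /s'E : ES e0 /\ bd Y e0 by []. by rewrite s0.
exists m; split => //.
  by move=> v /Ysh; rewrite bdsh.
by move=> d Ed Yd; apply: mmin; apply/s'E.
Qed.

(** If [v] is never killed, its components below the edges of [T] stay finite with least vertex [v]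
    but grow without bound. Having finitely many orbits, one of them contains two vertices of the
    same orbit. The element carrying one to the other must fix [v], against freeness. *)
Lemma vertex_killed v : VS v -> exists e, kills e v.
Proof.
(* [T e] makes the component of [v] below [e] finite with least vertex [v]. A largest such [e] kills
   [v]. *)
move=> Vv; pose T e := exists2 Y, cutmin Y e & minv Y v.
have Tsh e : T e -> ES e /\ sh (o e) = sh v.
  by move=> [Y [Ee Ysh _ _] [vY _]]; split => //; have [_ ->] := Ysh _ vY.
have [e0 T0] : exists e, T e.
  have v1sh u : u \in [fset v]%fset -> VS u /\ sh u = sh v by rewrite inE => /eqP->.
  have [|e ve] := cutmin_exists _ v1sh; first by apply/fset0Pn; exists v; rewrite inE.
  exists e; exists [fset v]%fset => //; split=> [|w]; rewrite inE // => /eqP; by left.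
have [[e Te emax]|noM] := pselect (exists2 e, T e & forall e', T e' -> ~ ltE e e').
  have [Y Ye vY] := Te; exists e; exists Y; split => // Z w Ze wZ.
  have [Ee Ysh Ybd Ymin] := Ye; have [_ Zsh Zbd Zmin] := Ze.
  have [vYY vmin] := vY; have [wZZ wmin] := wZ.
  have [_ shv] := Ysh _ vYY; have [Vw shw] := Zsh _ wZZ.
  have [->|vw|wv] : [\/ v = w, ltV v w | ltV w v].
    by apply: ltV_total => //; rewrite shw.
  - by left.
  (* In the symmetric difference [e] leaves the coboundary while [v] stays least, so its least edge
     would be an element of [T] above [e]. *)
  - exfalso; pose D := symdiff Y Z.
    have Dsh u : u \in D -> VS u /\ sh u = sh (o e).
      by rewrite in_symdiff; have [/Ysh//|_ /=] := boolP (u \in Y); move=> /Zsh.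
    have vD : v \in D.
      rewrite in_symdiff vYY; apply/negP => /wmin[vw'|wv].
        by apply: (ltVxx (v := v)); rewrite {2}vw'.
      by apply: ltVxx (ltVT vw wv).
    have vDmin : minv D v.
      split => // u; rewrite in_symdiff; have [/vmin h _|_ /=] := boolP (u \in Y); first exact: h.
      by move=> /wmin[->|wu]; right => //; exact: ltVT vw wu.
    have [|d Dd] := cutmin_exists _ Dsh; first by apply/fset0Pn; exists v.
    apply: (emax d); first by exists D.
    have [Ed _ + _] := Dd; rewrite bd_symdiff.
    have [/Ymin h|nYd /= /Zmin h] := boolP (bd Y d).
      by case: (h Ed) => // ->; rewrite Zbd.
    by case: (h Ed) => // de; rewrite de Ybd in nYd.
  - by right.
have next e : T e -> exists2 e', T e' & ltE e e'.
  move=> Te; apply: contrapT => ne; apply: noM; exists e => // e' Te' ee'.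
  by apply: ne; exists e'.
have TC e : T e -> exists C : {fset V}, [/\ forall u, u \in C <-> comp e v u,
    forall u, u \in C -> VS u /\ sh u = sh v & minv C v].
  move=> [Y Ye [vY vmin]]; have [Ee Ysh _ _] := Ye.
  have [C [CE CY]] := compf (cutmin_closed Ye) vY.
  exists C; split => //; first by move=> u /CY/Ysh[Vu ->]; have [_ ->] := Ysh _ vY.
  by split=> [|w /CY/vmin//]; apply/CE; exact: comp_refl.
(* The least edge [e1] of the coboundary of [C] is again in [T]; beyond a later element [e'] of [T]
   the component contains both ends of [e1]. *)
have grow e (C : {fset V}) : T e -> (forall u, u \in C <-> comp e v u) ->
    exists e' C', [/\ T e', ltE e e', forall u, u \in C' <-> comp e' v u
      & (#|` C| < #|` C'|)%N].
  move=> Te CE; have [C1 [C1E C1sh C1min]] := TC _ Te.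
  have CC1 : C = C1 by apply/fsetP => u; apply/idP/idP => [/CE|/C1E] h; [exact/C1E|exact/CE].
  rewrite -CC1 in C1sh C1min.
  have [|e1 Ce1] := cutmin_exists _ C1sh.
    by apply/fset0Pn; exists v; apply/CE; exact: comp_refl.
  have [Ee1 Csh1 Cbd1 _] := Ce1.
  have ee1 : e = e1 \/ ltE e e1.
    have [Ee she] := Tsh _ Te.
    have she1 : sh (o e) = sh (o e1) by rewrite she; have [vC _] := C1min; have [_ ->] := Csh1 _ vC.
    case: (ltE_total Ee Ee1 she1) => [->|?|e1e]; [by left|by right|].
    by have := bd_comp CE Ee1 e1e; rewrite Cbd1.
  have [|e' Te' e1e'] := next e1; first by exists C.
  have ee' : ltE e e' by case: ee1 => [->//|ee1]; exact: ltET ee1 e1e'.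
  have [C' [C'E _ _]] := TC _ Te'; exists e', C'; split => //.
  have CC' : (C `<=` C')%fset.
    by apply/fsubsetP => u /CE cu; apply/C'E; apply: comp_mono cu; right.
  apply: fproper_ltn_card; rewrite fproperEneq CC' andbT.
  apply/eqP => eCC; have := comp_edge Ee1 e1e' v.
  rewrite -!C'E -eCC; move: Cbd1; rewrite /bd.
  by case: (o e1 \in C); case: (t e1 \in C) => // _ []; [move=> /(_ isT)|move=> _ /(_ isT)].
have unbounded N : forall e, T e -> exists e' C', [/\ T e', e = e' \/ ltE e e',
    forall u, u \in C' <-> comp e' v u & (N <= #|` C'|)%N].
  move=> e Te; elim: N => [|N [e' [C' [Te' ee' C'E NC']]]].
    by have [C [CE _ _]] := TC _ Te; exists e, C; split => //; left.
  have [e2 [C2 [Te2 e'e2 C2E CC2]]] := grow _ _ Te' C'E.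
  exists e2, C2; split => //; last exact: leq_ltn_trans CC2.
  by right; case: ee' => [->//|ee']; exact: ltET ee' e'e2.
(* The translate of the component of [v] has least vertex [av a v] and contains [v]. If [T] goes
   beyond [ae a e], a later component of [v] contains [av a v], and minimality both ways gives
   equality. Otherwise all components of [v] lie in the finite translate, against [unbounded]. *)
have fixed e u a : T e -> comp e v u -> comp e v (av a u) -> A a ->
    e = ae a e \/ ltE e (ae a e) -> av a v = v.
  move=> Te cu cau Aa eae; have [C [CE Csh Cmin]] := TC _ Te.
  have aCE w : w \in transl a C <-> comp (ae a e) (av a u) w.
    rewrite in_transl CE; split=> [cw|cw].
      rewrite -[w](aVKV a); apply: comp_act => //.
      exact: comp_trans (comp_sym cu) cw.
    apply: comp_trans cu _; have := comp_act (subgroupV As Aa) cw.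
    by rewrite aEK aVK.
  have cauv : comp (ae a e) (av a u) v by apply: comp_mono (comp_sym cau).
  have [avC avmin] := minv_transl Aa Csh Cmin.
  have /avmin[//|avv] : v \in transl a C by apply/aCE.
  have [[e' Te' aee']|nlt] := pselect (exists2 e', T e' & ltE (ae a e) e').
    have [C' [C'E _ [_ min']]] := TC _ Te'.
    have /min'[//|vav] : av a v \in C'.
      apply/C'E; apply: (@comp_trans _ _ (av a u)).
        apply: comp_mono cau; right; case: eae => [->//|eae]; exact: ltET eae aee'.
      by apply: (comp_mono (or_intror aee')); apply/aCE.
    by case: (ltVxx (ltVT avv vav)).
  have [e' [C' [Te' _ C'E card']]] := unbounded (#|` transl a C|.+1) _ Te.
  have [Ee' she'] := Tsh _ Te'; have [Ee she] := Tsh _ Te.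
  have [Vu shu] : VS u /\ sh u = sh v by apply: Csh; apply/CE.
  have [Vau shau] : VS (av a u) /\ sh (av a u) = sh v by apply: Csh; apply/CE.
  have e'ae : e' = ae a e \/ ltE e' (ae a e).
    have [Vo _] := ES_VS Ee.
    have sh' : sh (o e') = sh (o (ae a e)).
      by rewrite she' o_av -shau; apply: shA => //; rewrite she.
    by case: (ltE_total Ee' (ESA Aa Ee) sh') => [|?|h]; [by left|by right|case: nlt; exists e'].
  exfalso; move: card'; rewrite ltnNge => /negP; apply.
  apply: fsubset_leq_card; apply/fsubsetP => w /C'E cw; apply/aCE.
  by apply: comp_trans cauv _; apply: comp_mono cw.
have [idx [idxlt idxR _]] := VScount.
have [e [C [Te _ CE cardC]]] := unbounded k.+1 _ T0.
have [C1 [C1E C1sh C1min]] := TC _ Te.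
have Csh u : u \in C -> VS u /\ sh u = sh v by move/CE/C1E; exact: C1sh.
(* Pigeonhole: [C] has more than [k] vertices and there are [k] orbits. *)
have [u [w [uC wC uw iuw]]] : exists u w, [/\ u \in C, w \in C, u <> w & idx u = idx w].
  apply: contrapT => nuw; move: cardC; apply/negP; rewrite -leqNgt.
  rewrite -(size_map idx) -[k in (_ <= k)%N](size_iota 0); apply: uniq_leq_size.
    rewrite map_inj_in_uniq ?fset_uniq // => u w uC wC e'.
    by apply: contrapT => ne; apply: nuw; exists u, w.
  move=> j /mapP[u uC ->]; rewrite mem_iota add0n; apply: idxlt.
  by have [] := Csh _ uC.
have [Vu shu] := Csh _ uC; have [Vw shw] := Csh _ wC.
have [a Aa wE] := (idxR _ _ Vu Vw).1 iuw.
have cu : comp e v u by apply/CE.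
have cw : comp e v w by apply/CE.
have [Ee she] := Tsh _ Te; have [Vo _] := ES_VS Ee.
have a1 : a = 1.
  apply: free Vv _ => //.
  have she' : sh (o e) = sh (o (ae a e)).
    by rewrite o_av she -shw wE; apply: shA => //; rewrite she.
  have [eae|eae|aee] := ltE_total Ee (ESA Aa Ee) she'.
  - by apply: fixed cu _ Aa _ => //; [rewrite -wE|left].
  - by apply: fixed cu _ Aa _ => //; [rewrite -wE|right].
  (* If [a] lowers [e], its inverse raises [e], and [fixed] is applied to the inverse from [w]. *)
  - rewrite -[v in RHS](aVKV a); congr av; apply/esym.
    apply: (fixed e w) => //; [by rewrite wE aVK|exact: subgroupV|right].
    by rewrite -[e in ltE e _](aEK a); apply: ltEA => //; exact: subgroupV.
by case: uw; rewrite wE a1 av1.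
Qed.

Lemma nonbridge_count_ge j : class_count nonbridge orbE j -> (k <= j)%N.
Proof.
move=> cj; apply: (class_count_le (Q := fun v e => kills e v)) VScount cj.
  by move=> v /vertex_killed[e kev]; exists e => //; exact: kills_nonbridge kev.
move=> v w d e _ _ _ _ kdv kew [a Aa eE]; exists a => //.
by apply: kills_uniq kew _; rewrite eE; exact: kills_act.
Qed.

End Surjectivity.
End Action.
End Pairing.

(** Intersecting the finite set with [VS] does not change its coboundary in [ES], because the edges
    of [ES] have both ends in [VS]. *)
Lemma nonbridge_mono (V E : choiceType) (o t : E -> V) (Q : Type) (sh : V -> Q)
    (ltE : E -> E -> Prop) (VS VS' : set V) (ES ES' : set E) :
  (forall e, ES e -> VS (o e) /\ VS (t e)) -> VS `<=` VS' -> ES `<=` ES' ->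
  ES `&` nonbridge o t sh ltE VS' ES' `<=` nonbridge o t sh ltE VS ES.
Proof.
move=> EV VV EE e [Ee [Y [_ Ysh Ybd Ymin]]].
exists [fset v in Y | `[< VS v >]]%fset.
have bdE d : ES d -> bd o t [fset v in Y | `[< VS v >]]%fset d = bd o t Y d.
  by move=> /EV[Vo Vt]; rewrite /bd !inE (asboolT Vo) (asboolT Vt) !andbT.
split => //; first by move=> v; rewrite !inE => /andP[/Ysh[_ shv] /asboolP Vv].
  by rewrite bdE.
by move=> d Ed; rewrite bdE // => /Ymin; apply; exact: EE.
Qed.

(** * Euler characteristics *)

(** Coordinates on a free action: [x] corresponds to its orbit and to the element [ga x] that
    carries the representative to [x]. Freeness makes [ga x] unique, hence equivariant. *)
Lemma free_orbit_section (G : groupType) (A : set G) (T : Type) (act : G -> T -> T)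
    (S : set T) k :
  is_subgroup A -> (forall x, act 1 x = x) ->
  (forall g h x, act (g * h) x = act g (act h x)) ->
  (forall a x, A a -> S x -> S (act a x)) ->
  (forall a x, A a -> S x -> act a x = x -> a = 1) ->
  class_count S (fun x y => exists2 a, A a & y = act a x) k ->
  exists (idx : T -> nat) (rho : 'I_k -> T) (ga : T -> G), [/\
    forall j, [/\ S (rho j), idx (rho j) = j & ga (rho j) = 1],
    forall a x, A a -> S x -> idx (act a x) = idx x /\ ga (act a x) = a * ga x
    & forall x, S x -> A (ga x) /\ exists2 j : 'I_k, idx x = j & x = act (ga x) (rho j)].
Proof.
move=> As act1 actM actS free [idx [idxlt idxR idxs]].
have /choice[rho rhoP] : forall j : 'I_k, exists x, S x /\ idx x = j.
  by move=> j; have [x Sx xj] := idxs _ (ltn_ord j); exists x.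
have /choice[ga gaP] : forall x, exists a, S x ->
    A a /\ exists2 j : 'I_k, idx x = j & x = act a (rho j).
  move=> x; have [Sx|nS] := pselect (S x); last by exists 1.
  have [Sr rj] := rhoP (Ordinal (idxlt _ Sx)).
  have [|a Aa xE] := (idxR (rho (Ordinal (idxlt _ Sx))) x Sr Sx).1; first by rewrite rj.
  by exists a => _; split => //; exists (Ordinal (idxlt _ Sx)).
have act_inj a b x : A a -> A b -> S x -> act a x = act b x -> a = b.
  move=> Aa Ab Sx e; have : b^-1 * a = 1.
    apply: (free _ x) => //; first by apply: subgroupM => //; exact: subgroupV.
    by rewrite actM e -actM mulVg act1.
  by move/(congr1 (fun z => b * z)); rewrite mulVKg mulg1.
have gaE x a (j : 'I_k) : S x -> A a -> x = act a (rho j) -> ga x = a.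
  move=> Sx Aa xE; have [Ag [i ii xE']] := gaP _ Sx.
  have [Sj jj] := rhoP j; have [Si ii'] := rhoP i.
  have ij : i = j.
    apply/val_inj; rewrite /= -ii -jj; apply/esym/(idxR _ _ Sj Sx); by exists a.
  by apply: (act_inj _ _ (rho j)) => //; rewrite -xE {2}xE' ij.
exists idx, rho, ga; split=> [j|a x Aa Sx|x Sx]; last exact: gaP.
  have [Sj jj] := rhoP j.
  by split => //; apply: (gaE _ _ j); rewrite ?act1 //; exact: subgroup1.
have [Ag [j xj xE]] := gaP _ Sx; have Sax := actS _ _ Aa Sx; split.
  by apply/esym/(idxR _ _ Sx Sax); exists a.
by apply: (gaE _ _ j) => //; [exact: subgroupM|rewrite actM -xE].
Qed.

Section Euler.
Variables (V E : Type) (o t : E -> V) (n : nat) (sh : V -> 'I_n).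
Variables (VS : set V) (ES : set E).
Variables (G : groupType) (A X : set G) (av : G -> V -> V) (ae : G -> E -> E).
Hypotheses (As : is_subgroup A) (AX : is_free_basis A X).
Hypothesis ES_VS : forall e, ES e -> VS (o e) /\ VS (t e).
Hypothesis sh_edge : forall e, sh (o e) = sh (t e).
Hypothesis av1 : forall v, av 1 v = v.
Hypothesis avM : forall g h v, av (g * h) v = av g (av h v).
Hypothesis ae1 : forall e, ae 1 e = e.
Hypothesis aeM : forall g h e, ae (g * h) e = ae g (ae h e).
Hypothesis o_av : forall g e, o (ae g e) = av g (o e).
Hypothesis t_av : forall g e, t (ae g e) = av g (t e).
Hypothesis VSA : forall a v, A a -> VS v -> VS (av a v).
Hypothesis ESA : forall a e, A a -> ES e -> ES (ae a e).
Hypothesis shA : forall a u v, A a -> VS u -> VS v -> sh u = sh v ->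
  sh (av a u) = sh (av a v).
Hypothesis free : forall a v, A a -> VS v -> av a v = v -> a = 1.
Hypothesis connected : forall f : V -> bool,
  (forall e, ES e -> f (o e) = f (t e)) ->
  forall v w, VS v -> VS w -> sh v = sh w -> f v = f w.
Variable base : 'I_n -> V.
Hypotheses (VSbase : forall q, VS (base q)) (shbase : forall q, sh (base q) = q).
Variables (kV kE : nat).
Hypothesis VScount : class_count VS (fun u v => exists2 a, A a & v = av a u) kV.
Hypothesis EScount : class_count ES (fun d e => exists2 a, A a & e = ae a d) kE.

Let free_edge a e : A a -> ES e -> ae a e = e -> a = 1.
Proof.
move=> Aa Ee aee; have [Vo _] := ES_VS Ee.
by apply: free Vo _; rewrite // -o_av aee.
Qed.

Let ext k (p : {ffun 'I_k -> bool}) (j : nat) : bool := oapp p false (insub j).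

Let extE k (p : {ffun 'I_k -> bool}) (j : 'I_k) : ext p j = p j.
Proof. by rewrite /ext valK. Qed.

(* Extending a cocycle on A by arbitrary values at the representatives of the
   vertex orbits gives every function whose coboundary is A-invariant. *)
Lemma euler_ge m (x : 'I_m -> G) : injective x -> (forall i, X (x i)) ->
  (n * m + kV <= kE + n)%N.
Proof.
move=> xinj xX.
have [idV [rV [gV [rVP gVA gVP]]]] := free_orbit_section As av1 avM VSA free VScount.
have [idE [rE [gE [rEP gEA gEP]]]] := free_orbit_section As ae1 aeM ESA free_edge EScount.
(* The action of [A] on the sheets, read off at the base points. *)
pose sq a q := sh (av a (base q)).
have sqE a v : A a -> VS v -> sq a (sh v) = sh (av a v).
  by move=> Aa Vv; apply: shA => //; rewrite shbase.
have sqM a b q : A a -> A b -> sq a (sq b q) = sq (a * b) q.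
  move=> Aa Ab; rewrite -[sq b q]/(sh (av b (base q))) sqE //; last exact: VSA.
  by rewrite -avM.
have XA := free_basis_sub AX.
(* The input bits are the values of the cocycle at the chosen generators, one for each sheet, and
   the values of [phi] at the vertex representatives. *)
have /choice[phi phiP] : forall d : {ffun 'I_n * 'I_m -> bool} * {ffun 'I_kV -> bool},
    exists phi : V -> bool, exists c : G -> 'I_n -> bool,
    [/\ forall a v, A a -> VS v -> phi (av a v) = phi v (+) c a (sh (av a v)),
      forall i q, c (x i) q = d.1 (q, i) & forall j, phi (rV j) = d.2 j].
  move=> [w p]; pose W y q := if pselect (exists i, y = x i) is left e
    then w (q, projT1 (cid e)) else false.
  have WE i q : W (x i) q = w (q, i).
    rewrite /W; case: pselect => [e|[]]; last by exists i.
    by case: cid => j /= /xinj <-.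
  have /choice[c cP] : forall q, exists c : G -> bool, c 1 = false /\
      forall h y, A h -> X y -> c (h * y) = c h (+) W y (sq h^-1 q).
    by move=> q; exact: free_basis_integral.
  (* The cocycle identity is twisted by the permutation of the sheets; the quotient of its two sides
     is constant along generators. *)
  have cM a b q : A a -> A b -> c q (a * b) = c q a (+) c (sq a^-1 q) b.
    move=> Aa Ab; have AVa := subgroupV As Aa.
    have : (c q (a * b) (+) c (sq a^-1 q) b) = (c q (a * 1) (+) c (sq a^-1 q) 1).
      refine (free_basis_const As AX
        (f := fun b => c q (a * b) (+) c (sq a^-1 q) b) _ Ab) => h y Ah Xy.
      have AVh := subgroupV As Ah.
      have Aah := subgroupM As Aa Ah.
      rewrite /= mulgA ((cP q).2 (a * h) y) // ((cP (sq a^-1 q)).2 h y) // invgM sqM //.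
      by case: (c q _); case: (c _ h); case: (W _ _).
    rewrite mulg1 (cP (sq a^-1 q)).1 addbF => <-.
    by rewrite -addbA addbb addbF.
  exists (fun v => ext p (idV v) (+) c (sh v) (gV v)), (fun a q => c q a).
  split=> [a v Aa Vv|i q|j].
  - have [Ag [j _ _]] := gVP _ Vv; have [-> ->] := gVA _ _ Aa Vv.
    rewrite cM // sqE; [|exact: subgroupV|exact: VSA].
    by rewrite -avM mulVg av1 addbAC addbA.
  - have := (cP q).2 1 (x i) (subgroup1 As) (xX i).
    by rewrite mul1g (cP q).1 /= WE invg1 /sq av1 shbase.
  - have [Vj jj ->] := rVP j; by rewrite (cP _).1 addbF jj extE.
(* The output bits, a coboundary modulo [A] and one value per sheet, determine [phi] on [VS] by
   connectedness, and [phi] gives back the input. *)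
pose out (d : {ffun 'I_n * 'I_m -> bool} * {ffun 'I_kV -> bool}) :=
  ([ffun j => phi d (o (rE j)) (+) phi d (t (rE j))], [ffun q => phi d (base q)]).
have out_inj : injective out.
  move=> d d' [/ffunP eqE /ffunP eqB].
  have [c [phic cw phir]] := phiP d; have [c' [phic' cw' phir']] := phiP d'.
  have bdE f (g : G -> 'I_n -> bool) : (forall a v, A a -> VS v ->
      f (av a v) = f v (+) g a (sh (av a v))) ->
      forall e (j : 'I_kE), ES e -> e = ae (gE e) (rE j) ->
      f (o e) (+) f (t e) = f (o (rE j)) (+) f (t (rE j)).
    move=> fg e j Ee ee; have [Ag _] := gEP _ Ee; have [Ej _ _] := rEP j.
    have [Vo Vt] := ES_VS Ej; rewrite ee o_av t_av !fg //.
    rewrite -o_av -t_av sh_edge.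
    by case: (f _); case: (f _); case: (g _ _).
  have same v : VS v -> phi d v = phi d' v.
    move=> Vv; have conn : (phi d v (+) phi d' v) =
        (phi d (base (sh v)) (+) phi d' (base (sh v))).
      apply: (connected (f := fun v => phi d v (+) phi d' v)) => // e Ee.
      have [_ [j _ ee]] := gEP _ Ee.
      have := eqE j; rewrite !ffunE -(bdE _ _ phic _ _ Ee ee) -(bdE _ _ phic' _ _ Ee ee).
      by case: (phi d _); case: (phi d _); case: (phi d' _); case: (phi d' _).
    have := eqB (sh v); rewrite !ffunE => e; move: conn; rewrite e addbb.
    by case: (phi d v); case: (phi d' v).
  case: d d' {eqE eqB bdE} phic cw phir phic' cw' phir' same => [w p] [w' p'] /=.
  move=> phic cw phir phic' cw' phir' same; congr pair.
    apply/ffunP => -[q i]; rewrite -cw -cw'.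
    have Ax := XA _ (xX i); have AVx := subgroupV As Ax.
    have Vx := VSA AVx (VSbase q).
    have := phic _ _ Ax Vx; rewrite (same _ Vx) (same _ (VSA Ax Vx)) phic' //.
    rewrite -avM mulgV av1 shbase; by case: (phi _ _); case: (c _ _); case: (c' _ _).
  by apply/ffunP => j; rewrite -phir -phir' same //; have [] := rVP j.
have := leq_card _ out_inj; rewrite !card_prod !card_ffun card_prod card_bool !card_ord.
by rewrite -!expnD leq_exp2l.
Qed.

Hypothesis integral : forall eps : E -> bool, exists phi : V -> bool,
  forall e, ES e -> phi (o e) (+) phi (t e) = eps e.

(** The count in the other direction: acyclicity realizes every invariant coboundary with any values
    at the base points. The resulting function is determined by its jumps under the generators and
    its values at the vertex representatives. *)
Lemma euler_le m (x : 'I_m -> G) : (forall y, X y -> exists i, y = x i) ->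
  (forall i, X (x i)) -> (kE + n <= n * m + kV)%N.
Proof.
move=> xs xX.
have [idV [rV [gV [rVP gVA gVP]]]] := free_orbit_section As av1 avM VSA free VScount.
have [idE [rE [gE [rEP gEA gEP]]]] := free_orbit_section As ae1 aeM ESA free_edge EScount.
have XA := free_basis_sub AX.
have /choice[phi phiP] : forall d : {ffun 'I_kE -> bool} * {ffun 'I_n -> bool},
    exists phi : V -> bool,
    (forall e, ES e -> phi (o e) (+) phi (t e) = ext d.1 (idE e)) /\
    (forall q, phi (base q) = d.2 q).
  move=> [eps r]; have [phi phiE] := integral (fun e => ext eps (idE e)).
  (* A constant added on each sheet adjusts the base values and leaves the coboundary alone. *)
  exists (fun v => phi v (+) (phi (base (sh v)) (+) r (sh v))); split=> [e Ee|q] /=.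
    rewrite -phiE // sh_edge.
    by case: (phi _); case: (phi _); case: (phi _); case: (r _).
  by rewrite shbase addbA addbb addFb.
pose out (d : {ffun 'I_kE -> bool} * {ffun 'I_n -> bool}) :=
  ([ffun qi : 'I_n * 'I_m => phi d (base qi.1) (+) phi d (av (x qi.2)^-1 (base qi.1))],
   [ffun j => phi d (rV j)]).
have out_inj : injective out.
  move=> d d' [/ffunP eqC /ffunP eqV].
  pose psi v := phi d v (+) phi d' v.
  have [dE dB] := phiP d; have [d'E d'B] := phiP d'.
  have psiE a e : A a -> ES e -> psi (o e) (+) psi (t e) =
      psi (av a (o e)) (+) psi (av a (t e)).
    move=> Aa Ee; rewrite -o_av -t_av.
    have ee f g h : f (+) g = h -> forall f' g' h', f' (+) g' = h' ->
      (f (+) f') (+) (g (+) g') = h (+) h'.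
      by case: f; case: g => <- []; case=> _ <-.
    rewrite /psi (ee _ _ _ (dE _ Ee) _ _ _ (d'E _ Ee)).
    have Eae := ESA Aa Ee; rewrite (ee _ _ _ (dE _ Eae) _ _ _ (d'E _ Eae)).
    by have [-> _] := gEA _ _ Aa Ee.
  have psix y v : X y -> VS v -> psi (av y^-1 v) = psi v.
    move=> Xy Vv; have [i ->] := xs _ Xy.
    have AVx := subgroupV As (XA _ (xX i)).
    have conn : (psi v (+) psi (av (x i)^-1 v)) =
        (psi (base (sh v)) (+) psi (av (x i)^-1 (base (sh v)))).
      apply: (connected (f := fun v => psi v (+) psi (av (x i)^-1 v))) => // e Ee.
      have := psiE _ _ AVx Ee.
      by case: (psi _); case: (psi _); case: (psi _); case: (psi _).
    have := eqC (sh v, i); rewrite !ffunE /= => e.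
    move: conn; rewrite /psi; move: e.
    by case: (phi d v); case: (phi d' v); case: (phi d _); case: (phi d' _);
      case: (phi d _); case: (phi d' _); case: (phi d _); case: (phi d' _).
  (* The difference [psi] of two functions with the same output is invariant under the generators,
     hence under [A], and vanishes at the representatives. *)
  have psi0 v : VS v -> psi v = false.
    move=> Vv; have [Ag [j _ vE]] := gVP _ Vv; have AVg := subgroupV As Ag.
    have : psi (av (gV v)^-1 v) = psi (av 1^-1 v).
      refine (free_basis_const As AX (f := fun a => psi (av a^-1 v)) _ Ag) => h y Ah Xy.
      have Vh := VSA (subgroupV As Ah) Vv.
      by rewrite /= invgM avM (psix y).
    rewrite invg1 av1 => <-; rewrite {2}vE -avM mulVg av1 /psi.
    by have := eqV j; rewrite !ffunE => ->; rewrite addbb.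
  have same v : VS v -> phi d v = phi d' v.
    by move=> /psi0; rewrite /psi; case: (phi d v); case: (phi d' v).
  case: d d' {eqC eqV psiE psix psi0 psi} dE dB d'E d'B same => [p r] [p' r'] /=.
  move=> dE dB d'E d'B same; congr pair; apply/ffunP => j.
    have [Ej jj _] := rEP j; have [Vo Vt] := ES_VS Ej.
    by have := dE _ Ej; rewrite !same // d'E // jj !extE.
  by rewrite -dB -d'B same.
have := leq_card _ out_inj; rewrite !card_prod !card_ffun card_prod card_bool !card_ord.
by rewrite -!expnD leq_exp2l.
Qed.

End Euler.

(** * Convex hulls in forests *)

Lemma mem_In (T : eqType) (x : T) s : x \in s -> List.In x s.
Proof. by elim: s => // y s IH; rewrite inE => /orP[/eqP->|/IH]; [left|right]. Qed.

Section Forest.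
Variables (V E : choiceType) (o t : E -> V) (n : nat) (sh : V -> 'I_n) (VT : set V).

Definition adj (u v : V) : bool :=
  `[< exists e, (o e = u /\ t e = v) \/ (o e = v /\ t e = u) >].

(** On each sheet of [VT], [phi] is constant or, on the sheet of [e], the indicator of one side of
    [e]. Thus [e] separates two vertices of a sheet exactly when [phi] differs at them. *)
Definition cut (phi : V -> bool) (e : E) :=
  forall d, phi (o d) (+) phi (t d) = `[< d = e >].

Hypothesis sh_edge : forall e, sh (o e) = sh (t e).
Hypothesis VT_edge : forall e, VT (o e) /\ VT (t e).
Hypothesis walk : forall v w, VT v -> VT w -> sh v = sh w ->
  exists2 p, path adj v p & last v p = w.
Hypothesis cut_exists : forall e, exists phi, cut phi e.

Lemma cut_neq phi e d : cut phi e -> d <> e -> phi (o d) = phi (t d).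
Proof.
by move=> /(_ d) + de; rewrite asboolF //; case: (phi _); case: (phi _).
Qed.

Lemma cut_const_path phi e z x p : cut phi e -> z = o e \/ z = t e ->
  z \notin x :: p -> path adj x p -> phi (last x p) = phi x.
Proof.
move=> ce ze; elim: p x => //= y p IH x zx /andP[/asboolP[d dxy] yp].
have [zy zNx] : z \notin y :: p /\ z <> x.
  by move: zx; rewrite inE negb_or => /andP[/eqP].
have zNy : z <> y by move: zy; rewrite inE negb_or => /andP[/eqP].
rewrite IH //; have de : d <> e.
  move=> de; rewrite de in dxy.
  by case: ze => zE; case: dxy => -[e1 e2];
    [apply: zNx|apply: zNy|apply: zNy|apply: zNx]; rewrite zE.
by have := cut_neq ce de; case: dxy => -[-> ->].
Qed.

(* The edges of a walk without repeated vertices all separate its ends. *)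
Lemma sep_const (T : Type) (f : V -> T) v w : VT v -> VT w -> sh v = sh w ->
  (forall e, (forall phi, cut phi e -> phi v <> phi w) -> f (o e) = f (t e)) ->
  f v = f w.
Proof.
move=> Vv Vw vw fe; have [p vp lp] := walk Vv Vw vw.
rewrite -lp in fe *; move: fe; case: (shortenP vp) => {}p {lp} {}vp up _ fe.
suff: forall p1 p2, p = p1 ++ p2 -> f (last v p1) = f v.
  by move=> /(_ p [::]); rewrite cats0 => ->.
elim/last_ind => // p1 u IH p2 pE; rewrite last_rcons.
have pE' : p = p1 ++ u :: p2 by rewrite pE cat_rcons.
rewrite -(IH _ pE'); set x := last v p1.
move: vp; rewrite pE' cat_path /= -/x => /and3P[vp1 /asboolP[e exu] up2].
have /negP uNp1 : u \notin v :: p1.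
  move: up; rewrite pE' -cat_cons cat_uniq => /and3P[_ /hasPn h _].
  by have := h u (mem_head _ _).
have xNp2 : x \notin u :: p2.
  move: up; rewrite pE' -cat_cons cat_uniq => /and3P[_ /hasPn h _].
  by apply/negP => /h; rewrite /= mem_last.
suff : f (o e) = f (t e) by case: exu => -[-> ->].
apply: fe => phi ce; rewrite pE' last_cat /= -/x.
have <- : phi x = phi v.
  apply: (cut_const_path (z := u) ce) vp1; last exact/negP.
  by case: exu => -[e1 e2]; [right|left].
have -> : phi (last u p2) = phi u.
  apply: (cut_const_path (z := x) ce) up2 => //.
  by case: exu => -[e1 e2]; [left|right].
by have := ce e; rewrite asboolT //; case: exu => -[-> ->]; case: (phi x); case: (phi u).
Qed.

Lemma sep_finite v w : VT v -> VT w -> sh v = sh w -> exists s : seq E,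
  forall e phi, cut phi e -> phi v <> phi w -> e \in s.
Proof.
move=> Vv Vw vw; have [p vp <-] := walk Vv Vw vw.
elim: p v vp {Vv vw} => [|u p IH] v /=; first by exists [::].
move=> /andP[/asboolP[d dvu] /IH[s sP]]; exists (d :: s) => e phi ce vl.
rewrite inE; have [//|/eqP ne] := eqVneq e d; apply/sP; first exact: ce.
suff <- : phi v = phi u by [].
have de : d <> e by move=> de; apply: ne.
by have := cut_neq ce de; case: dvu => -[-> ->].
Qed.

Lemma zero_const (f : V -> bool) : (forall d, f (o d) = f (t d)) ->
  forall v w, VT v -> VT w -> sh v = sh w -> f v = f w.
Proof. by move=> fE v w Vv Vw vw; apply: sep_const. Qed.

Lemma cut_sheet phi e v w : cut phi e -> VT v -> VT w -> sh v = sh w ->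
  phi v <> phi w -> sh (o e) = sh v.
Proof.
move=> ce Vv Vw vw phivw; apply: contrapT => ev; apply: phivw.
have := @zero_const (fun z => (sh z == sh v) && phi z) _ v w Vv Vw vw.
rewrite -vw eqxx /=; apply => d; rewrite -sh_edge.
have [dv|//] := eqVneq (sh (o d)) (sh v); rewrite (cut_neq ce) // => de.
by apply: ev; rewrite -de.
Qed.

Lemma cut_uniq phi psi e v w : cut phi e -> cut psi e -> VT v -> VT w ->
  sh v = sh w -> phi v (+) phi w = psi v (+) psi w.
Proof.
move=> ce ce' Vv Vw vw.
have := @zero_const (fun z => phi z (+) psi z) _ v w Vv Vw vw.
have h d : phi (o d) (+) psi (o d) = phi (t d) (+) psi (t d).
  have := ce d; rewrite -(ce' d).
  by case: (phi _); case: (phi _); case: (psi _); case: (psi _).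
by move/(_ h); case: (phi v); case: (phi w); case: (psi v); case: (psi w).
Qed.

Section Hull.
Variable O : set V.
Hypothesis OVT : O `<=` VT.

Definition hullE : set E := [set e | exists phi u v,
  [/\ cut phi e, O u, O v, sh u = sh v & phi u <> phi v]].

(** No half-tree contains [v] and misses the points of [O] on its sheet: the hull as an intersection
    of half-trees. *)
Definition hullV : set V := [set v | VT v /\
  forall e phi, cut phi e -> exists u, [/\ O u, sh u = sh v & phi u = phi v]].

Lemma sub_hullV : O `<=` hullV.
Proof. by move=> v Ov; split; [exact: OVT|move=> e phi _; exists v]. Qed.

Lemma hull_convex v w e phi : hullV v -> hullV w -> sh v = sh w ->
  cut phi e -> phi v <> phi w -> hullE e.
Proof.
move=> [_ hv] [_ hw] vw ce phivw.
have [u [Ou uv pu]] := hv _ _ ce; have [u' [Ou' uw pu']] := hw _ _ ce.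
by exists phi, u, u'; split => //; rewrite ?pu ?pu' // uv uw.
Qed.

(** If an edge [e'] cut [z] off from all of [O], then [u] and [u'] would lie beyond [e'] while [e]
    lies on the side of [z], so [e] could not separate them. *)
Lemma hull_ends e : hullE e -> forall z, z = o e \/ z = t e -> hullV z.
Proof.
move=> [phi [u [u' [ce Ou Ou' uu' pu]]]] z ze; have [Vo Vt] := VT_edge e.
have Vz : VT z by case: ze => ->.
have Vu := OVT Ou; have Vu' := OVT Ou'.
have shz : sh z = sh u.
  by rewrite -(cut_sheet ce Vu Vu' uu' pu); case: ze => ->.
split => // e' psi ce'; apply: contrapT => nu.
have [pu1 pu1'] : psi u <> psi z /\ psi u' <> psi z.
  by split => h; apply: nu; [exists u|exists u']; split => //; rewrite ?shz.
have psiuu' : psi u = psi u'.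
  by move: pu1 pu1'; case: (psi u); case: (psi u'); case: (psi z).
have [ee'|nee'] := pselect (e = e').
  subst e'; have := cut_uniq ce ce' Vu Vu' uu'.
  by rewrite psiuu' addbb; case: (phi u) pu; case: (phi u').
pose x := if psi (o e') == psi z then t e' else o e'.
have psix : psi x <> psi z.
  have := ce' e'; rewrite asboolT // /x; case: (eqVneq (psi (o e')) (psi z)) => [->|].
    by case: (psi (t e')); case: (psi z).
  by case: (psi (o e')); case: (psi z).
(* phi modified to be constant on the side of e' containing e. *)
pose f y := if psi y == psi z then phi x else phi y.
have := @zero_const f _ u u' Vu Vu' uu'.
have neq_eqb (a b : bool) : a <> b -> (a == b) = false by move/eqP/negbTE.
rewrite /f (neq_eqb _ _ pu1) (neq_eqb _ _ pu1') => h; apply: pu; apply: h => d.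
have [->|de'] := pselect (d = e').
  have := ce' e'; rewrite asboolT //; move: psix; rewrite /x.
  case: (eqVneq (psi (o e')) (psi z)) => [->|n1]; first by move=> /neq_eqb ->.
  case: (eqVneq (psi (t e')) (psi z)) => // n2 _; move: n1 n2.
  by case: (psi (o e')); case: (psi (t e')); case: (psi z).
rewrite (cut_neq ce' de'); case: (eqVneq (psi (t d)) (psi z)) => // dz.
apply: (cut_neq ce) => de; subst d; move/eqP: dz; apply.
by case: ze => -> //; exact: esym (cut_neq ce' de').
Qed.

End Hull.

Section Convex.
Variables (VS : set V) (ES : set E).
Hypothesis VSVT : VS `<=` VT.
Hypothesis convex : forall v w e phi, VS v -> VS w -> sh v = sh w ->
  cut phi e -> phi v <> phi w -> ES e.

Lemma convex_const (f : V -> bool) : (forall e, ES e -> f (o e) = f (t e)) ->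
  forall v w, VS v -> VS w -> sh v = sh w -> f v = f w.
Proof.
move=> fE v w Sv Sw vw; apply: sep_const => //; [exact: VSVT|exact: VSVT|].
move=> e esep; apply: fE; have [phi ce] := cut_exists e.
exact: convex ce (esep _ ce).
Qed.

(** If no edge of [ES] ends at [v], the indicator of [v] has zero coboundary and is constant on the
    sheet. *)
Lemma convex_ends v w : VS v -> VS w -> sh v = sh w ->
  v = w \/ exists2 e, ES e & v = o e \/ v = t e.
Proof.
move=> Sv Sw vw; apply: or_asboolP; rewrite -implyNb; apply/implyP => /asboolP vNw.
apply/asboolP; apply: contrapT => ne; apply: vNw.
have := @convex_const (fun z => z == v) _ v w Sv Sw vw; rewrite eqxx => h.
apply/esym/eqP; rewrite -h // => e Ee.
by apply/idP/idP => /eqP ve; case: ne; exists e; rewrite // ve; [left|right].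
Qed.

End Convex.

Section HullAction.
Variables (G : groupType) (A X : set G) (av : G -> V -> V) (ae : G -> E -> E).
Hypothesis As : is_subgroup A.
Hypothesis AX : is_free_basis A X.
Hypothesis av1 : forall v, av 1 v = v.
Hypothesis avM : forall g h v, av (g * h) v = av g (av h v).
Hypothesis ae1 : forall e, ae 1 e = e.
Hypothesis aeM : forall g h e, ae (g * h) e = ae g (ae h e).
Hypothesis o_av : forall g e, o (ae g e) = av g (o e).
Hypothesis t_av : forall g e, t (ae g e) = av g (t e).
Hypothesis VTG : forall g v, VT v -> VT (av g v).
Hypothesis shG : forall g u v, VT u -> VT v -> sh u = sh v -> sh (av g u) = sh (av g v).

Lemma cut_act g phi e : cut phi e -> cut (fun v => phi (av g^-1 v)) (ae g e).
Proof.
move=> ce d; rewrite -o_av -t_av ce; apply/asboolP/asboolP => [<-|->].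
  by rewrite -aeM mulgV ae1.
by rewrite -aeM mulVg ae1.
Qed.

Lemma cut_actV g phi e : cut phi e -> cut (fun v => phi (av g v)) (ae g^-1 e).
Proof. by move/(cut_act g^-1); rewrite invgK. Qed.

Let avK g v : av g^-1 (av g v) = v.
Proof. by rewrite -avM mulVg av1. Qed.

Let avKV g v : av g (av g^-1 v) = v.
Proof. by rewrite -avM mulgV av1. Qed.

Variable base : 'I_n -> V.
Hypothesis VTbase : forall q, VT (base q).
Hypothesis sh_base : forall q, sh (base q) = q.

Let O : set V := [set v | exists a q, A a /\ v = av a (base q)].

Lemma orbit_base_VT : O `<=` VT.
Proof. by move=> _ [a [q [_ ->]]]; exact: VTG. Qed.

Lemma orbit_base_act a v : A a -> O v -> O (av a v).
Proof.
move=> Aa [b [q [Ab ->]]]; exists (a * b), q; split; first exact: subgroupM.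
by rewrite avM.
Qed.

Lemma hullE_act a e : A a -> hullE O e -> hullE O (ae a e).
Proof.
move=> Aa [phi [u [v [ce Ou Ov uv puv]]]].
exists (fun v => phi (av a^-1 v)), (av a u), (av a v); split.
- exact: cut_act.
- exact: orbit_base_act.
- exact: orbit_base_act.
- by apply: shG => //; exact: orbit_base_VT.
- by rewrite !avK.
Qed.

Lemma hullV_act a v : A a -> hullV O v -> hullV O (av a v).
Proof.
move=> Aa [Vv hv]; split; first exact: VTG.
move=> e phi /(cut_actV a)/hv[u [Ou uv pu]].
exists (av a u); split => //; first exact: orbit_base_act.
by apply: shG => //; exact: orbit_base_VT.
Qed.

(** The base point that [b] carries into the sheet of [z], after the move: each [b] yields one point
    per sheet. *)
Let sheet_pt z b := av b (base (sh (av b^-1 z))).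

Let sheet_ptE z b : VT z -> sh (sheet_pt z b) = sh z.
Proof.
move=> Vz; rewrite -[in RHS](avKV b z); apply: shG; rewrite ?sh_base //.
exact: VTG.
Qed.

(** An edge separating two orbit points separates the points given by two neighbours [h] and [h * y]
    in the Cayley graph of [A]. Moved by [h^-1], it separates a base point from a generator's image
    of a base point, and there are finitely many such edges. *)
Lemma hullE_count m (x : 'I_m -> G) :
  (forall y, X y -> exists i, y = x i) -> (forall i, X (x i)) ->
  exists k, class_count (hullE O) (fun d e => exists2 a, A a & e = ae a d) k.
Proof.
move=> xs xX; have XA := free_basis_sub AX.
have /choice[sep sepP] : forall iqq : 'I_m * 'I_n * 'I_n, exists s : seq E,
    forall e phi, cut phi e -> sh (base iqq.1.2) = sh (av (x iqq.1.1) (base iqq.2)) ->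
      phi (base iqq.1.2) <> phi (av (x iqq.1.1) (base iqq.2)) -> e \in s.
  move=> [[i q] q'] /=; have Vx := VTG (x i) (VTbase q').
  have [shqq'|ns] := pselect (sh (base q) = sh (av (x i) (base q'))).
    have [s sP] := sep_finite (VTbase q) Vx shqq'.
    by exists s => e phi ce _; exact: sP ce.
  by exists [::].
apply: (class_count_fin (s := flatten [seq sep iqq | iqq <- enum {: 'I_m * 'I_n * 'I_n}])).
- by move=> e; exists 1; [exact: subgroup1|rewrite ae1].
- move=> d e [a Aa ->]; exists a^-1; first exact: subgroupV.
  by rewrite -aeM mulVg ae1.
- move=> d e f [a Aa ->] [b Ab ->]; exists (b * a); first exact: subgroupM.
  by rewrite aeM.
move=> e [phi [_ [_ [ce [a [q [Aa ->]]] [b [q' [Ab ->]]] shab pab]]]].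
set z := av a (base q) in shab pab; have Vz : VT z := VTG _ (VTbase q).
pose p := sheet_pt z.
have pa : p a = z by rewrite /p /sheet_pt /z avK sh_base.
have pb : p b = av b (base q').
  rewrite /p /sheet_pt; congr (av b (base _)).
  rewrite -[RHS]sh_base -(avK b (base q')); apply: shG => //; exact: VTG.
have [h [y [Ah Xy ph]]] : exists h y, [/\ A h, X y & phi (p (h * y)) <> phi (p h)].
  apply: contrapT => nh; apply: pab; rewrite -pa -pb.
  have const : forall h, A h -> phi (p h) = phi (p 1).
    apply: (free_basis_const As AX (f := fun h => phi (p h))) => h y Ah Xy.
    by apply: contrapT => ne; apply: nh; exists h, y.
  by rewrite (const a) // (const b).
have [i yi] := xs _ Xy; have Ay := XA _ Xy.
exists (ae h^-1 e); last by exists h^-1; [exact: subgroupV|].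
apply: mem_In; apply/flattenP.
pose iqq := (i, sh (av h^-1 z), sh (av (h * y)^-1 z)).
exists (sep iqq); first by apply/mapP; exists iqq; rewrite ?mem_enum.
have phE : phi (av h (base iqq.1.2)) = phi (p h) by [].
have phyE : phi (av h (av (x iqq.1.1) (base iqq.2))) = phi (p (h * y)).
  by rewrite /= -yi -avM.
apply: (sepP iqq _ (fun v => phi (av h v))); first exact: cut_actV.
  rewrite /= -yi sh_base.
  have -> : av y (base (sh (av (h * y)^-1 z))) = av h^-1 (sheet_pt z (h * y)).
    by rewrite /sheet_pt (avM h y (base _)) avK.
  by apply: shG; rewrite ?sheet_ptE //; exact: VTG.
by move=> e'; apply: ph; rewrite -phE -phyE e'.
Qed.

End HullAction.
End Forest.

(** * Counting bridges *)

Lemma class_count_inj_fin (T U : Type) (S : set T) (R : T -> T -> Prop)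
    (S' : set U) (R' : U -> U -> Prop) k' (Q : T -> U -> Prop) :
  (forall x, R x x) -> (forall x y, R x y -> R y x) ->
  (forall x y z, R x y -> R y z -> R x z) ->
  (forall x, S x -> exists2 y, S' y & Q x y) ->
  (forall x x' y y', S x -> S x' -> S' y -> S' y' ->
     Q x y -> Q x' y' -> R' y y' -> R x x') ->
  class_count S' R' k' -> exists k, class_count S R k.
Proof.
move=> Rr Rs Rt Qtot Qinj [idx [idxlt idxR _]].
have [[x0 Sx0]|S0] := pselect (exists x, S x); last first.
  by apply: (class_count_fin (s := [::])) => // x Sx; case: S0; exists x.
have /choice[f fP] : forall j : nat, exists x,
    forall x' y', S x' -> S' y' -> Q x' y' -> idx y' = j -> R x x'.
  move=> j; have [[x [y [Sx Sy Qxy <-]]]|nx] := pselect (exists x y,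
      [/\ S x, S' y, Q x y & idx y = j]); last first.
    by exists x0 => x' y' Sx' Sy' Qxy' yj; case: nx; exists x', y'.
  by exists x => x' y' Sx' Sy' Qxy' /esym yj; apply: (Qinj _ _ y y') => //; apply/idxR.
apply: (class_count_fin (s := [seq f j | j <- iota 0 k'])) => // x Sx.
have [y Sy Qxy] := Qtot _ Sx.
exists (f (idx y)); last by apply: Rs; exact: fP Sx Sy Qxy _.
have : idx y \in iota 0 k' by rewrite mem_iota /= add0n; exact: idxlt.
elim: (iota 0 k') => // i l IH; rewrite inE => /orP[/eqP->|/IH]; by [left|right].
Qed.

Lemma class_count_reps (T : Type) (S : set T) (R : T -> T -> Prop) k :
  class_count S R k -> exists s : seq T,
    (forall y, List.In y s -> S y) /\ forall x, S x -> exists2 y, List.In y s & R x y.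
Proof.
move=> [idx [idxlt idxR idxs]].
have : forall j, (j <= k)%N -> exists s : seq T, (forall y, List.In y s -> S y) /\
    forall x, S x -> (idx x < j)%N -> exists2 y, List.In y s & R x y.
  elim=> [_|j IH jk]; first by exists [::].
  have [s [sS sP]] := IH (ltnW jk); have [z Sz zj] := idxs _ jk.
  exists (z :: s); split=> [y [<-//|/sS//]|x Sx].
  rewrite ltnS leq_eqVlt => /orP[/eqP xj|/sP[//|y ys xy]]; last by exists y => //; right.
  by exists z; [left|apply/idxR => //; rewrite xj zj].
move=> /(_ k (leqnn k))[s [sS sP]]; exists s; split => // x Sx.
by apply: sP => //; exact: idxlt.
Qed.

Section OrbitRelation.
Variables (G : groupType) (A : set G) (T : Type) (act : G -> T -> T).
Hypothesis As : is_subgroup A.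
Hypothesis act1 : forall x, act 1 x = x.
Hypothesis actM : forall g h x, act (g * h) x = act g (act h x).

Definition orb (x y : T) := exists2 a, A a & y = act a x.

Lemma orb_refl x : orb x x.
Proof. by exists 1; [exact: subgroup1|rewrite act1]. Qed.

Lemma orb_sym x y : orb x y -> orb y x.
Proof.
by move=> [a Aa ->]; exists a^-1; [exact: subgroupV|rewrite -actM mulVg act1].
Qed.

Lemma orb_trans x y z : orb x y -> orb y z -> orb x z.
Proof.
move=> [a Aa ->] [b Ab ->]; exists (b * a); first exact: subgroupM.
by rewrite actM.
Qed.

End OrbitRelation.

Section BridgeCount.
Variables (V E : choiceType) (o t : E -> V) (n : nat) (sh : V -> 'I_n) (VT : set V).
Variables (G : groupType) (av : G -> V -> V) (ae : G -> E -> E).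
Hypothesis sh_edge : forall e, sh (o e) = sh (t e).
Hypothesis VT_edge : forall e, VT (o e) /\ VT (t e).
Hypothesis walk : forall v w, VT v -> VT w -> sh v = sh w ->
  exists2 p, path (adj o t) v p & last v p = w.
Hypothesis integral : forall eps : E -> bool, exists phi : V -> bool,
  forall e, phi (o e) (+) phi (t e) = eps e.
Hypothesis av1 : forall v, av 1 v = v.
Hypothesis avM : forall g h v, av (g * h) v = av g (av h v).
Hypothesis ae1 : forall e, ae 1 e = e.
Hypothesis aeM : forall g h e, ae (g * h) e = ae g (ae h e).
Hypothesis o_av : forall g e, o (ae g e) = av g (o e).
Hypothesis t_av : forall g e, t (ae g e) = av g (t e).
Hypothesis VTG : forall g v, VT v -> VT (av g v).
Hypothesis shG : forall g u v, VT u -> VT v -> sh u = sh v -> sh (av g u) = sh (av g v).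
Hypothesis free_edge : forall g e, ae g e = e -> g = 1.
Variables (base : 'I_n -> V) (s : 'I_n -> G).
Hypothesis VTbase : forall q, VT (base q).
Hypothesis sh_base : forall q, sh (base q) = q.
Variables (ltE : E -> E -> Prop) (ltG : G -> G -> Prop).
Hypothesis ltExx : forall e, ~ ltE e e.
Hypothesis ltET : forall d e f, ltE d e -> ltE e f -> ltE d f.
Hypothesis ltE_total : forall d e, sh (o d) = sh (o e) -> [\/ d = e, ltE d e | ltE e d].
Hypothesis ltE_act : forall g d e, ltE d e -> ltE (ae g d) (ae g e).
Hypothesis ltGxx : forall g, ~ ltG g g.
Hypothesis ltGT : forall g h k, ltG g h -> ltG h k -> ltG g k.
Hypothesis ltG_total : forall g h q, sh (av g (base q)) = sh (av h (base q)) ->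
  [\/ g = h, ltG (g * s q) (h * s q) | ltG (h * s q) (g * s q)].
Hypothesis ltG_mul : forall k g h, ltG g h -> ltG (k * g) (k * h).

Let cut_exists e : exists phi, cut o t phi e.
Proof. by have [phi phiE] := integral (fun d => `[< d = e >]); exists phi. Qed.

Section VertexOrder.
Variables (A : set G) (VS : set V) (k : nat).
Hypothesis As : is_subgroup A.
Hypothesis VSVT : VS `<=` VT.
Hypothesis VSA : forall a v, A a -> VS v -> VS (av a v).
Hypothesis free : forall a v, A a -> VT v -> av a v = v -> a = 1.
Hypothesis VScount : class_count VS (orb A av) k.

(** Orbits are compared first, then positions within an orbit by [ltG]; freeness makes the position
    a group element. *)
Lemma vertex_order : exists ltV : V -> V -> Prop,
  [/\ forall v, ~ ltV v v, forall u v w, ltV u v -> ltV v w -> ltV u w,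
    forall u v, VS u -> VS v -> sh u = sh v -> [\/ u = v, ltV u v | ltV v u]
  & forall a u v, A a -> VS u -> VS v -> sh u = sh v ->
      ltV u v -> ltV (av a u) (av a v)].
Proof.
have [idx [rho [ga [rhoP gaA gaP]]]] := free_orbit_section As av1 avM VSA
  (fun a v Aa Sv => free Aa (VSVT Sv)) VScount.
(* [ltG_total] compares only suitable products: multiplying by [s] at the sheet of the
   representative makes vertices of one orbit and one sheet comparable. *)
pose io v := ga v * s (sh (av (ga v)^-1 v)).
exists (fun u v => (idx u < idx v)%N \/ idx u = idx v /\ ltG (io u) (io v)).
have ioA a v : A a -> VS v -> io (av a v) = a * io v.
  move=> Aa Sv; rewrite /io; have [_ ->] := gaA _ _ Aa Sv.
  by rewrite invgM -avM mulgVK mulgA.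
split=> [v [|[_ /ltGxx]]|u v w [uv|[uv luv]] [vw|[vw lvw]]|u v Su Sv uv|a u v Aa Su Sv uv] //.
- by rewrite ltnn.
- by left; exact: ltn_trans vw.
- by left; rewrite -vw.
- by left; rewrite uv.
- by right; split; [rewrite uv|exact: ltGT lvw].
- have [iuv|iuv|iuv] := ltngtP (idx u) (idx v); [by constructor 2; left|by constructor 3; left|].
  have [Au [i ui uE]] := gaP _ Su; have [Av [j vj vE]] := gaP _ Sv.
  have ij : i = j by apply/val_inj; rewrite /= -ui -vj.
  subst j; have [Si _ _] := rhoP i; have Vi := VSVT Si.
  have shb a : sh (av a (rho i)) = sh (av a (base (sh (rho i)))).
    by apply: shG; rewrite ?sh_base.
  have ioE w : w = av (ga w) (rho i) -> io w = ga w * s (sh (rho i)).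
    move=> wE; rewrite /io; suff -> : av (ga w)^-1 w = rho i by [].
    by rewrite {2}wE -avM mulVg av1.
  have := @ltG_total (ga u) (ga v) (sh (rho i)); rewrite -!shb -uE -vE => /(_ uv).
  rewrite -!ioE // => -[e|l|l]; last by constructor 3; right.
    by constructor 1; rewrite uE vE e.
  by constructor 2; right.
- have [-> _] := gaA _ _ Aa Su; have [-> _] := gaA _ _ Aa Sv; rewrite !ioA //.
  by case=> [h|[h1 h2]]; [left|right; split => //; exact: ltG_mul].
Qed.

End VertexOrder.

Section Counts.
Variables (A : set G) (VS : set V) (ES : set E) (kE : nat).
Hypothesis As : is_subgroup A.
Hypothesis VSVT : VS `<=` VT.
Hypothesis VSA : forall a v, A a -> VS v -> VS (av a v).
Hypothesis ESA : forall a e, A a -> ES e -> ES (ae a e).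
Hypothesis ES_VS : forall e, ES e -> VS (o e) /\ VS (t e).
Hypothesis free : forall a v, A a -> VT v -> av a v = v -> a = 1.
Hypothesis VSbase : forall q, VS (base q).
Hypothesis convex : forall v w e phi, VS v -> VS w -> sh v = sh w ->
  cut o t phi e -> phi v <> phi w -> ES e.
Hypothesis EScount : class_count ES (orb A ae) kE.

Let conn := convex_const walk cut_exists VSVT convex.

Lemma vertices_count : exists k, class_count VS (orb A av) k.
Proof.
have [l [_ lP]] := class_count_reps EScount.
apply: (class_count_fin (s := [seq base q | q <- enum 'I_n] ++
  ([seq o e | e <- l] ++ [seq t e | e <- l]))).
- exact: orb_refl.
- exact: orb_sym.
- exact: orb_trans.
have InL T (x : T) l1 l2 : List.In x l1 -> List.In x (l1 ++ l2).
  by elim: l1 => //= y l1 IH [->|/IH]; [left|right].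
have InR T (x : T) l1 l2 : List.In x l2 -> List.In x (l1 ++ l2).
  by elim: l1 => //= y l1 IH /IH; right.
have InM T U (f : T -> U) x l1 : List.In x l1 -> List.In (f x) (map f l1).
  by elim: l1 => //= y l1 IH [->|/IH]; [left|right].
move=> v Sv; have [->|[e Ee ve]] := convex_ends walk cut_exists
    VSVT convex Sv (VSbase (sh v)) (esym (sh_base _)).
  exists (base (sh v)); last exact: orb_refl.
  by apply: InL; apply: InM; apply: mem_In; rewrite mem_enum.
have [d dl [a Aa dE]] := lP _ Ee; case: ve => ->.
  exists (o d); last by exists a => //; rewrite dE o_av.
  by apply: InR; apply: InL; exact: InM.
exists (t d); last by exists a => //; rewrite dE t_av.
by apply/InR/InR/InM.
Qed.

Lemma bridges_count_exists : exists k1 k2,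
  [/\ class_count (nonbridge o t sh ltE VS ES) (orb A ae) k1,
      class_count (ES `\` nonbridge o t sh ltE VS ES) (orb A ae) k2 & kE = (k1 + k2)%N].
Proof.
apply: class_count_sub EScount _ _; first by move=> e [Y []].
move=> d e Ed Ee [a Aa ->].
apply: (nonbridge_act ES_VS As av1 avM ae1 aeM o_av t_av VSA ESA) Aa.
- by move=> b u v Ab Su Sv; apply: shG; exact: VSVT.
- by move=> b d' e' _; exact: ltE_act.
Qed.

Variable X : set G.
Hypothesis AX : is_free_basis A X.

(** Injectivity of the pairing bounds the non-bridge orbits by the vertex orbits, and [euler_ge]
    does the rest. *)
Lemma bridges_ge k m (x : 'I_m -> G) : injective x -> (forall i, X (x i)) ->
  class_count (ES `\` nonbridge o t sh ltE VS ES) (orb A ae) k -> (n * m <= k + n)%N.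
Proof.
move=> xinj xX ck; have [kV cV] := vertices_count.
have [ltV [ltVxx ltVT ltV_total ltVA]] := vertex_order As VSVT VSA free cV.
have shA a u v : A a -> VS u -> VS v -> sh u = sh v -> sh (av a u) = sh (av a v).
  by move=> _ Su Sv; apply: shG; exact: VSVT.
have free' a v : A a -> VS v -> av a v = v -> a = 1.
  by move=> Aa Sv; apply: free => //; exact: VSVT.
have [k1 [k2 [c1 c2 kEE]]] := bridges_count_exists.
have k1V : (k1 <= kV)%N.
  apply: (nonbridge_count_le ES_VS sh_edge ltVxx ltVT ltV_total ltExx ltET _ As av1 avM
    ae1 aeM o_av t_av VSA ESA shA ltVA _ c1 cV) => //.
  + by move=> d e Ed Ee; exact: ltE_total.
  + by move=> a d e _; exact: ltE_act.
have k2k : (k2 <= k)%N.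
  by apply: (class_count_le (Q := eq)) c2 ck => [e Se|d e _ _ _ _ _ _ <- <- //]; exists e.
have := euler_ge As AX ES_VS sh_edge av1 avM ae1 aeM o_av t_av VSA ESA shA free'
  conn VSbase sh_base cV EScount xinj xX.
lia.
Qed.

Hypothesis infinite : forall l : seq G, exists2 a, A a & a \notin l.

(** With empty coboundary, [Y] would be a whole sheet of [VS]. Each element of [A] carries some base
    point into it, and by freeness the base point and its image determine the element; so [A] would
    be finite. *)
Lemma no_finite_sheet (Y : {fset V}) : Y != fset0 ->
  (exists q, forall v, v \in Y -> VS v /\ sh v = q) ->
  exists2 e, ES e & bd o t Y e.
Proof.
move=> /fset0Pn[v vY] [q Yq]; apply: contrapT => nE.
have all_in w : VS w -> sh w = q -> w \in Y.
  move=> Sw wq; have [Sv vq] := Yq _ vY.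
  have := @conn (fun z => z \in Y) _ v w Sv Sw; rewrite vY vq wq => <- // e Ee.
  have : ~ bd o t Y e by move=> be; apply: nE; exists e.
  by rewrite /bd; case: (_ \in _); case: (_ \in _) => // -[].
have /choice[f fP] : forall p : 'I_n * V, exists b, forall a, A a ->
    av a (base p.1) = p.2 -> a = b.
  move=> [j y] /=; have [[b [Ab bE]]|nb] := pselect (exists b, A b /\ av b (base j) = y).
    exists b => a Aa aE; apply: (mulIg b^-1); rewrite mulgV.
    apply: (free (v := av b (base j))) => //.
    - by apply: subgroupM => //; exact: subgroupV.
    - exact: VTG.
    - by rewrite -avM mulgVK aE bE.
  by exists 1 => a Aa aE; case: nb; exists a.
have [a Aa] := infinite [seq f p | p <- [seq (j, y) | j <- enum 'I_n, y <- enum_fset Y]].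
move/negP; apply; apply/mapP.
pose j := sh (av a^-1 v); have [Sv vq] := Yq _ vY.
exists (j, av a (base j)); last by exact: fP.
apply/allpairsP; exists (j, av a (base j)); split => //=; first by rewrite mem_enum.
apply: all_in; first exact: VSA.
rewrite -vq -[v in RHS]av1 -(mulgV a) avM; apply: shG; rewrite ?sh_base //.
by apply: VTG; exact: VSVT.
Qed.

(** By freeness each edge orbit has at most one edge with origin [v] and at most one with end
    [v]. *)
Lemma locally_finite v : exists l : seq E, forall e, ES e -> o e = v \/ t e = v -> e \in l.
Proof.
have [l [lS lP]] := class_count_reps EScount.
have lS' : forall y, List.In y l -> VS (o y) /\ VS (t y) by move=> y /lS/ES_VS.
suff [l' l'P] : exists l' : seq E, forall e d, List.In d l -> orb A ae e d ->
    o e = v \/ t e = v -> e \in l'.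
  by exists l' => e /lP[d dl ed]; exact: l'P ed.
elim: l lS' {lS lP} => [|d l IH] lS; first by exists [::].
have [|l' l'P] := IH; first by move=> y yl; apply: lS; right.
have [So St] := lS d (or_introl erefl).
have one (f : E -> V) : VT (f d) -> (forall a, f (ae a d) = av a (f d)) ->
    exists c, forall e, orb A ae e d -> f e = v -> e = c.
  move=> Vf fA; have [[c [cd fc]]|nc] := pselect (exists c, orb A ae c d /\ f c = v).
    exists c => e ed fe.
    have [a Aa eE] := orb_sym As ae1 aeM ed; have [b Ab cE] := orb_sym As ae1 aeM cd.
    rewrite eE cE; congr (ae _ d); apply: (mulgI b^-1); rewrite mulVg.
    apply: (free (v := f d)) => //.
      by apply: subgroupM => //; exact: subgroupV.
    by rewrite avM -fA -eE fe -fc cE fA -avM mulVg av1.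
  by exists d => e ed fe; case: nc; exists e.
have [co coP] := one o (VSVT So) (fun a => o_av a d).
have [ct ctP] := one t (VSVT St) (fun a => t_av a d).
exists [:: co, ct & l'] => e d' [<- ed [/(coP _ ed)->|/(ctP _ ed)->]|d'l ed ev].
- by rewrite inE eqxx.
- by rewrite !inE eqxx orbT.
- by rewrite !inE (l'P _ _ d'l ed ev) !orbT.
Qed.

Lemma bridges_le k m (x : 'I_m -> G) : (forall y, X y -> exists i, y = x i) ->
  (forall i, X (x i)) ->
  class_count (ES `\` nonbridge o t sh ltE VS ES) (orb A ae) k -> (k + n <= n * m)%N.
Proof.
move=> xs xX ck; have [kV cV] := vertices_count.
have [ltV [ltVxx ltVT ltV_total ltVA]] := vertex_order As VSVT VSA free cV.
have shA a u v : A a -> VS u -> VS v -> sh u = sh v -> sh (av a u) = sh (av a v).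
  by move=> _ Su Sv; apply: shG; exact: VSVT.
have free' a v : A a -> VS v -> av a v = v -> a = 1.
  by move=> Aa Sv; apply: free => //; exact: VSVT.
have [k1 [k2 [c1 c2 kEE]]] := bridges_count_exists.
have k1V : (kV <= k1)%N.
  apply: (nonbridge_count_ge ES_VS sh_edge ltVxx ltVT ltV_total ltExx ltET _ As av1 avM
    ae1 aeM o_av t_av VSA ESA shA ltVA _ free' _ no_finite_sheet cV c1).
  + by move=> d e Ed Ee; exact: ltE_total.
  + by move=> a d e _; exact: ltE_act.
  + by move=> v _; exact: locally_finite.
have k2k : (k <= k2)%N.
  by apply: (class_count_le (Q := eq)) ck c2 => [e Se|d e _ _ _ _ _ _ <- <- //]; exists e.
have integral' eps : exists phi : V -> bool, forall e, ES e -> phi (o e) (+) phi (t e) = eps e.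
  by have [phi phiE] := integral eps; exists phi => e _.
have := euler_le As AX ES_VS sh_edge av1 avM ae1 aeM o_av t_av VSA ESA free'
  conn VSbase sh_base cV EScount integral' xs xX.
lia.
Qed.

End Counts.

Lemma intersection_rank_le (A B X Y Z : set G) r r' m
    (x : 'I_r -> G) (y : 'I_r' -> G) (z : 'I_m -> G) :
  is_subgroup A -> is_subgroup B -> is_free_basis A X -> is_free_basis B Y ->
  is_free_basis (A `&` B) Z ->
  (forall a v, A a -> VT v -> av a v = v -> a = 1) ->
  (forall a v, B a -> VT v -> av a v = v -> a = 1) ->
  (forall l : seq G, exists2 a, A a & a \notin l) ->
  (forall l : seq G, exists2 a, B a & a \notin l) ->
  (forall y, X y -> exists i, y = x i) -> (forall i, X (x i)) ->
  (forall x, Y x -> exists i, x = y i) -> (forall i, Y (y i)) ->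
  injective z -> (forall i, Z (z i)) -> (0 < n)%N ->
  (m.-1 <= n * (r.-1 * r'.-1))%N.
Proof.
move=> As Bs AX BY CZ Afree Bfree Ainf Binf xs xX ys yY zinj zZ n0.
(* [A] and [B] use the same base points, so the intersection of their hulls meets every sheet. *)
pose O (D : set G) := [set v | exists a q, D a /\ v = av a (base q)].
have baseO D q : is_subgroup D -> O D (base q).
  by move=> Ds; exists 1, q; rewrite av1; split => //; exact: subgroup1.
have OVT D : O D `<=` VT by exact: (orbit_base_VT (A := D) VTG VTbase).
pose VH D := hullV o t sh VT (O D); pose EH D := hullE o t sh (O D).
have VHVT D : VH D `<=` VT by move=> v [].
have VHA D : is_subgroup D -> forall a v, D a -> VH D v -> VH D (av a v).
  by move=> Ds a v; exact: (hullV_act Ds avM ae1 aeM o_av t_av VTG shG VTbase).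
have EHA D : is_subgroup D -> forall a v, D a -> EH D v -> EH D (ae a v).
  by move=> Ds a v; exact: (hullE_act Ds av1 avM ae1 aeM o_av t_av VTG shG VTbase).
have EHVH D : forall e, EH D e -> VH D (o e) /\ VH D (t e).
  move=> e Ee; have h := hull_ends sh_edge VT_edge walk (OVT D) Ee.
  by split; apply: h; [left|right].
have VHbase D : is_subgroup D -> forall q, VH D (base q).
  by move=> Ds q; apply: sub_hullV; [exact: OVT|exact: baseO].
have VHconv D : forall v w e phi, VH D v -> VH D w -> sh v = sh w ->
  cut o t phi e -> phi v <> phi w -> EH D e by exact: hull_convex.
have side D W p (w : 'I_p -> G) : is_subgroup D -> is_free_basis D W ->
    (forall a v, D a -> VT v -> av a v = v -> a = 1) ->
    (forall l : seq G, exists2 a, D a & a \notin l) ->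
    (forall y, W y -> exists i, y = w i) -> (forall i, W (w i)) ->
    exists kE k, [/\ class_count (EH D) (orb D ae) kE,
      class_count (EH D `\` nonbridge o t sh ltE (VH D) (EH D)) (orb D ae) k
      & (k + n <= n * p)%N].
  move=> Ds DW Dfree Dinf ws wW.
  have [kE cE] := hullE_count walk Ds DW av1 avM ae1 aeM o_av t_av VTG shG
    VTbase sh_base ws wW.
  have [k1 [k2 [_ c2 _]]] := bridges_count_exists Ds (VHVT D) (VHA D Ds) (EHA D Ds) (EHVH D) cE.
  exists kE, k2; split => //.
  exact: (bridges_le Ds (VHVT D) (VHA D Ds) (EHA D Ds) (EHVH D) Dfree (VHbase D Ds)
    (VHconv D) cE DW Dinf ws wW c2).
have [kEA [kA [cEA cA kAle]]] := side A X r x As AX Afree Ainf xs xX.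
have [kEB [kB [cEB cB kBle]]] := side B Y r' y Bs BY Bfree Binf ys yY.
pose C := A `&` B; have Cs : is_subgroup C := subgroupI As Bs.
pose VC := VH A `&` VH B; pose EC := EH A `&` EH B.
have free_inj a b e : ae a e = ae b e -> a = b.
  move=> e1; apply: (mulIg b^-1); rewrite mulgV; apply: (free_edge (e := ae b e)).
  by rewrite -aeM mulgVK.
have orbC (e e' : E) : orb A ae e e' -> orb B ae e e' -> orb C ae e e'.
  by move=> [a Aa ->] [b Bb /free_inj ab]; exists a => //; split => //; rewrite ab.
(* Edge stabilizers are trivial, so the [A]-orbit and the [B]-orbit of an edge determine its orbit
   under the intersection. This gives finiteness with no assumption on the rank of the
   intersection. *)
have [kEC cEC] : exists k, class_count EC (orb C ae) k.
  apply: (class_count_inj_fin (Q := fun e p => p = (e, e))) (class_count_prod cEA cEB).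
  - exact: orb_refl.
  - exact: orb_sym.
  - exact: orb_trans.
  - by move=> e [EeA EeB]; exists (e, e).
  - by move=> e e' _ _ _ _ _ _ -> -> /= []; exact: orbC.
have VCVT : VC `<=` VT by move=> v [/VHVT].
have VCA a v : C a -> VC v -> VC (av a v).
  by move=> [Aa Ba] [VA VB]; split; [exact: (VHA A)|exact: (VHA B)].
have ECA a v : C a -> EC v -> EC (ae a v).
  by move=> [Aa Ba] [VA VB]; split; [exact: (EHA A)|exact: (EHA B)].
have ECVC e : EC e -> VC (o e) /\ VC (t e).
  by move=> [/EHVH[oA tA] /EHVH[oB tB]].
have Cfree a v : C a -> VT v -> av a v = v -> a = 1 by move=> [Aa _]; exact: Afree.
have VCbase q : VC (base q) by split; exact: VHbase.
have VCconv v w e phi : VC v -> VC w -> sh v = sh w ->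
    cut o t phi e -> phi v <> phi w -> EC e.
  move=> [vA vB] [wA wB] vw ce pvw.
  by split; [exact: (VHconv A v w _ phi)|exact: (VHconv B v w _ phi)].
have [k1 [k [_ cC _]]] := bridges_count_exists Cs VCVT VCA ECA ECVC cEC.
have kge := bridges_ge Cs VCVT VCA ECA ECVC Cfree VCbase VCconv cEC CZ zinj zZ cC.
have kle : (k <= kA * kB)%N.
  apply: (class_count_le (Q := fun e p => p = (e, e))) cC (class_count_prod cA cB).
    move=> e [[EA EB] nb]; exists (e, e) => //; split; split => //= h; apply: nb.
      exact: (nonbridge_mono ECVC (fun v (Sv : VC v) => Sv.1)
        (fun f (Ef : EC f) => Ef.1) (conj (conj EA EB) h)).
    exact: (nonbridge_mono ECVC (fun v (Sv : VC v) => Sv.2)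
      (fun f (Ef : EC f) => Ef.2) (conj (conj EA EB) h)).
  by move=> e e' _ _ _ _ _ _ -> -> /= []; exact: orbC.
have kA' : (kA <= n * r.-1)%N by nia.
have kB' : (kB <= n * r'.-1)%N by nia.
have : (n * m.-1 <= (n * r.-1) * (n * r'.-1))%N.
  by apply: leq_trans (leq_mul kA' kB'); apply: leq_trans kle; nia.
(* One of the two factors [n] on the right cancels against the one on the left. *)
by rewrite -mulnA leq_pmul2l // mulnCA.
Qed.

End BridgeCount.

(** * The Bass-Serre forest *)

Lemma finite_index_coset (G : groupType) (F : set G) :
  is_subgroup F -> finite_set (left_cosets F) ->
  exists (sigma : G -> 'I_#|` fset_set (left_cosets F)|)
    (s : 'I_#|` fset_set (left_cosets F)| -> G),
  (forall g h, sigma g = sigma h <-> F (g^-1 * h)) /\ (forall q, sigma (s q) = q).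
Proof.
move=> Fs fin; set fs := fset_set (left_cosets F).
have memF g : left_coset F g \in fs by rewrite in_fset_set // mem_set //; exists g.
have lt g : (index (left_coset F g) fs < #|` fs|)%N by rewrite index_mem memF.
have /choice[s sP] : forall q : 'I_#|` fs|, exists g, left_coset F g = nth (left_coset F 1) fs q.
  move=> q; have := mem_nth (left_coset F 1) (ltn_ord q).
  by rewrite -[_ \in _]/(_ \in fs) in_fset_set // in_setE => -[g _ gE]; exists g.
exists (fun g => Ordinal (lt g)), s; split.
- move=> g h; rewrite -(left_coset_eq g h Fs); split=> [[e]|e].
    by rewrite -[LHS](nth_index (left_coset F 1) (memF g)) e nth_index //; exact: memF.
  by apply/val_inj => /=; rewrite e.
- by move=> q; apply/val_inj; rewrite /= sP index_uniq // fset_uniq.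
Qed.

Section BassSerre.
Variables (G : groupType) (I : Type) (Gi : I -> set G) (F : set G).
Hypotheses (Fs : is_subgroup F) (FG : is_free_product Gi F).
Hypothesis Gio : forall i, left_orderable (Gi i).
Variables (n : nat) (sigma : G -> 'I_n) (s : 'I_n -> G).
Hypothesis sigmaE : forall g h, sigma g = sigma h <-> F (g^-1 * h).
Hypothesis sigmas : forall q, sigma (s q) = q.

(* |G : F| disjoint copies of the Bass-Serre tree of F, permuted by G: the edge
   (g, i) joins g to g G_i, and G acts by left multiplication. *)
Let V : choiceType := (option {classic I} * set G)%type.
Let E : choiceType := (G * {classic I})%type.

Let o (e : E) : V := (None, [set e.1]).
Let t (e : E) : V := (Some e.2, left_coset (Gi e.2) e.1).
(** Group elements are stored as singletons so that one translation of sets, [left_coset v.2 a],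
    moves both kinds of vertices. *)
Let av (a : G) (v : V) : V := (v.1, left_coset v.2 a).
Let ae (a : G) (e : E) : E := (a * e.1, e.2).
Let VT : set V := [set v | (exists g, v = (None, [set g])) \/ exists e, v = t e].
Let rep (S : set G) : G := xget 1 S.
(** The sheet is the coset of [F] of any element of the vertex; the choice does not matter since the
    factors lie in [F]. *)
Let sh (v : V) : 'I_n := sigma (rep v.2).

Let Gs i : is_subgroup (Gi i) := factor_subgroup FG i.

Let rep1 g : rep [set g] = g.
Proof. by have : [set g] (rep [set g]) by exact: (@xgetPex _ 1 [set g] (ex_intro _ g erefl)). Qed.

Let repG i g : exists2 x, Gi i x & rep (left_coset (Gi i) g) = g * x.
Proof.
have : left_coset (Gi i) g (rep (left_coset (Gi i) g)).
  apply: (@xgetPex _ 1); exists g; exists 1; [exact: subgroup1|by rewrite mulg1].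
by case=> x Gx <-; exists x.
Qed.

Let sigma_factor i g x : Gi i x -> sigma (g * x) = sigma g.
Proof. by move=> Gx; apply/esym/sigmaE; rewrite mulKg; exact: factor_sub FG _ _ Gx. Qed.

Let sho g : sh (None, [set g]) = sigma g.
Proof. by rewrite /sh /= rep1. Qed.

Let sht e : sh (t e) = sigma e.1.
Proof. by rewrite /sh /=; have [x Gx ->] := repG e.2 e.1; exact: sigma_factor Gx. Qed.

Let av1 v : av 1 v = v.
Proof.
case: v => c S; rewrite /av /left_coset; congr pair => /=.
by apply/seteqP; split => [_ [x Sx <-]|x Sx]; [rewrite mul1g|exists x; rewrite ?mul1g].
Qed.

Let left_cosetM (S : set G) g h : left_coset S (g * h) = left_coset (left_coset S h) g.
Proof.
apply/seteqP; split => [_ [x Sx <-]|_ [_ [x Sx <-] <-]].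
  by exists (h * x); [exists x|rewrite mulgA].
by exists x => //; rewrite mulgA.
Qed.

Let avM g h v : av (g * h) v = av g (av h v).
Proof. by rewrite /av left_cosetM. Qed.

Let ae1 e : ae 1 e = e.
Proof. by case: e => g i; rewrite /ae mul1g. Qed.

Let aeM g h e : ae (g * h) e = ae g (ae h e).
Proof. by rewrite /ae mulgA. Qed.

Let av_o g h : av g (None, [set h]) = (None, [set g * h]).
Proof. by rewrite /av /= /left_coset image_set1. Qed.

Let o_av g e : o (ae g e) = av g (o e).
Proof. by rewrite av_o. Qed.

Let t_av g e : t (ae g e) = av g (t e).
Proof. by rewrite /t /= left_cosetM. Qed.

Let VTG g v : VT v -> VT (av g v).
Proof.
move=> [[h ->]|[e ->]]; first by left; exists (g * h); rewrite av_o.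
by right; exists (ae g e); rewrite t_av.
Qed.

Let sh_av g v h : VT v -> sh v = sigma h -> sh (av g v) = sigma (g * h).
Proof.
have sig x y : sigma x = sigma y -> sigma (g * x) = sigma (g * y).
  by move=> /sigmaE xy; apply/sigmaE; rewrite invgM -mulgA mulKg.
move=> [[k ->]|[e ->]]; first by rewrite av_o !sho; exact: sig.
by rewrite -t_av !sht; exact: sig.
Qed.

Let shG g u v : VT u -> VT v -> sh u = sh v -> sh (av g u) = sh (av g v).
Proof.
move=> Vu Vv uv; rewrite (sh_av g Vu (esym (sigmas _))) uv.
by rewrite (sh_av g Vv (esym (sigmas _))).
Qed.

Let sh_edge e : sh (o e) = sh (t e).
Proof. by rewrite sho sht. Qed.

Let VT_edge e : VT (o e) /\ VT (t e).
Proof. by split; [left; exists e.1|right; exists e]. Qed.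

Let free_edge g e : ae g e = e -> g = 1.
Proof. by case: e => h i [] /(canRL (mulgK _)); rewrite mulgV. Qed.

Let walk v w : VT v -> VT w -> sh v = sh w ->
  exists2 p, path (adj o t) v p & last v p = w.
Proof.
pose conn u u' := exists2 p, path (adj o t) u p & last u p = u'.
have trans u u' u'' : conn u u' -> conn u' u'' -> conn u u''.
  move=> [p up <-] [q uq <-]; exists (p ++ q); last by rewrite last_cat.
  by rewrite cat_path up.
have ot e : conn (o e) (t e).
  by exists [:: t e] => //=; rewrite andbT; apply/asboolP; exists e; left.
have to e : conn (t e) (o e).
  by exists [:: o e] => //=; rewrite andbT; apply/asboolP; exists e; right.
(* Reachability of [h] from [g] is a proposition unchanged under multiplying [h] by a factor element
   [x]: both [h] and [h * x] are adjacent to the vertex [h G_i]. *)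
have oo g h : F (g^-1 * h) -> conn (None, [set g]) (None, [set h]).
  move=> Fgh; suff <- : conn (None, [set g]) (None, [set g]) =
      conn (None, [set g]) (None, [set h]) by exists [::].
  apply/esym; apply: (free_product_const FG
    (f := fun h => conn (None, [set g]) (None, [set h]))) Fgh => {}h i x Gx.
  have tE : t (h * x, i) = t (h, i).
    by rewrite /t /=; congr pair; apply/left_coset_eq => //; rewrite invgM mulgVK; exact: subgroupV.
  apply/propext; split=> c; apply: (trans _ _ _ c).
    apply: (@trans _ (t (h * x, i))); first exact: (ot (h * x, i)).
    by rewrite tE; exact: (to (h, i)).
  apply: (@trans _ (t (h, i))); first exact: (ot (h, i)).
  by rewrite -tE; exact: (to (h * x, i)).
have out u : VT u -> exists g, [/\ sigma g = sh u, conn u (None, [set g])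
    & conn (None, [set g]) u].
  move=> [[g ->]|[e ->]]; first by exists g; split; rewrite ?sho //; exists [::].
  by exists e.1; split; [rewrite sht|exact: to|exact: ot].
move=> /out[g [gv vg _]] /out[h [hw _ hw']] vw.
apply: (trans _ _ _ vg); apply: (trans _ _ _ _ hw'); apply: oo; apply/sigmaE.
by rewrite gv vw.
Qed.

Let integral (eps : E -> bool) : exists phi : V -> bool,
  forall e, phi (o e) (+) phi (t e) = eps e.
Proof.
have [phi phiE] := free_product_integral Fs FG (fun g i => eps (g, i)).
exists (fun v => if v.1 is Some i then phi (rep v.2) (+) eps (rep v.2, i)
  else phi (rep v.2)) => -[g i] /=.
rewrite rep1; have [x Gx ->] := repG i g; rewrite (phiE _ i) //.
by case: (phi g); case: (eps _); case: (eps _).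
Qed.

Let base q : V := (None, [set s q]).

(** Stabilizers are trivial at group elements and are conjugates of the factors at cosets. *)
Lemma conjugate_free_action (A : set G) :
  (forall i g, A `&` conjugate (Gi i) g = [set 1]) ->
  forall a v, A a -> VT v -> av a v = v -> a = 1.
Proof.
move=> Atriv a v Aa [[g ->]|[[g i] ->]].
  rewrite av_o => -[] e; have : [set g] (a * g) by rewrite -e.
  by move=> /(canRL (mulgK _)); rewrite mulgV.
rewrite -t_av /t /= => -[] /(left_coset_eq _ _ (Gs i)); rewrite invgM -mulgA => h.
have : (A `&` conjugate (Gi i) g^-1) a.
  split => //; exists (g^-1 * (a * g)).
    have := subgroupV (Gs i) h; by rewrite !invgM !invgK mulgA.
  by rewrite /conjg invgK !mulgA mulgV mul1g mulgK.
by rewrite Atriv.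
Qed.

Lemma virtual_free_product_rank_le (A B X Y Z : set G) r r' m
    (x : 'I_r -> G) (y : 'I_r' -> G) (z : 'I_m -> G) :
  is_subgroup A -> is_subgroup B -> is_free_basis A X -> is_free_basis B Y ->
  is_free_basis (A `&` B) Z ->
  (forall i g, A `&` conjugate (Gi i) g = [set 1]) ->
  (forall i g, B `&` conjugate (Gi i) g = [set 1]) ->
  (forall l : seq G, exists2 a, A a & a \notin l) ->
  (forall l : seq G, exists2 a, B a & a \notin l) ->
  (forall y, X y -> exists i, y = x i) -> (forall i, X (x i)) ->
  (forall x, Y x -> exists i, x = y i) -> (forall i, Y (y i)) ->
  injective z -> (forall i, Z (z i)) -> (0 < n)%N ->
  (m.-1 <= n * (r.-1 * r'.-1))%N.
Proof.
move=> As Bs AX BY CZ Atriv Btriv Ainf Binf xs xX ys yY zinj zZ n0.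
have [P [PF PM P1 Ptot]] := free_product_cone Fs FG Gio.
have [lt [ltxx ltT lttot]] := strict_total_exists I.
pose ltG g h := P (g^-1 * h).
have ltGT g h k : ltG g h -> ltG h k -> ltG g k.
  by move=> gh hk; have := PM _ _ gh hk; rewrite -mulgA mulVKg.
have ltGxx g : ~ ltG g g by rewrite /ltG mulVg.
have ltGtot g h : sigma g = sigma h -> [\/ g = h, ltG g h | ltG h g].
  move=> /sigmaE Fgh; have [e|ne] := pselect (g^-1 * h = 1).
    by constructor 1; rewrite -[h](mulVKg g) e mulg1.
  have [Pgh|] := Ptot _ Fgh ne; first by constructor 2.
  by rewrite invgM invgK; constructor 3.
(* Lexicographic: left multiplication moves only the group element and keeps the factor index, so
   the order is invariant. *)
pose ltE (d e : E) := ltG d.1 e.1 \/ d.1 = e.1 /\ lt d.2 e.2.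
apply: (@intersection_rank_le V E o t n sh VT G av ae sh_edge VT_edge walk integral av1 avM
  ae1 aeM o_av t_av VTG shG free_edge base s _ _ ltE ltG _ _ _ _ ltGxx ltGT _ _
  A B X Y Z r r' m x y z As Bs AX BY CZ _ _ Ainf Binf xs xX ys yY zinj zZ n0).
- by move=> q; left; exists (s q).
- by move=> q; rewrite sho.
- by move=> e [/ltGxx|[_ /ltxx]].
- move=> d e f [de|[de1 de2]] [ef|[ef1 ef2]].
  + by left; exact: ltGT ef.
  + by left; rewrite -ef1.
  + by left; rewrite de1.
  + by right; split; [rewrite de1|exact: ltT ef2].
- move=> [g i] [h j]; rewrite !sho /= => /ltGtot[e|gh|hg]; last by constructor 3; left.
    subst h; have [->|ij|ji] := lttot i j; first by constructor 1.
      by constructor 2; right.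
    by constructor 3; right.
  by constructor 2; left.
- move=> g d e [de|[de1 de2]]; [left|by right; rewrite /= de1].
  by rewrite /ltG /= invgM -mulgA mulKg.
- move=> g h q; rewrite !av_o !sho => /ltGtot[/mulIg e|l|l]; by [constructor 1|constructor 2|constructor 3].
- by move=> k g h gh; rewrite /ltG invgM -mulgA mulKg.
- exact: conjugate_free_action.
- exact: conjugate_free_action.
Qed.

End BassSerre.

(** * Ranks *)

Section FreeRank.
Variables (G : groupType) (H X : set G).
Hypotheses (Hs : is_subgroup H) (HX : is_free_basis H X).

Lemma free_basis_neq0 : H <> [set 1] -> X !=set0.
Proof.
move=> H1; apply: contrapT => X0; apply: H1; apply/seteqP.
split=> [h /(free_basis_word HX)[s [/andP[sX _] <-]]|_ ->]; last exact: subgroup1.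
case: s sX => [|a s /andP[]]; first by rewrite big_nil.
by rewrite in_setE => Xa; case: X0; exists a.1.
Qed.

(** The powers of one basis element are pairwise distinct. *)
Lemma free_infinite : X !=set0 -> forall l : seq G, exists2 a, H a & a \notin l.
Proof.
move=> [x Xx] l; apply: contrapT => nl.
have all_l a : H a -> a \in l.
  by move=> Ha; apply: contrapT => /negP al; apply: nl; exists a.
pose w k := nseq k (x, false).
have wr k : reduced_word X (w k).
  apply/andP; split; first by rewrite all_nseq /= mem_set ?orbT.
  by case: k => //= k; elim: k => //= k ->; rewrite !eqxx.
have wH k : word_val (w k) \in l.
  apply: all_l; apply: word_val_subgroup Hs (free_basis_sub HX) _.
  by case/andP: (wr k).
have := @uniq_leq_size _ [seq word_val (w k) | k <- iota 0 (size l).+1] l.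
rewrite size_map size_iota ltnn => h; suff : false by [].
apply: h => [|_ /mapP[k _ ->] //].
rewrite map_inj_uniq ?iota_uniq // => j k /(free_basis_uniq HX (wr j) (wr k)).
by move=> /(congr1 size); rewrite !size_nseq.
Qed.

Lemma free_basis_comm x y : X x -> X y -> x * y = y * x -> x = y.
Proof.
move=> Xx Xy xy.
have wr a b : X a -> X b -> reduced_word X [:: (a, false); (b, false)].
  by move=> Xa Xb; rewrite /reduced_word /= !mem_set //= implybT.
have := free_basis_uniq HX (wr x y Xx Xy) (wr y x Xy Xx).
by rewrite !big_cons !big_nil /letter_val /= !mulg1 => /(_ xy)[].
Qed.

Lemma free_rank1_comm : (forall x y, X x -> X y -> x = y) ->
  forall g h, H g -> H h -> g * h = h * g.
Proof.
move=> X1.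
have comm (k : G) : H k -> (forall x, X x -> k * x = x * k) ->
    forall h, H h -> k * h = h * k.
  move=> Hk kX h Hh; suff <- : (k * 1 = 1 * k) = (k * h = h * k) by rewrite mulg1 mul1g.
  apply/esym; apply: (free_basis_const Hs HX (f := fun h => k * h = h * k)) Hh => {}h x Hh Xx.
  rewrite mulgA -[h * x * k]mulgA -(kX x) // mulgA; apply/propext; split=> [/mulIg //|->//].
move=> g h Hg Hh; apply: (comm g) => // x Xx; apply/esym; apply: (comm x) => //.
  exact: free_basis_sub HX _ Xx.
by move=> y Xy; rewrite (X1 x y).
Qed.

(** Elements inject into words in letters; letters, with their signs, are words of length 1 or 2 in
    [X]; and [X] injects into words over [minus_one X], the removed element becoming the empty
    word. *)
Lemma card_free_infinite_rank : infinite_set X -> H #<= minus_one X.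
Proof.
move=> Xinf; have Minf : infinite_set (minus_one X).
  by apply: infinite_setD => //; exact: finite_set1.
pose L : set (G * bool) := [set a | X a.1].
have HL : H #<= words_on L.
  have /choice[nf nfP] : forall h, exists s : seq (G * bool), H h ->
      reduced_word X s /\ word_val s = h.
    by move=> h; have [/(free_basis_word HX)[s ?]|] := pselect (H h); [exists s|exists [::]].
  apply: (card_le_of_inj (f := nf)) => [h Hh a|h h' Hh Hh' e].
    have [/andP[/allP nX _] _] := nfP _ Hh.
    have memIn s : List.In a s -> a \in s.
      by elim: s => //= b s IH [->|/IH]; rewrite inE ?eqxx // => ->; rewrite orbT.
    by move=> /memIn/nX; rewrite in_setE.
  by have [_ <-] := nfP _ Hh; have [_ <-] := nfP _ Hh'; rewrite e.
have LX : L #<= X.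
  apply: card_le_trans (card_words_on Xinf).
  apply: (card_le_of_inj (f := fun a : G * bool => if a.2 then [:: a.1] else [:: a.1; a.1])).
    by move=> [x []] /= Xx y /= []; [move=> <-|case|move=> <-|case=> // <-].
  by move=> [x []] [y []] //= _ _ [->].
have XM : X #<= minus_one X.
  apply: card_le_trans (card_words_on Minf).
  apply: (card_le_of_inj (f := fun x => if x == xget 1 X then [::] else [:: x])).
    by move=> x Xx; case: eqVneq => [_ y []|nx y /= [<-|//]]; split => //; exact/eqP.
  by move=> x y _ _; case: eqVneq => [->|_]; case: eqVneq => [->|_] // [].
apply: card_le_trans HL _; apply: card_le_trans (card_le_words_on LX) _.
exact: card_le_trans (card_words_on Xinf) XM.
Qed.

End FreeRank.

Lemma xget1_mem (G : groupType) (X : set G) : X !=set0 -> X (xget 1 X).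
Proof. by move=> [x Xx]; apply: xgetPex; exists x. Qed.

Lemma card_minus_one (G : groupType) (X : set G) : finite_set X -> X !=set0 ->
  #|` fset_set (minus_one X)| = #|` fset_set X|.-1.
Proof.
move=> fX X0; rewrite /minus_one fset_setD1 // [in RHS](cardfsD1 (xget 1 X)).
by rewrite in_fset_set // mem_set //; exact: xget1_mem.
Qed.

Lemma finite_enum (G : groupType) (X : set G) : finite_set X ->
  exists x : 'I_#|` fset_set X| -> G, [/\ forall y, X y -> exists i, y = x i,
    forall i, X (x i) & injective x].
Proof.
move=> fX; exists (fun i => nth 1 (fset_set X) i); split.
- move=> y Xy; have yX : y \in fset_set X by rewrite in_fset_set // mem_set.
  have lt : (index y (fset_set X) < #|` fset_set X|)%N by rewrite index_mem.
  by exists (Ordinal lt); rewrite /= nth_index.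
- move=> i; have := mem_nth 1 (ltn_ord i).
  by rewrite -[_ \in _]/(_ \in fset_set X) in_fset_set // in_setE.
- by move=> i j /eqP; rewrite nth_uniq ?fset_uniq // => /eqP/val_inj.
Qed.

Lemma card_fsetM (T U : choiceType) (S : {fset T}) (R : {fset U}) :
  #|` (S `*` R)%fset| = (#|` S| * #|` R|)%N.
Proof.
rewrite -(size_allpairs pair); apply/perm_size/uniq_perm; rewrite ?fset_uniq //.
  by apply: allpairs_uniq; rewrite ?fset_uniq // => -[x y] [x' y'] _ _ [-> ->].
move=> [x y]; rewrite -[_ \in _]/(_ \in (S `*` R)%fset) in_fsetM.
apply/andP/allpairsP => [[xS yR]|[[x' y'] [/= xS yR [-> ->]]] //].
by exists (x, y).
Qed.

Theorem theorem2 (G : groupType) (F : set G) (I : Type) (Gi : I -> set G)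
    (F_subgroup : is_subgroup F)
    (F_finite_index : finite_set (left_cosets F))
    (F_free_product : is_free_product Gi F)
    (Gi_left_orderable : forall i, left_orderable (Gi i))
    (A B : set G)
    (A_free : is_free_subgroup A) (B_free : is_free_subgroup B)
    (A_nontrivial : A <> [set 1]) (B_nontrivial : B <> [set 1])
    (A_trivial_meet : forall i g, A `&` conjugate (Gi i) g = [set 1])
    (B_trivial_meet : forall i g, B `&` conjugate (Gi i) g = [set 1]) :
  is_free_subgroup (A `&` B) /\
  (forall X Y Z : set G,
     is_free_basis A X -> is_free_basis B Y -> is_free_basis (A `&` B) Z ->
     minus_one Z #<= left_cosets F `*` (minus_one X `*` minus_one Y)).
Proof.
have As : is_subgroup A by case: A_free.
have Bs : is_subgroup B by case: B_free.
have Cs := subgroupI As Bs.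
split; first by case: A_free => _ [X AX]; apply: free_subgroup_of_free As AX Cs _ => x [].
move=> X Y Z AX BY CZ.
have X0 := free_basis_neq0 As AX A_nontrivial.
have Y0 := free_basis_neq0 Bs BY B_nontrivial.
have ZC := free_basis_sub CZ.
(* A group of rank at most 1 is commutative, so its free subgroup [A]&[B] has at most one basis
   element. *)
have rank1 D W : is_subgroup D -> is_free_basis D W -> A `&` B `<=` D ->
    (forall x y, W x -> W y -> x = y) -> minus_one Z = set0.
  move=> Ds DW CD W1; apply/seteqP; split => // z [Zz zn]; apply: zn => /=.
  have Zg := xget1_mem (ex_intro _ z Zz).
  apply: (free_basis_comm CZ) => //.
  by apply: (free_rank1_comm Ds DW) => //; apply: CD; exact: ZC.
have minus_neq0 (W : set G) : W !=set0 -> (forall x y, W x -> W y -> x = y) \/ minus_one W !=set0.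
  move=> W0; have [[x Wx]|W1] := pselect (minus_one W !=set0); first by right; exists x.
  left=> x y Wx Wy; have all z : W z -> z = xget 1 W.
    by move=> Wz; apply: contrapT => nz; apply: W1; exists z.
  by rewrite (all x) // (all y).
(* Once rank 1 is settled, both [minus_one X] and [minus_one Y] have elements; these fill the other
   coordinate in the infinite cases. *)
case: (minus_neq0 X X0) => [X1|[x0 Mx0]].
  by rewrite (rank1 A X As AX _ X1) ?card_ge0 // => x [].
case: (minus_neq0 Y Y0) => [Y1|[y0 My0]].
  by rewrite (rank1 B Y Bs BY _ Y1) ?card_ge0 // => x [].
have F1 : left_cosets F (left_coset F 1) by exists 1.
have MZ : minus_one Z #<= Z by apply: subset_card_le => z [].
have [Xfin|Xinf] := pselect (finite_set X); last first.
  apply: card_le_trans MZ _.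
  apply: (@card_le_trans _ _ _ A); first by apply: subset_card_le => z /ZC[].
  apply: card_le_trans (card_free_infinite_rank AX Xinf) _.
  apply: (card_le_of_inj (f := fun x => (left_coset F 1, (x, y0)))) => //.
  by move=> x x' _ _ [].
have [Yfin|Yinf] := pselect (finite_set Y); last first.
  apply: card_le_trans MZ _.
  apply: (@card_le_trans _ _ _ B); first by apply: subset_card_le => z /ZC[].
  apply: card_le_trans (card_free_infinite_rank BY Yinf) _.
  apply: (card_le_of_inj (f := fun y => (left_coset F 1, (x0, y)))) => //.
  by move=> y y' _ _ [].
have [sigma [s [sigmaE sigmas]]] := finite_index_coset F_subgroup F_finite_index.
have n0 : (0 < #|` fset_set (left_cosets F)|)%N.
  by rewrite cardfs_gt0; apply/fset0Pn; exists (left_coset F 1); rewrite in_fset_set // mem_set.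
have [x [xs xX _]] := finite_enum Xfin; have [y [ys yY _]] := finite_enum Yfin.
have main m (z : 'I_m -> G) : injective z -> (forall i, Z (z i)) ->
    (m.-1 <= #|` fset_set (left_cosets F)| *
      (#|` fset_set (minus_one X)| * #|` fset_set (minus_one Y)|))%N.
  move=> zinj zZ; rewrite !card_minus_one //.
  exact: (virtual_free_product_rank_le F_subgroup F_free_product Gi_left_orderable sigmaE
    sigmas As Bs AX BY CZ A_trivial_meet B_trivial_meet (free_infinite As AX X0)
    (free_infinite Bs BY Y0) xs xX ys yY zinj zZ n0).
have Mfin (W : set G) : finite_set W -> finite_set (minus_one W) by move=> ?; exact: finite_setD.
have MXY := finite_setX (Mfin _ Xfin) (Mfin _ Yfin).
have [Zfin|Zinf] := pselect (finite_set Z); last first.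
  (* At least [N.+2] elements of an infinite basis would give [N.+1 <= N]. *)
  exfalso; set N := (#|` fset_set (left_cosets F)| *
    (#|` fset_set (minus_one X)| * #|` fset_set (minus_one Y)|))%N in main.
  have [Z' Z'Z cZ'] := infinite_set_fset N.+2 Zinf.
  have [z [_ zZ zinj]] := finite_enum (finite_fset Z').
  have := main _ z zinj (fun i => Z'Z _ (zZ i)); rewrite set_fsetK; lia.
have [Z0|Z0] := pselect (Z !=set0); last first.
  rewrite (_ : minus_one Z = set0) ?card_ge0 //.
  by apply/seteqP; split => // z [Zz _]; case: Z0; exists z.
have [z [_ zZ zinj]] := finite_enum Zfin.
have := main _ z zinj zZ; rewrite -card_minus_one // => le.
have fZ := Mfin _ Zfin; have RHSfin := finite_setX F_finite_index MXY.
have cardI (T : choiceType) (S : set T) : finite_set S -> S #= `I_#|` fset_set S|.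
  by move=> fS; have [k Sk] := (finite_setP S).1 fS; rewrite (card_fset_set Sk).
rewrite (card_le_eql (cardI _ _ fZ)) (card_le_eqr (cardI _ _ RHSfin)) card_le_II.
rewrite (fset_setX F_finite_index MXY) (fset_setX (Mfin _ Xfin) (Mfin _ Yfin)).
by apply: leq_trans le _; rewrite leq_eqVlt; apply/orP; left; apply/eqP/esym;
  etransitivity; [exact: card_fsetM|congr (_ * _)%N; exact: card_fsetM].
Qed.
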